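(* Let $s$ be a positive integer. All polynomial tau-functions of the $s$-component KP hierarchy are, up to a shift over the lattice, of the form $$\tau_m(q,t)=\sum_{\substack{m_1,\ldots,m_s\ge0\\ m_1+\cdots+m_s=m}}\tau^{(m_1,m_2,\ldots,m_s)}(t)\,q_1^{m_1}q_2^{m_2}\cdots q_s^{m_s},$$ where $m$ is a positive integer and $\tau^{(m_1,m_2,\ldots,m_s)}(t)$ is the determinant of the $m\times m$ matrix whose entry in row $m_1+\cdots+m_{a-1}+i$ (with $1\le a\le s$, $1\le i\le m_a$) and column $j$ ($1\le j\le m$) is $$\frac{\partial^{\,m_a-i+1}h_j(t)}{\partial (t_1^{(a)})^{m_a-i+1}}.$$ (So the rows consist of $s$ consecutive blocks, the $a$-th block consisting of the derivatives of $(h_1,\ldots,h_m)$ with respect to $t_1^{(a)}$ of orders $m_a,m_a-1,\ldots,1$, from top to bottom; the block is empty if $m_a=0$.) Here $$h_j(t)=\sum_{a=1}^s b^{(a)}_{j}\,s_{M_j^{(a)}}(t^{(a)}+c_j^{(a)}),\qquad j=1,\ldots,m,$$ where $M_j^{(a)}$ are arbitrary positive integers, and $c_j^{(a)}=(c_{1j}^{(a)},c_{2j}^{(a)},c_{3j}^{(a)},\ldots)$ and $b^{(a)}_{j}$, for $1\le j\le m$ and $1\le a\le s$, are arbitrary complex constants. That is, every polynomial tau-function of the $s$-component KP hierarchy is a shift over the lattice of such a $\tau_m(q,t)$ for some choice of these data, and conversely, for every choice of the data, every lattice shift of $\tau_m(q,t)$, if nonzero, is a polynomial tau-function of the $s$-component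 KP hierarchy.
   Context: Variables: $t=(t_k^{(a)})_{1\le a\le s,\ k\ge1}$, with $t^{(a)}=(t_1^{(a)},t_2^{(a)},\ldots)$, a second copy $y=(y_k^{(a)})$, and $q_1^{\pm1},\ldots,q_s^{\pm1}$; all commute. The elementary Schur polynomials in one set of variables $u=(u_1,u_2,\ldots)$ are defined by $\exp\left(\sum_{i\ge1}u_iz^i\right)=\sum_{j\ge0}s_j(u)z^j$. Write ${\rm Res}\,dz\sum_i f_iz^i=f_{-1}$. A polynomial tau-function of the $s$-component KP hierarchy is, for some $k\in\mathbb{Z}$, a nonzero element $$\tau(q,t)=\sum_{\substack{(m_1,\ldots,m_s)\in\mathbb{Z}^s\\ m_1+\cdots+m_s=k}}\tau^{(m_1,\ldots,m_s)}(t)\,q_1^{m_1}\cdots q_s^{m_s}$$ of $\mathbb{C}[q_a^{\pm1};1\le a\le s]\otimes\mathbb{C}[t_1^{(a)},t_2^{(a)},\ldots;1\le a\le s]$ (so only finitely many $\tau^{(m_1,\ldots,m_s)}$ are nonzero and each is a polynomial) such that for all $(m_1,\ldots,m_s),(p_1,\ldots,p_s)\in\mathbb{Z}^s$ with $\sum_a m_a=k+1$ and $\sum_a p_a=k-1$ one has, identically in $t$ and $y$ (as formal power series in $t,y$ after expanding the exponential), $$\begin{aligned}{\rm Res}\,dz\sum_{a=1}^s&(-1)^{m_1+\cdots+m_{a-1}+p_1+\cdots+p_{a-1}}z^{m_a-p_a-2}\exp\left(\sum_{i=1}^\infty(t_i^{(a)}-y_i^{(a)})z^i\right)\\ &\times\exp\left(\sum_{i=1}^\infty\frac{\frac{\partial}{\partial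 y_i^{(a)}}-\frac{\partial}{\partial t_i^{(a)}}}{i}z^{-i}\right)\tau^{(m_1,\ldots,m_a-1,\ldots,m_s)}(t)\,\tau^{(p_1,\ldots,p_a+1,\ldots,p_s)}(y)=0.\end{aligned}$$ A shift over the lattice by $(d_1,\ldots,d_s)\in\mathbb{Z}^s$ means relabeling $(m_1,\ldots,m_s)\mapsto(m_1+d_1,\ldots,m_s+d_s)$ of the components, i.e. multiplying $\tau(q,t)$ by $q_1^{d_1}\cdots q_s^{d_s}$. *)

(* Defs.v *)
From HB Require Import structures.
From mathcomp Require Import all_boot all_order all_algebra.
From mathcomp Require Import finmap.
From mathcomp Require Import reals.
From mathcomp Require Import complex.
From mathcomp Require Import monalg.

Set Implicit Arguments.
Unset Strict Implicit.
Unset Printing Implicit Defensive.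

Import GRing.Theory.
Local Open Scope ring_scope.

(* Polynomials over K in the (possibly infinitely many) commuting variables
   indexed by I. *)
Notation mpol K I := {malg K[{cmonom I}]}.

Section Polynomials.
Context {K : comNzRingType}.

Definition var {I : choiceType} (i : I) : mpol K I := << ucm i >>.

Definition pderiv {I : choiceType} (i : I) (f : mpol K I) : mpol K I :=
  \sum_(m <- msupp f) << f@_m *+ m i *g divcm m (ucm i) >>.

Definition rename {I J : choiceType} (r : I -> J) (f : mpol K I) : mpol K J :=
  mmap (fun x => x%:MP)
    (fun m : {cmonom I} => \prod_(i <- finsupp m) var (r i) ^+ m i) f.

End Polynomials.

(* A formal power series over A is given by its sequence of coefficients. *)
Section PowerSeries.
Context {K : fieldType}.

Definition psconst {A : nmodType} (x : A) : nat -> A :=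
  fun l => if l == 0%N then x else 0.

(* The series (exp D) f, where D is a linear operator on series which raises
   the order by at least 1: the terms D^n f / n! with n > l do not contribute
   to the coefficient of order l. *)
Definition psexp {A : lmodType K} (D : (nat -> A) -> (nat -> A))
    (f : nat -> A) : nat -> A :=
  fun l => \sum_(n < l.+1) (n`!%:R)^-1 *: iter n D f l.

(* Multiplication by u_1 z + u_2 z^2 + ...; the value u 0 is never used. *)
Definition psmul {A : comAlgType K} (u f : nat -> A) : nat -> A :=
  fun l => \sum_(1 <= i < l.+1) u i * f (l - i)%N.

(* The coefficient of z^j in exp (u_1 z + u_2 z^2 + ...). *)
Definition schur {A : comAlgType K} (u : nat -> A) (j : nat) : A :=
  psexp (psmul u) (psconst 1) j.

End PowerSeries.

Section MultiKP.
Variables (R : realType) (s : nat).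

(* (a, k) is the index of the variable t_{k+1}^{(a)}: the variables are
   numbered from 1, as opposed to nat; components are numbered from 0. *)
Notation tidx := ('I_s * nat)%type.

(* C[t], and C[t, y] with the t-variables on the left *)
Notation Ct := (mpol R[i] tidx).
Notation Cty := (mpol R[i] (tidx + tidx)%type).

Definition lattice := {ffun 'I_s -> int}.

(* C[q_a^{+-1}] (x) C[t], as finitely supported functions from the lattice to
   C[t]: the coefficient of q^v in tau is tau@_v. *)
Definition Cqt := {malg Ct[lattice]}.

Definition tvar (a : 'I_s) (k : nat) : Ct := var (a, k.-1).

Definition tyt (a : 'I_s) (k : nat) : Cty := var (inl (a, k.-1)).
Definition tyy (a : 'I_s) (k : nat) : Cty := var (inr (a, k.-1)).

Definition in_t (f : Ct) : Cty := rename inl f.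
Definition in_y (f : Ct) : Cty := rename inr f.

(* The operator \sum_(i >= 1) (d/dy_i^{(a)} - d/dt_i^{(a)}) / i * w^i on series
   in w = z^{-1} with coefficients in C[t, y]. *)
Definition dtyop (a : 'I_s) (f : nat -> Cty) : nat -> Cty :=
  fun l => \sum_(1 <= i < l.+1)
    (i%:R^-1 : R[i]) *: (pderiv (inr (a, i.-1)) (f (l - i)%N)
                         - pderiv (inl (a, i.-1)) (f (l - i)%N)).

(* Coefficient of z^j, for any integer j, in the exponential of
   \sum_(i >= 1) (t_i^{(a)} - y_i^{(a)}) z^i. *)
Definition exp_ty (a : 'I_s) (j : int) : Cty :=
  match j with
  | Posz n => schur (fun i => tyt a i - tyy a i) n
  | Negz _ => 0
  end.

Definition unitv (a : 'I_s) : lattice := [ffun b => (b == a)%:R].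

(* The coefficient of z^{-1} in the a-th summand of the bilinear equation, as
   the sequence of the contributions of the terms z^{-l} of the exponential of
   derivatives: z^(m_a - p_a - 2) z^j z^(-l) is z^{-1} iff
   j = l + 1 - m_a + p_a. *)
Definition res_term (tau : Cqt) (m p : lattice) (a : 'I_s) (l : nat) : Cty :=
  (((-1 : R[i]) ^ (\sum_(b < s | (b < a)%N) (m b + p b)))
   *: (exp_ty a (l%:Z + 1 - m a + p a)
       * psexp (dtyop a) (psconst (in_t (tau@_(m - unitv a))
                                   * in_y (tau@_(p + unitv a)))) l))%R.

(* u_0 + u_1 + ... = 0 for a sum with finitely many nonzero terms. The sum over
   l below is of this kind, the exponential of derivatives being a polynomial
   in z^{-1} when applied to a polynomial. *)
Definition finsum_eq0 (u : nat -> Cty) : Prop :=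
  exists L0, forall L, (L0 <= L)%N -> \sum_(l < L) u l = 0.

Definition kp_bilinear (tau : Cqt) (m p : lattice) : Prop :=
  finsum_eq0 (fun l => \sum_(a < s) res_term tau m p a l).

Definition polynomial_tau (tau : Cqt) : Prop :=
  tau != 0 /\
  exists k : int,
    (forall v : lattice, \sum_a v a != k -> tau@_v = 0) /\
    (forall m p : lattice, \sum_a m a = k + 1 -> \sum_a p a = k - 1 ->
       kp_bilinear tau m p).

Definition lattice_shift (d : lattice) (tau : Cqt) : Cqt :=
  \sum_(v <- msupp tau) << tau@_v *g v + d >>.

Section TauM.
Variables (m : nat) (M : 'I_m -> 'I_s -> nat) (b : 'I_m -> 'I_s -> R[i]).
(* [c j a k] is c_{kj}^{(a)} for k >= 1; [c j a 0] is never used. *)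
Variable c : 'I_m -> 'I_s -> nat -> R[i].

Definition hfun (j : 'I_m) : Ct :=
  \sum_(a < s) b j a *: schur (fun k => tvar a k + (c j a k)%:MP) (M j a).

(* For each a, the derivatives with respect to t_1^{(a)} of orders
   mu_a, mu_a - 1, ..., 1, blocks being ordered by increasing a. There are
   \sum_a mu_a rows. *)
Definition tau_rows (mu : 'I_s -> nat) : seq ('I_m -> Ct) :=
  [seq (fun j => iter k (pderiv (a, 0%N)) (hfun j))
     | a <- enum 'I_s, k <- rev (iota 1 (mu a))].

Definition tau_det (mu : 'I_s -> nat) : Ct :=
  \det (\matrix_(r < m, j < m) nth (fun=> 0) (tau_rows mu) r j).

Definition tau_m : Cqt :=
  \sum_(mu : {ffun 'I_s -> 'I_m.+1} | (\sum_(a < s) mu a)%N == m)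
    << tau_det (fun a => mu a) *g [ffun a => (mu a : nat)%:Z] >>.

End TauM.

End MultiKP.

(* Main.v *)
(* In the bosonic realization the vertex operators are the fermions psi_n^(a) of an
   exterior algebra. A polynomial tau-function, shifted far enough over the lattice, is
   an element of degree m of the algebra generated from the vacuum by the creation
   operators (the modes of positive index), and the residue in the bilinear equation
   becomes the sum of psi_n^(a) tau (x) psi_n^(a)* tau over these modes. So the
   equation is the Pluecker relation, which characterizes the decomposable elements: tau
   is f_1 ... f_m |0>, each f_j being a combination of creation operators. Applying
   psi_n^(a) to a determinant of the stated form adds the column of s_n(t^(a)), so this
   product is such a determinant with columns h_j in the span of the s_k(t^(a)), k > 0.
   Finally, adding constants to h_j changes nothing, and modulo constants a combination
   of s_1, ..., s_M with nonzero top coefficient b is b s_M(t + c) for some c, because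
   s_M(t + c) = sum_i s_i(t) s_{M-i}(c) and the s_k(c), k > 0, can be prescribed. *)
Require Import Defs.
From HB Require Import structures.
From mathcomp Require Import all_boot all_order all_algebra.
From mathcomp Require Import zify ring.
From mathcomp Require Import boolp functions finmap reals complex monalg.
Set Implicit Arguments.
Unset Strict Implicit.
Unset Printing Implicit Defensive.
Import Order.TTheory GRing.Theory Num.Theory.
Local Open Scope ring_scope.

(** The obstacle is that everything infinite must become finite. The full Fock space is
    semi-infinite, but on the part generated from [vac] by positive modes the operators [psi] of
    non-positive index act by zero, since they kill [vac] and anticommute with the generators; and
    all but finitely many contractions kill a given vector. So the residue, a sum over all integers,
    is a finite sum in an ordinary exterior algebra. That every tau-function can be shifted into it
    rests on writing multiplication by s_j(t^(a)) through modes composed with coefficients of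
    exp(sum d_i z^-i / i), which preserve this algebra. Identities between exponentials are not
    checked by expansion: an exponential is the unique solution of its Euler equation. The vertex
    calculus then comes from exp(sum (w/z)^i / i) = 1/(1 - w/z). With one sign only two terms
    survive, which gives anticommutation and, on determinants, differences of consecutive rows; with
    the other sign a geometric series appears, whose two expansions add up to a delta function. *)

(** * Derivations and ring morphisms of polynomial algebras *)

Section Leibniz.
Context {A : pzRingType} (d : {additive A -> A}).
(** A predicate on pairs, because the product rule is propagated by induction on each factor in
    turn. *)
Definition leibniz (f g : A) := d (f * g) = d f * g + f * d g.
Lemma leibnizDl f1 f2 g : leibniz f1 g -> leibniz f2 g -> leibniz (f1 + f2) g.
Proof. by rewrite /leibniz mulrDl !raddfD /= mulrDl => -> ->; rewrite mulrDl addrACA. Qed.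
Lemma leibnizDr f g1 g2 : leibniz f g1 -> leibniz f g2 -> leibniz f (g1 + g2).
Proof. by rewrite /leibniz mulrDr !raddfD /= mulrDr => -> ->; rewrite mulrDr addrACA. Qed.
Lemma leibniz0l g : leibniz 0 g.
Proof. by rewrite /leibniz mul0r raddf0 !mul0r addr0. Qed.
Lemma leibniz0r g : leibniz g 0.
Proof. by rewrite /leibniz mulr0 raddf0 !mulr0 addr0. Qed.
End Leibniz.

Section Pderiv.
Context {K : comNzRingType} {I : choiceType}.
Implicit Types (f g : mpol K I) (m : {cmonom I}) (i j : I).

Lemma divcmMl m1 m2 i : (0 < m1 i)%N ->
  divcm (mulcm m1 m2) (ucm i) = mulcm (divcm m1 (ucm i)) m2.
Proof.
move=> m1i; apply/eqP/cmP=> j; rewrite divcmE !mulcmE divcmE ucmE.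
by case: eqP => [<-|_]; rewrite ?subn0 // addnBAC.
Qed.

(** [pderiv] is a sum over the support. This form has no support in it, and turns linearity and
    commutation into coefficientwise identities. *)
Lemma mcoeff_pderiv i f m :
  (pderiv i f)@_m = f@_(mulcm m (ucm i)) *+ (m i).+1.
Proof.
rewrite /pderiv raddf_sum /=.
have key (k : {cmonom I}) : << f@_k *+ k i *g divcm k (ucm i) >>@_m
    = (f@_k *+ k i) *+ (k == mulcm m (ucm i)).
  rewrite mcoeffU; case: (posnP (k i)) => [->|ki]; first by rewrite mulr0n !mul0rn.
  congr (_ *+ nat_of_bool _); apply/eqP/eqP => [<-|->].
    apply/eqP/cmP=> j; rewrite mulcmE divcmE ucmE.
    by case: eqP => [<-|_]; rewrite ?subn0 ?addn0 // subnK.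
  by apply/eqP/cmP=> j; rewrite divcmE mulcmE ucmE addnK.
under eq_bigr => k _ do rewrite key.
case: (msuppP f (mulcm m (ucm i))) => [km|km].
  rewrite (big_fsetD1 _ km) /= eqxx mulr1n big1_fset => [|k]; last first.
    by rewrite in_fsetD1 => /andP[/negPf-> _]; rewrite mulr0n.
  by rewrite addr0 mulcmE ucmE eqxx addn1.
rewrite mul0rn big1_fset // => k kf _.
by case: eqP => // keq; rewrite -keq kf in km.
Qed.

Lemma pderivU i (c : K) m : pderiv i << c *g m >> = << c *+ m i *g divcm m (ucm i) >>.
Proof.
rewrite /pderiv msuppU; case: eqP => [->|_]; first by rewrite big_seq_fset0 mul0rn monalgU0.
by rewrite big_seq_fset1 mcoeffUU.
Qed.

End Pderiv.

(* [pder], [mon], [meval] and [ren] are locked because conversion would otherwise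
   unfold the operations of the monoid algebra. *)
HB.lock Definition pder {K : comNzRingType} {I : choiceType} (i : I)
  (f : mpol K I) : mpol K I := pderiv i f.

HB.lock Definition mon {K : comNzRingType} {I : choiceType} (c : K)
  (m : {cmonom I}) : mpol K I := << c *g m >>.

Section Pder.
Context {K : comNzRingType} {I : choiceType}.
Implicit Types (f g : mpol K I) (m : {cmonom I}) (i j : I).

Lemma mcoeff_pder i f m :
  (pder i f)@_m = f@_(mulcm m (ucm i)) *+ (m i).+1.
Proof. by rewrite pder.unlock mcoeff_pderiv. Qed.

Lemma pderU i (c : K) m : pder i << c *g m >> = << c *+ m i *g divcm m (ucm i) >>.
Proof. by rewrite pder.unlock pderivU. Qed.

Lemma mpolZE (c : K) f m : (c *: f)@_m = c * f@_m.
Proof. exact: mcoeffZ. Qed.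

Lemma pderD i f g : pder i (f + g) = pder i f + pder i g.
Proof. by apply/malgP=> m; rewrite mcoeffD !mcoeff_pder mcoeffD mulrnDl. Qed.

Lemma pderZ i (c : K) f : pder i (c *: f) = c *: pder i f.
Proof. by apply/malgP=> m; rewrite mpolZE !mcoeff_pder mpolZE mulrnAr. Qed.

Lemma pder_is_linear i (c : K) f g :
  pder i (c *: f + g) = c *: pder i f + pder i g.
Proof. by rewrite pderD pderZ. Qed.
HB.instance Definition _ i := GRing.isLinear.Build K (mpol K I) (mpol K I) *:%R
  (@pder K I i) (pder_is_linear i).

Lemma pder_comm i j f : pder i (pder j f) = pder j (pder i f).
Proof.
apply/malgP=> m; rewrite !mcoeff_pder.
have -> : mulcm (mulcm m (ucm i)) (ucm j) = mulcm (mulcm m (ucm j)) (ucm i).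
  by rewrite -!mulcmA [mulcm (ucm i) _]mulcmC.
rewrite !mulcmE !ucmE -!mulrnA eq_sym.
by case: (eqVneq j i) => [->|_]; rewrite ?addn0 // mulnC.
Qed.

Lemma mon0 m : mon 0 m = 0 :> mpol K I.
Proof. by rewrite mon.unlock monalgU0. Qed.

Lemma monD (c1 c2 : K) m : mon (c1 + c2) m = mon c1 m + mon c2 m.
Proof. by rewrite mon.unlock monalgUD. Qed.

Lemma malg_addind (P : mpol K I -> Prop) :
  P 0 -> (forall f g, P f -> P g -> P (f + g)) ->
  (forall (c : K) m, P (mon c m)) -> forall f, P f.
Proof.
move=> P0 PD PU f; rewrite [f]monalgE; elim/big_ind: _ => // m _.
by have := PU (f@_m) m; rewrite mon.unlock.
Qed.

Lemma monM (c1 c2 : K) m1 m2 :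
  mon c1 m1 * mon c2 m2 = mon (c1 * c2) (mulcm m1 m2) :> mpol K I.
Proof. by rewrite mon.unlock; exact: fgmulUU. Qed.

Lemma pder_mon i (c : K) m : pder i (mon c m) = mon (c *+ m i) (divcm m (ucm i)).
Proof. by rewrite mon.unlock pderU. Qed.

Lemma pderMU i (c1 c2 : K) m1 m2 :
  pder i (mon c1 m1 * mon c2 m2)
    = pder i (mon c1 m1) * mon c2 m2 + mon c1 m1 * pder i (mon c2 m2).
Proof.
rewrite monM !pder_mon !monM mulcmE mulrnDr monD mulrnAl mulrnAr.
congr (_ + _).
  case: (posnP (m1 i)) => [->|m1i]; first by rewrite mulr0n !mon0.
  by rewrite divcmMl.
case: (posnP (m2 i)) => [->|m2i]; first by rewrite mulr0n !mon0.
by rewrite mulcmC divcmMl // mulcmC.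
Qed.

Lemma pderM i f g : pder i (f * g) = pder i f * g + f * pder i g.
Proof.
rewrite -/(leibniz (pder i) f g).
elim/malg_addind: f => [|f1 f2|c m]; [exact: leibniz0l|exact: leibnizDl|].
elim/malg_addind: g => [|g1 g2|c' m']; [exact: leibniz0r|exact: leibnizDr|].
exact: pderMU.
Qed.

Lemma var_mon i : var i = mon 1 (ucm i) :> mpol K I.
Proof. by rewrite mon.unlock. Qed.

Lemma malgC_mon (c : K) : c%:MP = mon c mone :> mpol K I.
Proof. by rewrite mon.unlock. Qed.

Lemma pder_var i j : pder i (var j) = (i == j)%:R :> mpol K I.
Proof.
rewrite var_mon pder_mon ucmE eq_sym; case: eqP => [->|_]; last exact: mon0.
rewrite mulr1n -[1%:R]mpolyC1E malgC_mon; congr (mon _ _); apply/eqP/cmP => k.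
by rewrite divcmE subnn cm1.
Qed.

Lemma pderC i (c : K) : pder i c%:MP = 0 :> mpol K I.
Proof. by rewrite malgC_mon pder_mon cm1 mulr0n mon0. Qed.

(** By induction on the degree of monomials, stripping one variable at a time. In the abstract
    setting of the vertex operators it becomes the hypothesis [genA]. *)
Lemma mpol_ind (P : mpol K I -> Prop) :
  (forall c, P c%:MP) -> (forall f g, P f -> P g -> P (f + g)) ->
  (forall i f, P f -> P (var i * f)) -> forall f, P f.
Proof.
move=> PC PD PX; apply: malg_addind => [||c m] //.
  by rewrite -(malgC0E (K := {cmonom I})).
have [n le_mn] := ubnP (mdeg m); elim: n m le_mn => // n IHn m le_mn.
have [m0|] := eqVneq (mdeg m) 0%N; first by rewrite (mdeg_eq0I m0) -malgC_mon.
rewrite mdeg_eq0 => m_neq1.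
have [i mi] : exists i, (0 < m i)%N.
  have [m0|[i im]] := fset_0Vmem (finsupp m).
    case/eqP: m_neq1; apply/eqP/cmP => i; rewrite cm1.
    by apply/eqP; rewrite cmE_eq0 m0.
  by exists i; rewrite lt0n cmE_neq0.
have mE : m = mulcm (ucm i) (divcm m (ucm i)).
  apply/eqP/cmP => j; rewrite mulcmE divcmE ucmE.
  by case: eqP => [<-|_]; rewrite ?subn0 // subnKC.
have -> : mon c m = var i * mon c (divcm m (ucm i)) by rewrite var_mon monM mul1r -mE.
apply/PX/IHn; move: le_mn; rewrite {1}mE mdegM mdegU ltnS.
by apply: leq_trans; rewrite add1n.
Qed.

End Pder.

Section Mprod.
Context {K : comNzRingType} {I : choiceType} {S : comNzRingType}.
Variables (h : I -> S).

Definition mprod (m : {cmonom I}) : S := \prod_(i <- finsupp m) h i ^+ m i.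

Lemma mprod_mmorph : mmorphism mprod.
Proof.
have prodE (E : {fset I}) (m : {cmonom I}) : (finsupp m `<=` E)%fset ->
    mprod m = \prod_(i <- E) h i ^+ m i.
  move=> le; rewrite /mprod (big_fset_incl _ le) // => i _.
  by rewrite -cmE_eq0 => /eqP->; rewrite expr0.
split=> [m1 m2|]; last by rewrite /mprod mdom1 big_seq_fset0.
rewrite (prodE (finsupp m1 `|` finsupp m2)%fset m1) ?fsubsetUl //.
rewrite (prodE (finsupp m1 `|` finsupp m2)%fset m2) ?fsubsetUr //.
rewrite /mprod mdomD -big_split /=; apply: eq_bigr => i _.
by rewrite cmM exprD.
Qed.
HB.instance Definition _ := isMultiplicative.Build _ _ mprod mprod_mmorph.

Lemma mprodU i : mprod (ucm i) = h i.
Proof. by rewrite /mprod mdomU big_seq_fset1 cmUU expr1. Qed.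

End Mprod.

HB.lock Definition meval {K : comNzRingType} {I : choiceType} {S : comNzRingType}
  (f : {rmorphism K -> S}) (h : I -> S) (p : mpol K I) : S := mmap f (mprod h) p.

Section Meval.
Context {K : comNzRingType} {I : choiceType} {S : comNzRingType}.
Variables (f : {rmorphism K -> S}) (h : I -> S).
Notation meval := (meval f h).

Lemma meval_is_additive p q : meval (p - q) = meval p - meval q.
Proof. by rewrite meval.unlock raddfB. Qed.
HB.instance Definition _ := GRing.isZmodMorphism.Build (mpol K I) S meval meval_is_additive.
Lemma meval_is_monoid_morphism : monoid_morphism meval.
Proof. by rewrite meval.unlock; split=> [|p q]; rewrite ?rmorph1 ?rmorphM. Qed.
HB.instance Definition _ := GRing.isMonoidMorphism.Build (mpol K I) S meval
  meval_is_monoid_morphism.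

Lemma mevalC c : meval c%:MP = f c.
Proof. by rewrite meval.unlock; exact: mmapC. Qed.
Lemma mevalX i : meval (var i) = h i.
Proof. by rewrite meval.unlock /var mmapU /= rmorph1 mul1r mprodU. Qed.
Lemma mevalZ c p : meval (c *: p) = f c * meval p.
Proof. by rewrite meval.unlock; exact: mmapZ. Qed.

End Meval.

HB.lock Definition ren {K : comNzRingType} {I J : choiceType} (r : I -> J)
  (p : mpol K I) : mpol K J := rename r p.

Section Intertwine.
Context {A B : pzRingType} (phi : {rmorphism A -> B}).
Variables (d : {additive A -> A}) (d' : {additive B -> B}).
(** Stable under sums and, for derivations, under products, so that it need only be checked on
    generators. *)
Definition intertwine f := d' (phi f) = phi (d f).
Lemma intertwineD f g : intertwine f -> intertwine g -> intertwine (f + g).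
Proof. by rewrite /intertwine !raddfD /= => -> ->. Qed.
Lemma intertwineM f g : leibniz d f g -> leibniz d' (phi f) (phi g) ->
  intertwine f -> intertwine g -> intertwine (f * g).
Proof.
by rewrite /intertwine /leibniz rmorphM /= => -> -> -> ->; rewrite rmorphD !rmorphM.
Qed.
End Intertwine.

Section Ren.
Context {K : comNzRingType} {I J : choiceType}.
Variable r : I -> J.
Notation ren := (@ren K I J r).

Lemma renE p : ren p = meval (@malgC _ K) (fun i => var (r i)) p.
Proof. by rewrite ren.unlock meval.unlock. Qed.
Lemma ren_is_linear c p q : ren (c *: p + q) = c *: ren p + ren q.
Proof. by rewrite !renE rmorphD /= mevalZ mul_malgC. Qed.
HB.instance Definition _ := GRing.isLinear.Build K (mpol K I) (mpol K J) *:%R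
  ren ren_is_linear.
Lemma ren_is_monoid_morphism : monoid_morphism ren.
Proof. by split=> [|p q]; rewrite !renE ?rmorph1 ?rmorphM. Qed.
HB.instance Definition _ := GRing.isMonoidMorphism.Build (mpol K I) (mpol K J)
  ren ren_is_monoid_morphism.
Lemma renX i : ren (var i) = var (r i).
Proof. by rewrite renE mevalX. Qed.
Lemma renC c : ren c%:MP = c%:MP.
Proof. by rewrite renE mevalC. Qed.

Lemma pder_ren (r_inj : injective r) i p : pder (r i) (ren p) = ren (pder i p).
Proof.
rewrite -/(intertwine ren (pder i) (pder (r i)) p).
elim/(@mpol_ind K I): p => [c|f g|j f].
- by rewrite /intertwine /= renC !pderC raddf0.
- exact: intertwineD.
- apply: intertwineM; [exact: pderM|exact: pderM|].
  by rewrite /intertwine /= renX !pder_var (inj_eq r_inj) rmorph_nat.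
Qed.

Lemma pder_ren0 j p : (forall i, r i != j) -> pder j (ren p) = 0.
Proof.
move=> jr; elim/(@mpol_ind K I): p => [c|f g IHf IHg|i f IHf].
- by rewrite renC !pderC.
- by rewrite (raddfD ren) pderD IHf IHg addr0.
- rewrite (rmorphM ren) pderM IHf mulr0 addr0 /= renX pder_var eq_sym.
  by rewrite (negPf (jr i)) mul0r.
Qed.
End Ren.

(** * Reindexing of triangular sums *)

Section TriangularSums.
Context {V : nmodType}.
Implicit Types (F : nat -> nat -> V) (l : nat).

Lemma sum_antidiagC F l :
  \sum_(i < l.+1) F i (l - i)%N = \sum_(i < l.+1) F (l - i)%N i.
Proof.
rewrite (reindex_inj rev_ord_inj) /=; apply: eq_bigr => i _.
by rewrite subSS subKn // -ltnS.
Qed.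

Lemma sum_triangleS F l : \sum_(r < l.+1) \sum_(k < l.+1 - r) F r k =
  \sum_(r < l) \sum_(k < l - r) F r k + \sum_(r < l.+1) F r (l - r)%N.
Proof.
have -> : \sum_(r < l) \sum_(k < l - r) F r k =
    \sum_(r < l.+1) \sum_(k < l - r) F r k.
  by rewrite big_ord_recr /= subnn big_ord0 addr0.
rewrite -big_split /=; apply: eq_bigr => r _.
by rewrite subSn ?big_ord_recr // -ltnS.
Qed.

Lemma sum_triangle_shift F l :
  \sum_(i < l.+1) \sum_(r < i) F r (i - r.+1)%N =
  \sum_(r < l) \sum_(k < l - r) F r k.
Proof.
elim: l => [|l IHl]; first by rewrite big_ord1 !big_ord0.
by rewrite big_ord_recr /= IHl sum_triangleS.
Qed.

Lemma sum_triangleC F l :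
  \sum_(r < l) \sum_(k < l - r) F r k = \sum_(k < l) \sum_(r < l - k) F r k.
Proof.
elim: l => [|l IHl]; first by rewrite !big_ord0.
rewrite sum_triangleS IHl (sum_triangleS (fun k r => F r k)).
by rewrite (sum_antidiagC F).
Qed.

Lemma sum_triangle_lt F l :
  \sum_(r < l) \sum_(k < l - r.+1) F r k = \sum_(k < l) \sum_(r < l - k.+1) F r k.
Proof.
case: l => [|l]; first by rewrite !big_ord0.
rewrite !big_ord_recr /= !subnn !big_ord0 !addr0.
under eq_bigr do rewrite subSS.
by rewrite sum_triangleC; apply: eq_bigr => k _; rewrite subSS.
Qed.

End TriangularSums.

(** * Exponentials of commuting operators *)

Section Flow.
Context {K : numFieldType}.

(* [E] is the coefficient sequence of [exp (\sum_i D_i z^i) (E 0)] when the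
   [D_i] commute: apply [z d/dz] to the exponential. *)
Definition flow {V : lmodType K} (D : nat -> V -> V) (E : nat -> V) :=
  forall l, l%:R *: E l = \sum_(i < l) i.+1%:R *: D i.+1 (E (l - i.+1)%N).

(** For l > 0 the scalar l is invertible, so the equation determines [E l] from the lower
    coefficients. *)
Lemma flow_inj {V : lmodType K} (D : nat -> V -> V) (E E' : nat -> V) :
  flow D E -> flow D E' -> E 0%N = E' 0%N -> forall l, E l = E' l.
Proof.
move=> DE DE' E0 l; elim/ltn_ind: l => -[//|l] IHl.
have := DE l.+1; rewrite (eq_bigr (fun i : 'I_l.+1 =>
    i.+1%:R *: D i.+1 (E' (l.+1 - i.+1)%N))); last first.
  by move=> i _; rewrite IHl // subSS ltnS leq_subr.
by rewrite -DE' => /scalerI; apply; rewrite pnatr_eq0.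
Qed.

(** The Euler operator is a derivation: on the antidiagonal the weight l splits as i + (l - i). [H1]
    and [H2] stand for the action of the operators through the first and the second index of [G], so
    that one lemma serves for products of exponentials and for composed exponentials. *)
Lemma flow_antidiag {V : lmodType K} (D : nat -> V -> V)
    (G : nat -> nat -> V) (H1 H2 : nat -> nat -> nat -> V) :
    (forall i, additive (D i)) ->
    (forall i j, i%:R *: G i j = \sum_(r < i) r.+1%:R *: H1 r (i - r.+1)%N j) ->
    (forall i j, j%:R *: G i j = \sum_(r < j) r.+1%:R *: H2 r i (j - r.+1)%N) ->
    (forall r i j, D r.+1 (G i j) = H1 r i j + H2 r i j) ->
  flow D (fun l => \sum_(i < l.+1) G i (l - i)%N).
Proof.
move=> Dadd G1 G2 GD l /=.
have D0 r : D r 0 = 0 by rewrite -[0 in LHS](subrr 0) Dadd subrr.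
have DD r : {morph D r : x y / x + y}.
  by move=> x y; rewrite -[y in LHS]opprK Dadd -[- y]sub0r Dadd D0 sub0r opprK.
have -> : l%:R *: (\sum_(i < l.+1) G i (l - i)%N) =
    \sum_(i < l.+1) i%:R *: G i (l - i)%N
    + \sum_(i < l.+1) (l - i)%:R *: G i (l - i)%N.
  rewrite scaler_sumr -big_split /=; apply: eq_bigr => i _.
  by rewrite -scalerDl -natrD subnKC // -ltnS.
rewrite (eq_bigr _ (fun (i : 'I_l.+1) _ => G1 i (l - i)%N)).
rewrite [X in _ + X](eq_bigr _ (fun (i : 'I_l.+1) _ => G2 i (l - i)%N)).
have -> : \sum_(r < l) r.+1%:R *:
      D r.+1 (\sum_(i < (l - r.+1).+1) G i (l - r.+1 - i)%N) =
    \sum_(r < l) \sum_(k < l - r) r.+1%:R *: H1 r k (l - (k + r.+1))%N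
    + \sum_(r < l) \sum_(k < l - r) r.+1%:R *: H2 r k (l - (k + r.+1))%N.
  rewrite -big_split /=; apply: eq_bigr => r _.
  rewrite subnSK // -big_split /= (big_morph _ (DD _) (D0 _)) scaler_sumr.
  by apply: eq_bigr => k _; rewrite GD scalerDr -subnDA addnC.
congr (_ + _).
  rewrite -(sum_triangle_shift (fun r k => r.+1%:R *: H1 r k (l - (k + r.+1))%N)).
  by apply: eq_bigr => i _; apply: eq_bigr => r _; rewrite subnK.
rewrite (sum_triangleC (fun r k => r.+1%:R *: H2 r k (l - (k + r.+1))%N)).
rewrite big_ord_recr /= subnn big_ord0 addr0.
by apply: eq_bigr => i _; apply: eq_bigr => r _; rewrite subnDA.
Qed.

End Flow.

Section Psexp.
Context {K : numFieldType} {V : lmodType K} (D : nat -> {linear V -> V}).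
Hypothesis Dcomm : forall i j x, D i (D j x) = D j (D i x).

Definition psop (f : nat -> V) : nat -> V :=
  fun l => \sum_(1 <= i < l.+1) D i (f (l - i)%N).

Lemma psopE f l : psop f l = \sum_(i < l) D i.+1 (f (l - i.+1)%N).
Proof. by rewrite /psop big_add1 /= big_mkord. Qed.

Lemma iter_psop_small x n l : (l < n)%N -> iter n psop (psconst x) l = 0.
Proof.
elim: n l => // n IHn l ltln; rewrite iterS psopE big1 // => i _.
by rewrite IHn ?linear0 //; move: (ltn_ord i); rewrite ltn_subLR //; lia.
Qed.

(** The Euler operator applied to a power: as the [D i] commute, the derivative of the (n+1)-st
    power of the series is n + 1 times the derivative of the series times its n-th power. *)
Lemma iter_psopS x n l :
  l%:R *: iter n.+1 psop (psconst x) l =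
  n.+1%:R *: \sum_(i < l) i.+1%:R *: D i.+1 (iter n psop (psconst x) (l - i.+1)%N).
Proof.
elim: n l => [|n IHn] l.
  rewrite scale1r iterS psopE scaler_sumr; apply: eq_bigr => i _ /=.
  rewrite /psconst; case: eqP => [/eqP|_]; last by rewrite linear0 !scaler0.
  by rewrite subn_eq0 => li; congr (_%:R *: _); apply/eqP; rewrite eqn_leq li ltn_ord.
rewrite iterS psopE scaler_sumr.
have -> : \sum_(i < l) l%:R *: D i.+1 (iter n.+1 psop (psconst x) (l - i.+1)%N) =
    \sum_(i < l) i.+1%:R *: D i.+1 (iter n.+1 psop (psconst x) (l - i.+1)%N) +
    \sum_(i < l) D i.+1 ((l - i.+1)%:R *: iter n.+1 psop (psconst x) (l - i.+1)%N).
  rewrite -big_split /=; apply: eq_bigr => i _.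
  by rewrite linearZ -scalerDl -natrD subnKC.
under [X in _ + X]eq_bigr => i _.
  rewrite IHn linearZ /= linear_sum scaler_sumr /=; over.
rewrite (sum_triangle_lt (fun j i => n.+1%:R *: D j.+1
   (i.+1%:R *: D i.+1 (iter n psop (psconst x) (l - j.+1 - i.+1)%N)))).
have -> : n.+2%:R = 1 + n.+1%:R :> K by rewrite -natr1 addrC.
rewrite scalerDl scale1r; congr (_ + _).
rewrite scaler_sumr; apply: eq_bigr => i _.
rewrite -scaler_sumr; congr (_ *: _).
rewrite iterS psopE linear_sum scaler_sumr; apply: eq_bigr => j _.
by rewrite linearZ Dcomm -!subnDA [(j.+1 + _)%N]addnC.
Qed.

Lemma psexp_flow x : flow D (psexp psop (psconst x)).
Proof.
move=> l; rewrite /psexp big_ord_recl /= scalerDr.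
rewrite [X in X + _](_ : _ = 0); last first.
  by rewrite /psconst; case: eqP => [->|_]; rewrite ?scale0r // !scaler0.
rewrite add0r scaler_sumr.
have -> : \sum_(n < l) l%:R *: ((bump 0 n)`!%:R^-1 *:
      iter (bump 0 n) psop (psconst x) l) =
    \sum_(n < l) \sum_(i < l) n`!%:R^-1 *:
      (i.+1%:R *: D i.+1 (iter n psop (psconst x) (l - i.+1)%N)).
  apply: eq_bigr => n _; rewrite scalerA mulrC -scalerA iter_psopS scalerA.
  rewrite factS natrM mulrC invfM mulrA mulfV ?pnatr_eq0 // mul1r.
  by rewrite scaler_sumr.
rewrite exchange_big /=; apply: eq_bigr => i _.
rewrite linear_sum scaler_sumr subnSK //.
rewrite (big_ord_widen l (fun n => i.+1%:R *: D i.+1 (n`!%:R^-1 *: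
   iter n psop (psconst x) (l - i.+1)%N))) ?leq_subr //.
(* On the right n runs only up to l - i - 1; the remaining terms on the left vanish because the n-th
   iterate has order at least n. *)
rewrite [RHS]big_mkcond /=; apply: eq_bigr => n _.
case: ltnP => [_|le]; first by rewrite [in RHS]linearZ /= !scalerA mulrC.
by rewrite iter_psop_small ?linear0 ?scaler0 //; move: (ltn_ord i); lia.
Qed.

Lemma psexp0 x : psexp psop (psconst x) 0 = x.
Proof. by rewrite /psexp big_ord1 /= invr1 scale1r. Qed.

End Psexp.

(** * Schur polynomials as coefficients of an exponential *)

Section Schur.
Context {K : numFieldType} {A : comAlgType K}.
Implicit Types (u v : nat -> A).

(** Multiplication as a bundled linear map, so that Schur polynomials become an instance of the
    exponential of commuting operators. *)
Definition mulL (x y : A) := x * y.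
Lemma mulL_is_linear x : linear (mulL x).
Proof. by move=> c y z; rewrite /mulL mulrDr scalerAr. Qed.
HB.instance Definition _ x := GRing.isLinear.Build K A A *:%R (mulL x)
  (mulL_is_linear x).

Lemma schur_flow u : flow (fun i f => u i * f) (schur u).
Proof.
by apply: (@psexp_flow K A (fun i => mulL (u i))) => i j x; rewrite /= /mulL mulrCA.
Qed.

Lemma schur0 u : schur u 0 = 1.
Proof. by rewrite /schur /psexp big_ord1 /= invr1 scale1r. Qed.

Lemma schurP u (E : nat -> A) : E 0%N = 1 ->
  (forall l, l%:R *: E l = \sum_(i < l) i.+1%:R *: (u i.+1 * E (l - i.+1)%N)) ->
  forall l, schur u l = E l.
Proof.
move=> E0 EF; apply: (flow_inj (D := fun i f => u i * f) (E' := E)) => //.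
  exact: schur_flow.
by rewrite schur0.
Qed.

Lemma eq_schur u v : (forall i, u i.+1 = v i.+1) -> schur u =1 schur v.
Proof.
move=> uv; apply: schurP => [|l]; first exact: schur0.
by rewrite schur_flow; apply: eq_bigr => i _; rewrite uv.
Qed.

(** This is exp(u) exp(v) = exp(u + v): the Cauchy product solves the Euler equation for u + v. *)
Lemma schur_sum u v l :
  \sum_(i < l.+1) schur u i * schur v (l - i)%N = schur (fun i => u i + v i) l.
Proof.
symmetry; move: l; apply: schurP; first by rewrite big_ord1 !schur0 mulr1.
apply: (@flow_antidiag _ _ (fun i f => (u i + v i) * f)
  (fun i j => schur u i * schur v j)
  (fun r i j => u r.+1 * (schur u i * schur v j))
  (fun r i j => v r.+1 * (schur u i * schur v j))).
- by move=> i x y; rewrite mulrBr.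
- move=> i j; rewrite scalerAl schur_flow mulr_suml; apply: eq_bigr => r _.
  by rewrite -scalerAl mulrA.
- move=> i j; rewrite scalerAr schur_flow mulr_sumr; apply: eq_bigr => r _.
  by rewrite -scalerAr mulrCA.
- by move=> r i j; rewrite mulrDl.
Qed.

Lemma schur_const0 u : (forall i, u i.+1 = 0) -> forall l, schur u l = (l == 0%N)%:R.
Proof.
move=> u0; apply: schurP => // l; rewrite big1 => [|i _]; last by rewrite u0 mul0r scaler0.
by case: l => [|l]; rewrite ?scale0r ?scaler0.
Qed.

(** Extended by zero to negative indices, so that the index shifts produced by derivatives and modes
    need no case distinction. *)
Definition schurz u (j : int) : A := if j is Posz n then schur u n else 0.

Lemma schurz_neg u j : j < 0 -> schurz u j = 0.
Proof. by case: j. Qed.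

Lemma sum_int_range (F : int -> A) (a lo : int) (T L : nat) :
    (forall n, F n != 0 -> lo <= n < lo + L%:Z) ->
    a <= lo -> lo + L%:Z <= a + T%:Z ->
  \sum_(i < T) F (a + i%:Z) = \sum_(i < L) F (lo + i%:Z).
Proof.
move=> F0 alo loT; have [k kE] : exists k : nat, lo = a + k%:Z.
  by exists `|lo - a|%N; lia.
have [r rE] : exists r, T = (k + (L + r))%N by exists (T - k - L)%N; lia.
have Z n : ~~ (lo <= n < lo + L%:Z) -> F n = 0.
  by apply: contraNeq => /F0.
rewrite rE !big_split_ord /= [X in X + _]big1 ?add0r; last first.
  by move=> i _; apply: Z; move: (ltn_ord i); lia.
rewrite [X in _ + X]big1 ?addr0; last first.
  by move=> i _; apply: Z; move: (ltn_ord i); lia.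
by apply: eq_bigr => i _; congr F; lia.
Qed.

(** Any window that contains 0, ..., N computes the full convolution, since outside it one of the
    two factors has negative index. *)
Lemma schurz_sum u v (N a : int) (T : nat) : a <= 0 -> N < a + T%:Z ->
  \sum_(i < T) schurz u (a + i%:Z) * schurz v (N - (a + i%:Z)) =
  schurz (fun i => u i + v i) N.
Proof.
case: N => [N|N] a0 NT.
  rewrite (@sum_int_range (fun n => schurz u n * schurz v (N%:Z - n)) a 0 T N.+1) //=.
  - rewrite -schur_sum; apply: eq_bigr => i _; rewrite add0r /=.
    by rewrite subzn // -ltnS.
  - move=> n; apply: contraNT => nN.
    have [n0|n0] := ltP n 0; first by rewrite schurz_neg ?mul0r.
    by rewrite [schurz v _]schurz_neg ?mulr0 //; lia.
rewrite big1 // => i _.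
have [n0|n0] := ltP (a + i%:Z) 0; first by rewrite schurz_neg ?mul0r.
by rewrite [schurz v _]schurz_neg ?mulr0 //; lia.
Qed.

End Schur.

Section SchurMorph.
Context {K : numFieldType} {A B : comAlgType K} (phi : {rmorphism A -> B}).
Lemma schur_morph (u : nat -> A) l : phi (schur u l) = schur (fun i => phi (u i)) l.
Proof.
symmetry; move: l; apply: schurP => [|l]; first by rewrite schur0 rmorph1.
rewrite scaler_nat -rmorphMn /= -scaler_nat schur_flow rmorph_sum.
by apply: eq_bigr => i _; rewrite !scaler_nat rmorphMn rmorphM.
Qed.
Lemma schurz_morph (u : nat -> A) j : phi (schurz u j) = schurz (fun i => phi (u i)) j.
Proof. by case: j => [n|n] /=; rewrite ?schur_morph ?rmorph0. Qed.
End SchurMorph.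

Lemma scaleCA (K : comPzRingType) (V : lmodType K) (a b : K) (v : V) :
  a *: (b *: v) = b *: (a *: v).
Proof. by rewrite !scalerA mulrC. Qed.

(** * Exponentials of commuting derivations *)

Section Taylor.
Context {K : numFieldType} {A : comAlgType K} (D : nat -> {linear A -> A}).
Hypothesis Dcomm : forall i j x, D i (D j x) = D j (D i x).

Definition taylor l f := psexp (psop D) (psconst f) l.

Lemma taylor_flow f : flow D (taylor^~ f).
Proof. exact: psexp_flow. Qed.

Lemma taylor0 f : taylor 0 f = f.
Proof. exact: psexp0. Qed.

Lemma taylorP (E : nat -> A) f : E 0%N = f -> flow D E -> forall l, taylor l f = E l.
Proof.
by move=> E0 EF; apply: flow_inj EF _ => //; [exact: taylor_flow | rewrite taylor0].
Qed.

Lemma taylor_is_linear l : linear (taylor l).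
Proof.
move=> c f g; move: l.
apply: (taylorP (E := fun l => c *: taylor l f + taylor l g)) => [|l].
  by rewrite !taylor0.
rewrite scalerDr scaleCA !taylor_flow scaler_sumr -big_split /=.
by apply: eq_bigr => i _; rewrite linearP scalerDr scaleCA.
Qed.
HB.instance Definition _ l := GRing.isLinear.Build K A A *:%R (taylor l)
  (taylor_is_linear l).

Lemma taylor_comm (phi : {linear A -> A}) : (forall i x, phi (D i.+1 x) = D i.+1 (phi x)) ->
  forall l f, phi (taylor l f) = taylor l (phi f).
Proof.
move=> phiD l f; symmetry; move: l; apply: taylorP => [|l]; first by rewrite taylor0.
rewrite -linearZZ taylor_flow linear_sum; apply: eq_bigr => i _.
by rewrite linearZZ phiD.
Qed.

Hypothesis Dder : forall i f g, leibniz (D i) f g.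

Lemma taylorM l f g :
  taylor l (f * g) = \sum_(i < l.+1) taylor i f * taylor (l - i)%N g.
Proof.
move: l; apply: taylorP; first by rewrite big_ord1 !taylor0.
apply: (@flow_antidiag _ _ D (fun i j => taylor i f * taylor j g)
  (fun r i j => D r.+1 (taylor i f) * taylor j g)
  (fun r i j => taylor i f * D r.+1 (taylor j g))).
- by move=> i x y; rewrite linearB.
- move=> i j; rewrite scalerAl taylor_flow mulr_suml; apply: eq_bigr => r _.
  by rewrite -scalerAl.
- move=> i j; rewrite scalerAr taylor_flow mulr_sumr; apply: eq_bigr => r _.
  by rewrite -scalerAr.
- by move=> r i j; apply: Dder.
Qed.

Lemma taylor_const l f : (forall i, D i.+1 f = 0) -> taylor l f = if l == 0%N then f else 0.
Proof.
move=> Df; move: l; apply: taylorP => // l; rewrite big1 => [|i _]; last first.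
  by case: ifP => _; rewrite ?Df ?linear0 ?scaler0.
by case: l => [|l]; rewrite ?scale0r ?scaler0.
Qed.

Lemma taylorM_const l f g : (forall i, D i.+1 f = 0) -> taylor l (f * g) = f * taylor l g.
Proof.
move=> Df; rewrite taylorM big_ord_recl subn0 taylor0 big1 ?addr0 // => i _.
by rewrite taylor_const // mul0r.
Qed.

End Taylor.

Section TaylorInverse.
Context {K : numFieldType} {A : comAlgType K} (D D' : nat -> {linear A -> A}).
Hypothesis Dcomm : forall i j x, D i (D j x) = D j (D i x).
Hypothesis D'comm : forall i j x, D' i (D' j x) = D' j (D' i x).
Hypothesis DD' : forall i x, D' i.+1 x = - D i.+1 x.

(** Composing exp(D) with exp(-D) solves the Euler equation in which all operators are zero, and
    such a solution has no coefficient of positive order. *)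
Lemma taylor_inverse l f :
  \sum_(i < l.+1) taylor D i (taylor D' (l - i)%N f) = if l == 0%N then f else 0.
Proof.
have DT i r x : D i.+1 (taylor D r x) = taylor D r (D i.+1 x).
  exact: taylor_comm.
have FL : flow (fun=> fun=> 0) (fun l => \sum_(i < l.+1) taylor D i (taylor D' (l - i)%N f)).
  apply: (@flow_antidiag _ _ (fun=> fun=> 0) (fun i j => taylor D i (taylor D' j f))
   (fun r i j => D r.+1 (taylor D i (taylor D' j f)))
   (fun r i j => D' r.+1 (taylor D i (taylor D' j f)))).
  - by move=> i x y; rewrite subrr.
  - by move=> i j; rewrite taylor_flow.
  - move=> i j; rewrite -linearZZ taylor_flow // linear_sum; apply: eq_bigr => r _.
    by rewrite linearZZ !DD' DT linearN.
  - by move=> r i j /=; rewrite DD' addrN.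
case: l => [|l] /=; first by rewrite big_ord1 !taylor0.
have := FL l.+1; rewrite [X in _ = X]big1 => [|i _]; last by rewrite scaler0.
by move/eqP; rewrite scaler_eq0 pnatr_eq0 => /eqP.
Qed.
End TaylorInverse.

Section TaylorSchur.
Context {K : numFieldType} {A : comAlgType K} (D : nat -> {linear A -> A}).
Hypothesis Dcomm : forall i j x, D i (D j x) = D j (D i x).
Hypothesis Dder : forall i f g, leibniz (D i) f g.

(** In generating form, [d] multiplies exp(sum u_k z^k) by e z^i. On coefficients this follows by
    strong induction on j: in the differentiated Euler recursion the term k + 1 = i contributes with
    weight i, and the recursion for the shifted coefficient with the remaining weight j - i. *)
Lemma der_schurz (d : {linear A -> A}) (u : nat -> A) (e : K) (i : nat) :
    (forall f g, leibniz d f g) -> (0 < i)%N ->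
    (forall k, d (u k.+1) = (e *+ (i == k.+1))%:A) ->
  forall j, d (schurz u j) = e *: schurz u (j - i%:Z).
Proof.
move=> dder i0 du.
have d1 : d 1 = 0.
  have := dder 1 1; rewrite /leibniz !mulr1 mul1r => /eqP.
  by rewrite -subr_eq subrr eq_sym => /eqP.
case=> [n|n]; last by rewrite /= linear0 schurz_neg ?scaler0 //; lia.
elim/ltn_ind: n => -[_|n IHn].
  by rewrite /= schur0 d1 schurz_neg ?scaler0 //; lia.
have n0 : n.+1%:R != 0 :> K by rewrite pnatr_eq0.
apply: (scalerI n0); rewrite -linearZZ [schurz u n.+1]/= schur_flow linear_sum /=.
have -> : \sum_(k < n.+1) d (k.+1%:R *: (u k.+1 * schur u (n.+1 - k.+1)%N)) =
   \sum_(k < n.+1) k.+1%:R *: (e *+ (i == k.+1) *: schur u (n.+1 - k.+1)%N)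
   + e *: \sum_(k < n.+1) k.+1%:R *: (u k.+1 * schurz u (n.+1%:Z - i%:Z - k.+1%:Z)).
  rewrite scaler_sumr -big_split /=; apply: eq_bigr => k _.
  rewrite linearZZ dder /= du -scalerAl mul1r scalerDr; congr (_ + _).
  have kn : (n.+1 - k.+1 < n.+1)%N by lia.
  have := IHn _ kn; rewrite [schurz u (Posz _)]/= => ->.
  rewrite -scalerAr [RHS]scaleCA; congr (_ *: (_ *: (_ * schurz u _))).
  by move: (ltn_ord k); lia.
have [ni|ni] := ltnP n.+1 i.
  rewrite schurz_neg ?scaler0; last lia.
  rewrite !big1 ?scaler0 ?addr0 // => k _; first by rewrite schurz_neg ?mulr0 ?scaler0 //; lia.
  by rewrite gtn_eqF ?mulr0n ?scale0r ?scaler0 //; move: (ltn_ord k); lia.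
have [r rE] : exists r, n.+1 = (i + r)%N by exists (n.+1 - i)%N; lia.
have -> : (n.+1%:Z - i%:Z) = r%:Z by lia.
have -> : \sum_(k < n.+1) k.+1%:R *: (u k.+1 * schurz u (r%:Z - k.+1%:Z)) = r%:R *: schur u r.
  rewrite schur_flow (big_ord_widen n.+1 (fun k => k.+1%:R *: (u k.+1 * schur u (r - k.+1)%N))).
    rewrite [RHS]big_mkcond; apply: eq_bigr => k _; case: ltnP => kr.
      by rewrite subzn.
    by rewrite schurz_neg ?mulr0 ?scaler0 //; lia.
  lia.
have i1n : (i.-1 < n.+1)%N by lia.
rewrite (bigD1 (Ordinal i1n)) //= prednK // eqxx mulr1n big1 ?addr0; last first.
  move=> k; rewrite -val_eqE /= => ki; have -> : (i == k.+1) = false by lia.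
  by rewrite scale0r scaler0.
have -> : (n.+1 - i)%N = r by lia.
by rewrite scaleCA -scalerDr -scalerDl -natrD rE scaleCA.
Qed.

(** On the generating series sum_j s_j z^j the operator sum_i D_i w^i is multiplication by sum (z
    w)^i / i = - log(1 - z w), so its exponential is multiplication by 1/(1 - z w). *)
Lemma taylor_schurz (u : nat -> A) :
    (forall i j, D i.+1 (schurz u j) = i.+1%:R^-1 *: schurz u (j - i.+1%:Z)) ->
  forall l j, taylor D l (schurz u j) = schurz u (j - l%:Z).
Proof.
move=> Du l j; move: l; apply: taylorP => // [|l]; first by rewrite subr0.
transitivity (\sum_(i < l) schurz u (j - l%:Z)).
  by rewrite sumr_const card_ord scaler_nat.
apply: eq_bigr => i _; rewrite Du scalerA divff ?pnatr_eq0 // scale1r.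
by congr (schurz u _); move: (ltn_ord i); lia.
Qed.

(** With the opposite sign the exponential is multiplication by 1 - z w, which leaves two terms.
    This factor causes both the anticommutation of [vop] and the row differences in the
    determinants. *)
Lemma taylor_schurzN (u : nat -> A) :
    (forall i j, D i.+1 (schurz u j) = - (i.+1%:R^-1 *: schurz u (j - i.+1%:Z))) ->
  forall l j, taylor D l (schurz u j) =
    if l is l'.+1 then if l' is 0%N then - schurz u (j - 1) else 0 else schurz u j.
Proof.
move=> Du l j; move: l.
apply: (taylorP Dcomm (E := fun l => if l is l'.+1 then
  if l' is 0%N then - schurz u (j - 1) else 0 else schurz u j)) => //.
case=> [|[|l]]; first by rewrite big_ord0 scale0r.
  by rewrite big_ord1 /= Du invr1 !scale1r.
rewrite big_ord_recr big_ord_recr /= big1 => [|i _]; last first.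
  have -> : (l.+2 - i.+1 = (l - i).+1)%N by move: (ltn_ord i); lia.
  have -> : (l - i = (l - i).-1.+1)%N by move: (ltn_ord i); lia.
  by rewrite linear0 scaler0.
rewrite subSnn subnn add0r scaler0 linearN !Du.
rewrite !(scalerN, opprK) !scalerA !divff ?pnatr_eq0 // !scale1r.
by apply/esym/eqP; rewrite subr_eq0; apply/eqP; congr (schurz u _); lia.
Qed.

End TaylorSchur.

(** * Finite boxes cut into antidiagonals *)

Section BoxSums.
Context {V : nmodType}.
Implicit Types (F : nat -> nat -> V).

Lemma sum_antidiag_triangle F T :
  \sum_(N < T) \sum_(i < N.+1) F i (N - i)%N = \sum_(i < T) \sum_(k < T - i) F i k.
Proof.
elim: T => [|T IHT]; first by rewrite !big_ord0.
by rewrite big_ord_recr /= IHT sum_triangleS.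
Qed.

Lemma sum_ord_zero (f : nat -> V) (I T : nat) :
  (I <= T)%N -> (forall i, (I <= i)%N -> f i = 0) -> \sum_(i < T) f i = \sum_(i < I) f i.
Proof.
move=> IT f0; rewrite -(subnKC IT) big_split_ord /= [X in _ + X]big1 ?addr0 // => i _.
by rewrite f0 ?leq_addr.
Qed.

Lemma sum_triangle_box F (I L T : nat) :
    (forall i k, (I <= i)%N -> F i k = 0) -> (forall i k, (L <= k)%N -> F i k = 0) ->
    (I + L <= T)%N ->
  \sum_(i < T) \sum_(k < T - i) F i k = \sum_(i < I) \sum_(k < L) F i k.
Proof.
move=> FI FL ILT.
rewrite (@sum_ord_zero (fun i => \sum_(k < T - i) F i k) I); first last.
- by move=> i Ii; rewrite big1 // => k _; rewrite FI.
- exact: leq_trans (leq_addr _ _) ILT.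
apply: eq_bigr => i _; apply: sum_ord_zero => [|k]; last exact: FL.
by move: (ltn_ord i); lia.
Qed.

Lemma sum_box_antidiag F (L T : nat) :
    (forall i k, (L <= i)%N -> F i k = 0) -> (forall i k, (L <= k)%N -> F i k = 0) ->
    (L + L <= T)%N ->
  \sum_(i < L) \sum_(k < L) F i k = \sum_(N < T) \sum_(i < N.+1) F i (N - i)%N.
Proof.
by move=> F1 F2 LT; rewrite sum_antidiag_triangle (sum_triangle_box (I := L) (L := L)).
Qed.

End BoxSums.

Lemma bump0 l : bump 0 l = l.+1.
Proof. by rewrite /bump leq0n. Qed.

(** * Vertex operators *)

(* [A] stands for C[t], with [u a k] for t_k^(a) and [d a k] for its partial
   derivative: four properties of polynomials suffice, [genA] being induction. *)
Section Vertex.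
Context {K : numFieldType} {A : comAlgType K} {s : nat}.
Variables (u : 'I_s -> nat -> A) (d : 'I_s -> nat -> {linear A -> A}).
Hypothesis dcomm : forall a b i j x, d a i (d b j x) = d b j (d a i x).
Hypothesis dder : forall a i f g, leibniz (d a i) f g.
Hypothesis du : forall a b i k, d a i.+1 (u b k.+1) = ((a == b) && (i == k))%:R.
Hypothesis genA : forall T : A -> Prop, (forall c : K, T c%:A) ->
  (forall f g, T f -> T g -> T (f + g)) -> (forall a k f, T f -> T (u a k.+1 * f)) ->
  forall f, T f.

Notation S a := (schurz (u a)).
Notation Sd a := (schurz (fun i => - u a i)).

Definition dP a i : {linear A -> A} := (- i%:R^-1) \*: d a i.
Definition dQ a i : {linear A -> A} := i%:R^-1 \*: d a i.

Lemma dPE a i x : dP a i x = - (i%:R^-1 *: d a i x).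
Proof. by rewrite /= scaleNr. Qed.
Lemma dQE a i x : dQ a i x = i%:R^-1 *: d a i x.
Proof. by []. Qed.

Lemma dN a i x : d a i (- x) = - d a i x. Proof. exact: linearN. Qed.
Lemma dZ a i c x : d a i (c *: x) = c *: d a i x. Proof. exact: linearZZ. Qed.

Lemma dPcomm a i b j x : dP a i (dP b j x) = dP b j (dP a i x).
Proof. by rewrite !dPE !dN !dZ !scalerN dcomm scaleCA. Qed.
Lemma dQcomm a i b j x : dQ a i (dQ b j x) = dQ b j (dQ a i x).
Proof. by rewrite !dQE !dZ dcomm scaleCA. Qed.
Lemma dPQcomm a i b j x : dP a i (dQ b j x) = dQ b j (dP a i x).
Proof. by rewrite !(dPE, dQE) !dN !dZ ?scalerN dcomm scaleCA. Qed.

Lemma dPder a i f g : leibniz (dP a i) f g.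
Proof.
have E x : (dP a i : {additive A -> A}) x = - (i%:R^-1 *: d a i x) by exact: dPE.
by rewrite /leibniz !E (dder a i f g) scalerDr opprD mulNr mulrN -scalerAl -scalerAr.
Qed.
Lemma dQder a i f g : leibniz (dQ a i) f g.
Proof.
have E x : (dQ a i : {additive A -> A}) x = i%:R^-1 *: d a i x by [].
by rewrite /leibniz !E (dder a i f g) scalerDr -scalerAl -scalerAr.
Qed.

(* Coefficients of [z^-l] in [exp (- \sum d_i z^-i / i)] and in its inverse. *)
Definition P a l (f : A) : A := taylor (dP a) l f.
Definition Q a l (f : A) : A := taylor (dQ a) l f.

Lemma P_is_linear a l : linear (P a l).
Proof. by move=> c f g; apply: taylor_is_linear => i j x; exact: dPcomm. Qed.
HB.instance Definition _ a l := GRing.isLinear.Build K A A *:%R (P a l) (P_is_linear a l).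
Lemma Q_is_linear a l : linear (Q a l).
Proof. by move=> c f g; apply: taylor_is_linear => i j x; exact: dQcomm. Qed.
HB.instance Definition _ a l := GRing.isLinear.Build K A A *:%R (Q a l) (Q_is_linear a l).

Lemma PD a l f g : P a l (f + g) = P a l f + P a l g. Proof. exact: linearD. Qed.
Lemma QD a l f g : Q a l (f + g) = Q a l f + Q a l g. Proof. exact: linearD. Qed.
Lemma Pz a l : P a l 0 = 0. Proof. exact: linear0. Qed.
Lemma Qz a l : Q a l 0 = 0. Proof. exact: linear0. Qed.
Lemma PZ a l c f : P a l (c *: f) = c *: P a l f. Proof. exact: linearZZ. Qed.
Lemma QZ a l c f : Q a l (c *: f) = c *: Q a l f. Proof. exact: linearZZ. Qed.
Lemma P0 a f : P a 0 f = f. Proof. exact: taylor0. Qed.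
Lemma Q0 a f : Q a 0 f = f. Proof. exact: taylor0. Qed.

Lemma PC a l b m f : P a l (P b m f) = P b m (P a l f).
Proof.
symmetry; apply: (taylor_comm (D := dP a)) => [i j x|i x]; first exact: dPcomm.
symmetry; apply: (taylor_comm (D := dP b)) => [j k y|j y]; exact: dPcomm.
Qed.

Lemma PQC a l b m f : P a l (Q b m f) = Q b m (P a l f).
Proof.
symmetry; apply: (taylor_comm (D := dP a)) => [i j x|i x]; first exact: dPcomm.
symmetry; apply: (taylor_comm (D := dQ b)) => [j k y|j y]; first exact: dQcomm.
exact: dPQcomm.
Qed.

Lemma PQ_inverse a l f :
  \sum_(i < l.+1) P a i (Q a (l - i)%N f) = if l == 0%N then f else 0.
Proof.
apply: taylor_inverse => [i j x|i j x|i x]; [exact: dPcomm|exact: dQcomm|].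
by rewrite dPE opprK.
Qed.

Lemma d_one a i : d a i 1 = 0.
Proof.
have := dder a i 1 1; rewrite /leibniz !mulr1 mul1r => /eqP.
by rewrite -subr_eq subrr eq_sym => /eqP.
Qed.
Lemma d_const a i (c : K) : d a i c%:A = 0.
Proof. by rewrite linearZZ d_one scaler0. Qed.

Lemma d_S a i j : d a i.+1 (S a j) = S a (j - i.+1%:Z).
Proof.
rewrite (@der_schurz _ _ _ _ 1 i.+1) ?scale1r //.
by move=> k; rewrite du eqxx eqSS /=; case: eqP => _; rewrite ?scale1r ?scale0r.
Qed.
Lemma d_Sd a i j : d a i.+1 (Sd a j) = - Sd a (j - i.+1%:Z).
Proof.
rewrite (@der_schurz _ _ _ _ (-1) i.+1) ?scaleN1r //.
move=> k; rewrite linearN du eqxx eqSS /=.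
by case: eqP => _; rewrite ?scaleN1r ?mulr0n ?scale0r ?oppr0.
Qed.
Lemma d_S_other a b i j : a != b -> d a i.+1 (S b j) = 0.
Proof.
move=> ab; rewrite (@der_schurz _ _ _ _ 0 i.+1) ?scale0r //.
by move=> k; rewrite du (negPf ab) mul0rn scale0r.
Qed.
Lemma d_Sd_other a b i j : a != b -> d a i.+1 (Sd b j) = 0.
Proof.
move=> ab; rewrite (@der_schurz _ _ _ _ 0 i.+1) ?scale0r //.
by move=> k; rewrite linearN du (negPf ab) mul0rn scale0r oppr0.
Qed.

Lemma P_Sd a l j f : P a l (Sd a j * f) = \sum_(i < l.+1) Sd a (j - i%:Z) * P a (l - i)%N f.
Proof.
rewrite /P taylorM => [|i k x|i g h]; [|exact: dPcomm|exact: dPder].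
apply: eq_bigr => i _; rewrite taylor_schurz // => [k n x|k n]; first exact: dPcomm.
by rewrite dPE d_Sd scalerN opprK.
Qed.
Lemma Q_S a l j f : Q a l (S a j * f) = \sum_(i < l.+1) S a (j - i%:Z) * Q a (l - i)%N f.
Proof.
rewrite /Q taylorM => [|i k x|i g h]; [|exact: dQcomm|exact: dQder].
apply: eq_bigr => i _; rewrite taylor_schurz // => [k n x|k n]; first exact: dQcomm.
by rewrite dQE d_S.
Qed.
Lemma P_S a l j f : P a l.+1 (S a j * f) = S a j * P a l.+1 f - S a (j - 1) * P a l f.
Proof.
rewrite /P taylorM => [|i k x|i g h]; [|exact: dPcomm|exact: dPder].
have dPS i n : dP a i.+1 (S a n) = - (i.+1%:R^-1 *: S a (n - i.+1%:Z)) by rewrite dPE d_S.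
have TS := taylor_schurzN (fun i j => dPcomm a i a j) dPS.
rewrite 2!big_ord_recl big1 => [|i _]; rewrite !TS /=; last by rewrite mul0r.
by rewrite mulNr addr0 subn1.
Qed.
Lemma P_S_other a b l j f : a != b -> P a l (S b j * f) = S b j * P a l f.
Proof.
move=> ab; apply: taylorM_const => [i k x|i g h|i]; [exact: dPcomm|exact: dPder|].
by rewrite dPE d_S_other // scaler0 oppr0.
Qed.
Lemma P_Sd_other a b l j f : a != b -> P a l (Sd b j * f) = Sd b j * P a l f.
Proof.
move=> ab; apply: taylorM_const => [i k x|i g h|i]; [exact: dPcomm|exact: dPder|].
by rewrite dPE d_Sd_other // scaler0 oppr0.
Qed.
Lemma Q_S_other a b l j f : a != b -> Q a l (S b j * f) = S b j * Q a l f.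
Proof.
move=> ab; apply: taylorM_const => [i k x|i g h|i]; [exact: dQcomm|exact: dQder|].
by rewrite dQE d_S_other // scaler0.
Qed.

(** First derivatives of a variable are constants, so only the orders 0 and k + 1 of the exponential
    can be nonzero on it. *)
Lemma taylor_u (D : nat -> {linear A -> A}) (e : nat -> K) a b k l :
    (forall i j x, D i (D j x) = D j (D i x)) ->
    (forall i x, D i.+1 x = e i *: d a i.+1 x) -> (k.+1 < l)%N ->
  taylor D l (u b k.+1) = 0.
Proof.
move=> Dcomm De kl.
have Du i : D i.+1 (u b k.+1) = (e i * ((a == b) && (i == k))%:R)%:A.
  by rewrite De du -scalerA; case: (_ && _); rewrite ?scale1r ?scale0r.
rewrite (taylorP Dcomm (E := fun l => if l is l'.+1 then D l (u b k.+1) else u b k.+1)) //.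
  case: l kl => // l kl; rewrite Du; have -> : (l == k) = false by lia.
  by rewrite andbF mulr0 scale0r.
case=> [|m]; first by rewrite scale0r big_ord0.
rewrite big_ord_recr /= subnn big1 ?add0r // => i _; have iL := ltn_ord i.
rewrite subSS; case E: (m - i)%N => [|r]; first by move: E iL => /=; lia.
by rewrite Du De d_const !scaler0.
Qed.

(** Polynomiality enters here. The exponential is multiplicative and finite on a variable, so each
    further variable raises the cutoff by a fixed amount. This makes the vertex operators finite
    sums. *)
Lemma PQ_bound f : exists L, forall a l, (L <= l)%N -> P a l f = 0 /\ Q a l f = 0.
Proof.
elim/genA: f => [c|f g [L1 H1] [L2 H2]|b k f [L H]].
- exists 1%N => a -[//|l] _; split.
    by apply: taylor_const => [i j x|i]; [exact: dPcomm | rewrite dPE d_const scaler0 oppr0].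
  by apply: taylor_const => [i j x|i]; [exact: dQcomm | rewrite dQE d_const scaler0].
- exists (maxn L1 L2) => a l; rewrite geq_max => /andP[/(H1 a)[P1 Q1] /(H2 a)[P2 Q2]].
  by rewrite PD QD P1 P2 Q1 Q2 addr0.
exists (L + k.+2)%N => a l lL; split.
  rewrite /P taylorM => [|i j x|i g h]; [|exact: dPcomm|exact: dPder].
  apply: big1 => i _; have [ik|ik] := leqP k.+2 i; last first.
    have /(H a)[+ _] : (L <= l - i)%N by lia.
    by rewrite /P => ->; rewrite mulr0.
  rewrite (@taylor_u _ (fun i => - i.+1%:R^-1) a) ?mul0r // => i' *; exact: dPcomm.
rewrite /Q taylorM => [|i j x|i g h]; [|exact: dQcomm|exact: dQder].
apply: big1 => i _; have [ik|ik] := leqP k.+2 i; last first.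
  have /(H a)[_] : (L <= l - i)%N by lia.
  by rewrite /Q => ->; rewrite mulr0.
rewrite (@taylor_u _ (fun i => i.+1%:R^-1) a) ?mul0r // => i' *; exact: dQcomm.
Qed.

(** A cutoff picked by choice; by [vopE] and [vopsE] every other valid cutoff gives the same
    operators. *)
Definition bound f : nat := projT1 (cid (PQ_bound f)).
Lemma P_bound f a l : (bound f <= l)%N -> P a l f = 0.
Proof. by rewrite /bound; case: cid => L /= H /(H a)[]. Qed.
Lemma Q_bound f a l : (bound f <= l)%N -> Q a l f = 0.
Proof. by rewrite /bound; case: cid => L /= H /(H a)[]. Qed.

(* Coefficients of the vertex operators
   [exp (\sum t_i z^i) exp (- \sum d_i z^-i / i)] and of its inverse. *)
Definition vop a (m : int) f := \sum_(l < bound f) S a (l%:Z + m) * P a l f.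
Definition vops a (m : int) f := \sum_(l < bound f) Sd a (l%:Z + m) * Q a l f.

Lemma vopE a m f L : (forall l, (L <= l)%N -> P a l f = 0) ->
  vop a m f = \sum_(l < L) S a (l%:Z + m) * P a l f.
Proof.
move=> PL; rewrite /vop; have [le|/ltnW le] := leqP L (bound f).
  by apply: (sum_ord_zero (f := fun l => S a (l%:Z + m) * P a l f) le) => i /PL ->; rewrite mulr0.
symmetry; apply: (sum_ord_zero (f := fun l => S a (l%:Z + m) * P a l f) le) => i.
by move/(P_bound a) ->; rewrite mulr0.
Qed.
Lemma vopsE a m f L : (forall l, (L <= l)%N -> Q a l f = 0) ->
  vops a m f = \sum_(l < L) Sd a (l%:Z + m) * Q a l f.
Proof.
move=> PL; rewrite /vops; have [le|/ltnW le] := leqP L (bound f).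
  by apply: (sum_ord_zero (f := fun l => Sd a (l%:Z + m) * Q a l f) le) => i /PL ->; rewrite mulr0.
symmetry; apply: (sum_ord_zero (f := fun l => Sd a (l%:Z + m) * Q a l f) le) => i.
by move/(Q_bound a) ->; rewrite mulr0.
Qed.

Lemma vop_is_linear a m : linear (vop a m).
Proof.
move=> c f g; pose L := maxn (bound f) (bound g).
have Lf l : (L <= l)%N -> P a l f = 0 by rewrite geq_max => /andP[/(P_bound a)].
have Lg l : (L <= l)%N -> P a l g = 0 by rewrite geq_max => /andP[_ /(P_bound a)].
rewrite !(@vopE _ _ _ L) // => [|l lL]; last by rewrite PD PZ Lf // Lg // scaler0 addr0.
rewrite scaler_sumr -big_split /=; apply: eq_bigr => l _.
by rewrite PD PZ mulrDr scalerAr.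
Qed.
HB.instance Definition _ a m := GRing.isLinear.Build K A A *:%R (vop a m) (vop_is_linear a m).
Lemma vops_is_linear a m : linear (vops a m).
Proof.
move=> c f g; pose L := maxn (bound f) (bound g).
have Lf l : (L <= l)%N -> Q a l f = 0 by rewrite geq_max => /andP[/(Q_bound a)].
have Lg l : (L <= l)%N -> Q a l g = 0 by rewrite geq_max => /andP[_ /(Q_bound a)].
rewrite !(@vopsE _ _ _ L) // => [|l lL]; last by rewrite QD QZ Lf // Lg // scaler0 addr0.
rewrite scaler_sumr -big_split /=; apply: eq_bigr => l _.
by rewrite QD QZ mulrDr scalerAr.
Qed.
HB.instance Definition _ a m := GRing.isLinear.Build K A A *:%R (vops a m) (vops_is_linear a m).

(** Moving [P] past the second [S] costs the factor 1 - w/z. In terms of the normally ordered [X],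
    symmetric in its indices, the product of modes i and j is X i j - X (i + 1) (j - 1), and the
    exchange of indices in the statement reverses its sign. *)
Lemma vop_anticomm a m n g : vop a m (vop a n g) = - vop a (n - 1) (vop a (m + 1) g).
Proof.
have Pg l : (bound g <= l)%N -> P a l g = 0 by exact: P_bound.
move: (bound g) Pg => L Pg.
pose X i j := \sum_(k < L) \sum_(l < L) S a (k%:Z + i) * (S a (l%:Z + j) * P a k (P a l g)).
have XC i j : X i j = X j i.
  rewrite /X exchange_big /=; apply: eq_bigr => k _; apply: eq_bigr => l _.
  by rewrite mulrCA PC.
suff E i j : vop a i (vop a j g) = X i j - X (i + 1) (j - 1).
  have e1 : n - 1 + 1 = n by lia.
  have e2 : m + 1 - 1 = m by lia.
  by rewrite 2!E e1 e2 (XC (n - 1)) (XC n) opprB.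
rewrite [vop a j g](vopE _ Pg).
have PP l : P a l.+1 (\sum_(k < L) S a (k%:Z + j) * P a k g) =
    \sum_(k < L) S a (k%:Z + j) * P a k (P a l.+1 g)
    - \sum_(k < L) S a (k%:Z + j - 1) * P a k (P a l g).
  rewrite linear_sum -sumrB; apply: eq_bigr => k _ /=.
  by rewrite P_S ![P a _ (P a k g)]PC.
(* One term more than [L], because by [PP] the order l + 1 of [P] also involves order l. *)
rewrite (@vopE _ _ _ L.+1) => [|l lL]; last first.
  case: l lL => // l lL; rewrite PP !Pg //; last exact: leqW.
  by rewrite !big1 ?subr0 // => k _; rewrite Pz mulr0.
rewrite big_ord_recl /= P0.
rewrite [X in _ + X = _](eq_bigr (fun l : 'I_L => S a (l.+1%:Z + i) * (\sum_(k < L) S a (k%:Z + j) *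
  P a k (P a l.+1 g)) - S a (l%:Z + (i + 1)) * \sum_(k < L) S a (k%:Z + (j - 1)) *
  P a k (P a l g))); last first.
  move=> l _; rewrite bump0 PP mulrBr; congr (_ * _ - S a _ * _); first by lia.
  by apply: eq_bigr => k _; rewrite addrA.
rewrite sumrB addrA; congr (_ - _); last first.
  apply: eq_bigr => l _; rewrite mulr_sumr; apply: eq_bigr => k _.
  by rewrite [P a k _]PC.
transitivity (\sum_(l < L.+1) S a (l%:Z + i) * \sum_(k < L) S a (k%:Z + j) * P a l (P a k g)).
  rewrite big_ord_recl /=; congr (_ * _ + _).
    by apply: eq_bigr => k _; rewrite P0.
  by apply: eq_bigr => l _; rewrite bump0; congr (_ * _); apply: eq_bigr => k _; rewrite [P a k _]PC.
rewrite big_ord_recr /= [X in _ + _ * X]big1 ?mulr0 ?addr0 => [|k _]; last first.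
  by rewrite PC Pg // Pz mulr0.
by apply: eq_bigr => l _; rewrite mulr_sumr.
Qed.

(** Both products carry the factor 1/(1 - w/z), expanded in opposite directions, so their sum is a
    delta function. It pairs [S] with its inverse [Sd] and then [P] with its inverse [Q], and only
    the constant term survives. *)
Lemma vop_vops_anticomm a m n g :
  vop a m (vops a n g) + vops a (n + 1) (vop a (m - 1) g) = if m + n == 0 then g else 0.
Proof.
have Pg l : (bound g <= l)%N -> P a l g = 0 by exact: P_bound.
have Qg l : (bound g <= l)%N -> Q a l g = 0 by exact: Q_bound.
move: (bound g) Pg Qg => L Pg Qg.
(* From i = [I] on, the Schur index lowered by i is negative, so each geometric series stops; [T]
   leaves room for the other index, which stays below [L]. *)
pose I := (L + `|m| + `|n|).+2; pose T := (I + L)%N.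
pose G i k := \sum_(l < L) S a (k%:Z + i%:Z + m) *
  (Sd a (l%:Z + n - i%:Z) * P a k (Q a l g)).
pose H i l := \sum_(k < L) Sd a (l%:Z + i%:Z + n + 1) *
  (S a (k%:Z + m - 1 - i%:Z) * P a k (Q a l g)).
have PPQ k l : (L <= k)%N || (L <= l)%N -> P a k (Q a l g) = 0.
  by case/orP => [Lk|Ll]; [rewrite PQC (Pg k) ?Qz | rewrite Qg ?Pz].
have G1 i k : (I <= i)%N -> G i k = 0.
  move=> Ii; rewrite /G big1 // => l _; rewrite [Sd a _]schurz_neg ?mul0r ?mulr0 //.
  by move: (ltn_ord l) Ii; rewrite /I; lia.
have G2 i k : (L <= k)%N -> G i k = 0.
  by move=> Lk; rewrite /G big1 // => l _; rewrite PPQ ?Lk // !mulr0.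
have H1 i k : (I <= i)%N -> H i k = 0.
  move=> Ii; rewrite /H big1 // => l _; rewrite [S a _]schurz_neg ?mul0r ?mulr0 //.
  by move: (ltn_ord l) Ii; rewrite /I; lia.
have H2 i k : (L <= k)%N -> H i k = 0.
  by move=> Lk; rewrite /H big1 // => l _; rewrite PPQ ?Lk ?orbT // !mulr0.
have E1 : vop a m (vops a n g) = \sum_(i < I) \sum_(k < L) G i k.
  have PE k : P a k (vops a n g) =
      \sum_(l < L) \sum_(i < k.+1) Sd a (l%:Z + n - i%:Z) * P a (k - i)%N (Q a l g).
    rewrite (vopsE _ Qg) linear_sum; apply: eq_bigr => l _ /=; exact: P_Sd.
  rewrite (@vopE _ _ _ T) => [|k Tk]; last first.
    rewrite PE big1 // => l _; rewrite big1 // => i _.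
    have [Ii|iI] := leqP I i.
      by rewrite schurz_neg ?mul0r //; move: (ltn_ord l) Ii; rewrite /I; lia.
    by rewrite PPQ ?mulr0 //; apply/orP; left; move: Tk iI; rewrite /T; lia.
  rewrite -(@sum_triangle_box _ _ I L T) // -sum_antidiag_triangle.
  apply: eq_bigr => k _; rewrite PE exchange_big mulr_sumr /=; apply: eq_bigr => i _.
  rewrite mulr_sumr; apply: eq_bigr => l _; congr (S a _ * _).
  by move: (ltn_ord i); lia.
have E2 : vops a (n + 1) (vop a (m - 1) g) = \sum_(i < I) \sum_(l < L) H i l.
  have QE l : Q a l (vop a (m - 1) g) =
      \sum_(k < L) \sum_(i < l.+1) S a (k%:Z + (m - 1) - i%:Z) * P a k (Q a (l - i)%N g).
    rewrite (vopE _ Pg) linear_sum; apply: eq_bigr => k _ /=; rewrite Q_S.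
    by apply: eq_bigr => i _; rewrite PQC.
  rewrite (@vopsE _ _ _ T) => [|l Tl]; last first.
    rewrite QE big1 // => k _; rewrite big1 // => i _.
    have [Ii|iI] := leqP I i.
      by rewrite schurz_neg ?mul0r //; move: (ltn_ord k) Ii; rewrite /I; lia.
    by rewrite PPQ ?mulr0 //; apply/orP; right; move: Tl iI; rewrite /T; lia.
  rewrite -(@sum_triangle_box _ _ I L T) // -sum_antidiag_triangle.
  apply: eq_bigr => l _; rewrite QE exchange_big mulr_sumr /=; apply: eq_bigr => i _.
  rewrite mulr_sumr; apply: eq_bigr => k _.
  by congr (Sd a _ * (S a _ * _)); move: (ltn_ord i); lia.
rewrite E1 E2 exchange_big [X in _ + X]exchange_big /=.
have -> : \sum_(k < L) \sum_(i < I) G i k + \sum_(l < L) \sum_(i < I) H i l =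
    \sum_(k < L) \sum_(l < L) if k%:Z + l%:Z + m + n == 0 then P a k (Q a l g) else 0.
  under eq_bigr do rewrite exchange_big /=.
  under [X in _ + X]eq_bigr do rewrite exchange_big /=.
  rewrite [X in _ + X]exchange_big /= -big_split /=; apply: eq_bigr => k _.
  rewrite -big_split /=; apply: eq_bigr => l _.
  (* The two half series over i form one complete convolution, hence a Schur polynomial at [u a] -
     [u a] = 0. *)
  transitivity (schurz (fun i => u a i - u a i) (k%:Z + l%:Z + m + n) * P a k (Q a l g)); last first.
    set N := _ + n; case: eqP => [->|] /=; first by rewrite schur0 mul1r.
    case: (N) => [[|r]|r] //= _; last by rewrite mul0r.
    by rewrite schur_const0 ?mul0r // => i; rewrite subrr.
  (* The upper half of this window is the sum from [G]; the lower half, read backwards, is the sum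
     from [H]. *)
  rewrite -(schurz_sum (u a) (fun i => - u a i) (a := k%:Z + m - I%:Z) (T := I + I)).
  - rewrite big_split_ord /= mulrDl addrC; congr (_ + _).
      rewrite mulr_suml (reindex_inj rev_ord_inj) /=; apply: eq_bigr => i _.
      rewrite [LHS]mulrCA mulrA.
      by congr (S a _ * Sd a _ * _); move: (ltn_ord i); lia.
    rewrite mulr_suml; apply: eq_bigr => i _; rewrite mulrA.
    by congr (S a _ * Sd a _ * _); lia.
  - by move: (ltn_ord k); rewrite /I; lia.
  - by move: (ltn_ord l); rewrite /I; lia.
rewrite (@sum_box_antidiag _ (fun k l => if k%:Z + l%:Z + m + n == 0 then P a k (Q a l g) else 0)
  L (L + L).+1) //; last first.
- by move=> k l Lk; rewrite PPQ ?Lk ?orbT // if_same.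
- by move=> k l Lk; rewrite PPQ ?Lk // if_same.
have -> : \sum_(N < (L + L).+1) \sum_(i < N.+1) (if i%:Z + (N - i)%N%:Z + m + n == 0
      then P a i (Q a (N - i)%N g) else 0) =
    \sum_(N < (L + L).+1) if (N == 0%N :> nat) && (m + n == 0) then g else 0.
  apply: eq_bigr => N _.
  have -> : \sum_(i < N.+1) (if i%:Z + (N - i)%N%:Z + m + n == 0
      then P a i (Q a (N - i)%N g) else 0) =
      if N%:Z + m + n == 0 then \sum_(i < N.+1) P a i (Q a (N - i)%N g) else 0.
    case: (boolP (N%:Z + m + n == 0)) => [N0|NN0].
      by apply: eq_bigr => i _; rewrite ifT //; move: (ltn_ord i) N0; lia.
    by rewrite big1 // => i _; rewrite ifF //; apply/negP; move: (ltn_ord i) NN0; lia.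
  rewrite PQ_inverse; case: (nat_of_ord N) => [|r] /=; last by rewrite if_same.
  by rewrite add0r.
by rewrite big_ord_recl /= big1 ?addr0 // => i _.
Qed.

(** Distinct components do not interact. The sign expected of fermions is supplied later by [sg]. *)
Lemma vop_comm a b m n g : a != b -> vop a m (vop b n g) = vop b n (vop a m g).
Proof.
move=> ab; have ba : b != a by rewrite eq_sym.
have Pg c l : (bound g <= l)%N -> P c l g = 0 by exact: P_bound.
move: (bound g) Pg => L Pg.
have PE c e j k : c != e -> P c k (vop e j g) =
    \sum_(l < L) S e (l%:Z + j) * P c k (P e l g).
  move=> ce; rewrite (vopE _ (Pg e)) linear_sum; apply: eq_bigr => l _.
  exact: P_S_other.
rewrite (@vopE a m (vop b n g) L) => [|l Ll]; last first.
  by rewrite PE // big1 // => k _; rewrite PC Pg // Pz mulr0.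
rewrite (@vopE b n (vop a m g) L) => [|l Ll]; last first.
  by rewrite PE // big1 // => k _; rewrite PC Pg // Pz mulr0.
under eq_bigr do rewrite PE // mulr_sumr.
under [RHS]eq_bigr do rewrite PE // mulr_sumr.
rewrite exchange_big; apply: eq_bigr => k _; apply: eq_bigr => l _ /=.
by rewrite mulrCA PC.
Qed.

Lemma vop_vops_comm a b m n g : a != b -> vop a m (vops b n g) = vops b n (vop a m g).
Proof.
move=> ab; have ba : b != a by rewrite eq_sym.
have Pg c l : (bound g <= l)%N -> P c l g = 0 by exact: P_bound.
have Qg c l : (bound g <= l)%N -> Q c l g = 0 by exact: Q_bound.
move: (bound g) Pg Qg => L Pg Qg.
have PE k : P a k (vops b n g) =
    \sum_(l < L) Sd b (l%:Z + n) * P a k (Q b l g).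
  rewrite (vopsE _ (Qg b)) linear_sum; apply: eq_bigr => l _.
  exact: P_Sd_other.
have QE k : Q b k (vop a m g) =
    \sum_(l < L) S a (l%:Z + m) * Q b k (P a l g).
  rewrite (vopE _ (Pg a)) linear_sum; apply: eq_bigr => l _.
  exact: Q_S_other.
rewrite (@vopE a m (vops b n g) L) => [|l Ll]; last first.
  by rewrite PE // big1 // => k _; rewrite PQC Pg // Qz mulr0.
rewrite (@vopsE b n (vop a m g) L) => [|l Ll]; last first.
  by rewrite QE // big1 // => k _; rewrite -PQC Qg // Pz mulr0.
under eq_bigr do rewrite PE // mulr_sumr.
under [RHS]eq_bigr do rewrite QE // mulr_sumr.
rewrite exchange_big; apply: eq_bigr => k _; apply: eq_bigr => l _ /=.
by rewrite mulrCA PQC.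
Qed.

(** [Q] commutes with [P] and meets only the factor [S], which produces a geometric series of
    lowered modes. *)
Lemma Q_vop a m i g : Q a i (vop a m g) = \sum_(r < i.+1) vop a (m - r%:Z) (Q a (i - r)%N g).
Proof.
have Pg l : (bound g <= l)%N -> P a l g = 0 by exact: P_bound.
move: (bound g) Pg => L Pg.
rewrite (vopE _ Pg) linear_sum /=.
under eq_bigr do rewrite Q_S.
rewrite exchange_big; apply: eq_bigr => r _ /=.
rewrite (@vopE _ _ _ L) => [|l Ll]; last by rewrite PQC Pg // Qz.
by apply: eq_bigr => l _; rewrite PQC addrA.
Qed.

Lemma Q_vop_other a b m i g : a != b -> Q a i (vop b m g) = vop b m (Q a i g).
Proof.
move=> ab; have Pg l : (bound g <= l)%N -> P b l g = 0 by exact: P_bound.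
move: (bound g) Pg => L Pg.
rewrite (vopE _ Pg) linear_sum /= (@vopE _ _ _ L) => [|l Ll]; last by rewrite PQC Pg // Qz.
by apply: eq_bigr => l _; rewrite Q_S_other // PQC.
Qed.

(** [P] and [Q] are inverse series, so composing the vertex operator with [Q] leaves multiplication
    by [S]. This brings arbitrary polynomials within reach of the modes. *)
Lemma S_vop a j g : exists L : nat, S a j * g = \sum_(i < L) vop a (j + i%:Z) (Q a i g).
Proof.
have Pg l : (bound g <= l)%N -> P a l g = 0 by exact: P_bound.
have Qg l : (bound g <= l)%N -> Q a l g = 0 by exact: Q_bound.
move: (bound g) Pg Qg => L Pg Qg; exists L.
have -> : \sum_(i < L) vop a (j + i%:Z) (Q a i g) =
    \sum_(k < L) \sum_(i < L) S a (k%:Z + (j + i%:Z)) * P a k (Q a i g).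
  rewrite exchange_big; apply: eq_bigr => i _; apply: vopE => l Ll.
  by rewrite PQC Pg // Qz.
rewrite (@sum_box_antidiag _ (fun k i => S a (k%:Z + (j + i%:Z)) * P a k (Q a i g))
  L (L + L).+1) //; last first.
- by move=> k l Ll; rewrite Qg // Pz mulr0.
- by move=> k l Lk; rewrite PQC Pg // Qz mulr0.
have -> : \sum_(N < (L + L).+1) \sum_(i < N.+1) S a (i%:Z + (j + (N - i)%N%:Z)) *
      P a i (Q a (N - i)%N g) =
    \sum_(N < (L + L).+1) S a (N%:Z + j) * if N == 0%N :> nat then g else 0.
  apply: eq_bigr => N _; rewrite -(PQ_inverse a) mulr_sumr; apply: eq_bigr => i _.
  by congr (S a _ * _); move: (ltn_ord i); lia.
rewrite big_ord_recl /= add0r big1 ?addr0 // => i _; exact: mulr0.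
Qed.

End Vertex.

(** * Decomposable vectors and Pluecker relations *)

Section Clifford.
Context {K : numFieldType} {V : lmodType K} {I : eqType} {X : Type}.
Variables (psi psis : I -> {linear V -> V}) (vac : V) (ev : X -> {scalar V}).
Hypothesis evP : forall f, (forall x, ev x f = 0) -> f = 0.
Hypothesis car : forall i j f, psi i (psis j f) + psis j (psi i f) = (i == j)%:R *: f.
Hypothesis psiC : forall i j f, psi i (psi j f) = - psi j (psi i f).
Hypothesis psis_vac : forall i, psis i vac = 0.

(* [psi] are creation operators (multiplication by basis vectors in an exterior
   algebra), [psis] the contractions by the dual basis; [fock m] is the degree [m]
   part and [pure m] its decomposable vectors. *)
Inductive fock : nat -> V -> Prop :=
| fock_vac : fock 0 vac
| fock_psi m i f : fock m f -> fock m.+1 (psi i f)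
| fock0 m : fock m 0
| fockD m f g : fock m f -> fock m g -> fock m (f + g)
| fockZ m c f : fock m f -> fock m (c *: f).

Inductive pure : nat -> V -> Prop :=
| pure_vac c : pure 0 (c *: vac)
| pure_psi m (r : seq I) (c : I -> K) f :
    pure m f -> pure m.+1 (\sum_(i <- r) c i *: psi i f).

Lemma fock_sum m (J : Type) (r : seq J) (F : J -> V) :
  (forall j, fock m (F j)) -> fock m (\sum_(j <- r) F j).
Proof. by move=> H; elim/big_ind: _ => [|f g|j _]; [exact: fock0|exact: fockD|]. Qed.

Lemma pure_fock m f : pure m f -> fock m f.
Proof.
elim=> [c|{f}m r c f _ IH]; first exact/fockZ/fock_vac.
by apply: fock_sum => i; apply/fockZ/fock_psi.
Qed.

Lemma carE i j f : psi i (psis j f) = (i == j)%:R *: f - psis j (psi i f).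
Proof. by rewrite -car addrK. Qed.
Lemma carE' i j f : psis j (psi i f) = (i == j)%:R *: f - psi i (psis j f).
Proof. by rewrite -car addrC addKr. Qed.

Lemma fock_psis m f : fock m f ->
  forall i, (m = 0%N -> psis i f = 0) /\ fock m.-1 (psis i f).
Proof.
elim=> {m f} [i|m i f Hf IH j|m i|m f g _ IHf _ IHg i|m c f _ IH i].
- by rewrite psis_vac; split=> //; exact: fock0.
- split=> //=; rewrite carE' -scaleN1r; apply/fockD/fockZ; first exact: fockZ.
  case: m Hf IH => [|m] Hf IH; last by apply: fock_psi; case: (IH j).
  by have [/(_ erefl) -> _] := IH j; rewrite linear0; exact: fock0.
- by rewrite linear0; split=> //; exact: fock0.
- rewrite linearD; have [f0 Hf] := IHf i; have [g0 Hg] := IHg i.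
  by split=> [m0|]; [rewrite f0 // g0 // addr0 | exact: fockD].
- rewrite linearZZ; have [f0 Hf] := IH i.
  by split=> [m0|]; [rewrite f0 // scaler0 | exact: fockZ].
Qed.

(** Only the mixed relation and [psiC] are assumed. On vectors generated from [vac] this one follows
    by moving both contractions past the creation operators until they reach [vac]. *)
Lemma psisC m f : fock m f -> forall i j, psis i (psis j f) = - psis j (psis i f).
Proof.
elim=> {m f} [i j|m k f Hf IH i j|m i j|m f g _ IHf _ IHg i j|m c f _ IH i j].
- by rewrite !psis_vac !linear0 ?oppr0.
- have E i' j' : psis i' (psis j' (psi k f)) = (k == j')%:R *: psis i' f
      - ((k == i')%:R *: psis j' f - psi k (psis i' (psis j' f))).
    by rewrite carE' linearB linearZZ carE'.
  by rewrite !E (IH i j) linearN opprK opprD addrA opprB addrAC.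
- by rewrite !linear0 ?oppr0.
- by rewrite !linearD IHf IHg ?opprD.
- by rewrite !linearZZ IH ?scalerN.
Qed.

Lemma psis_sqr m f i : fock m f -> psis i (psis i f) = 0.
Proof.
move=> /psisC/(_ i i)/eqP; rewrite -subr_eq0 opprK -mulr2n -scaler_nat.
by rewrite scaler_eq0 pnatr_eq0 => /eqP.
Qed.

Lemma fock_support m f : fock m f -> exists r : seq I, forall i, i \notin r -> psis i f = 0.
Proof.
elim=> {m f} [|m k f _ [r H]|m|m f g _ [r1 H1] _ [r2 H2]|m c f _ [r H]].
- by exists [::] => i _; exact: psis_vac.
- exists (k :: r) => i; rewrite inE negb_or eq_sym => /andP[ik /H ir].
  by rewrite carE' (negPf ik) scale0r ir linear0 subrr.
- by exists [::] => i _; exact: linear0.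
- exists (r1 ++ r2) => i; rewrite mem_cat negb_or => /andP[/H1 E1 /H2 E2].
  by rewrite linearD E1 E2 addr0.
- by exists r => i /H E; rewrite linearZZ E scaler0.
Qed.

(** The number operator, as a finite sum over any [r] containing the modes that occur. It shows that
    a nonzero vector of positive degree has a nonzero contraction. *)
Lemma fock_number m f : fock m f -> exists r0 : seq I, forall r, uniq r ->
  {subset r0 <= r} -> \sum_(i <- r) psi i (psis i f) = m%:R *: f.
Proof.
elim=> {m f} [|m k f _ [r0 H]|m|m f g _ [r1 H1] _ [r2 H2]|m c f _ [r0 H]].
- by exists [::] => r _ _; rewrite big1 ?scale0r // => i _; rewrite psis_vac linear0.
- exists (k :: r0) => r ur sr.
  have kr : k \in r by apply: sr; rewrite mem_head.
  have /(H r ur) E : {subset r0 <= r} by move=> i ir; apply: sr; rewrite inE ir orbT.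
  under eq_bigr => i _ do rewrite carE' linearB linearZZ psiC opprK.
  rewrite big_split /= (bigD1_seq k) //= eqxx scale1r big1 ?addr0; last first.
    by move=> i ik; rewrite eq_sym (negPf ik) scale0r.
  by rewrite -linear_sum E linearZZ -natr1 scalerDl scale1r addrC.
- by exists [::] => r _ _; rewrite big1 ?scaler0 // => i _; rewrite !linear0.
- exists (r1 ++ r2) => r ur sr.
  have /(H1 r ur) E1 : {subset r1 <= r} by move=> i ir; apply: sr; rewrite mem_cat ir.
  have /(H2 r ur) E2 : {subset r2 <= r} by move=> i ir; apply: sr; rewrite mem_cat ir orbT.
  by under eq_bigr do rewrite !linearD; rewrite big_split /= E1 E2 scalerDr.
- exists r0 => r ur /(H r ur) E; under eq_bigr do rewrite !linearZZ.
  by rewrite -scaler_sumr E scaleCA.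
Qed.

(* The vanishing of [\sum_i Y i (x) Z i], tested on the functionals [ev]. *)
Definition tens0 (r : seq I) (Y Z : I -> V) :=
  forall x y, \sum_(i <- r) ev x (Y i) * ev y (Z i) = 0.

Lemma tens0l r Y Z y : tens0 r Y Z -> \sum_(i <- r) ev y (Z i) *: Y i = 0.
Proof.
move=> H; apply: evP => x; rewrite linear_sum -[RHS](H x y); apply: eq_bigr => i _.
by rewrite linearZ mulrC.
Qed.
Lemma tens0r r Y Z x : tens0 r Y Z -> \sum_(i <- r) ev x (Y i) *: Z i = 0.
Proof.
move=> H; apply: evP => y; rewrite linear_sum -[RHS](H x y); apply: eq_bigr => i _.
by rewrite linearZ.
Qed.

(** The family [ev] is not assumed stable under composition with [phi]. So one factor is tested
    first, the resulting vector vanishes by [evP] and can be mapped by [phi]; then the roles are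
    exchanged. *)
Lemma tens0_map (phi : {linear V -> V}) r Y Z :
  tens0 r Y Z -> tens0 r (fun i => phi (Y i)) (fun i => phi (Z i)).
Proof.
move=> H x y; have H' : tens0 r (fun i => phi (Y i)) Z.
  move=> x' y'; have /(congr1 (fun f => ev x' (phi f))) := tens0l y' H.
  rewrite !linear0 !linear_sum => E; rewrite -[RHS]E; apply: eq_bigr => i _.
  by rewrite linearZZ linearZ mulrC.
have /(congr1 (fun f => ev y (phi f))) := tens0r x H'.
rewrite !linear0 !linear_sum => E; rewrite -[RHS]E; apply: eq_bigr => i _.
by rewrite linearZZ linearZ.
Qed.

(** The sum over all modes is infinite; it is encoded by asking for every finite set that is large
    enough. *)
Definition plucker f := exists r0 : seq I, forall r, uniq r -> {subset r0 <= r} ->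
  tens0 r (fun i => psi i f) (fun i => psis i f).

Lemma pluckerZ c f : plucker f -> plucker (c *: f).
Proof.
move=> [r0 H]; exists r0 => r ur sr x y.
transitivity (c * (c * \sum_(i <- r) ev x (psi i f) * ev y (psis i f))).
  rewrite !mulr_sumr; apply: eq_bigr => i _.
  by rewrite !linearZZ !linearZ mulrCA -!mulrA [_ * (c * _)]mulrCA.
by rewrite H // !mulr0.
Qed.

(** Apply the contraction to both factors. Moving it past [psi i] yields one extra term, at i = j,
    whose second factor [psis j (psis j f)] is zero. *)
Lemma plucker_psis m f j : fock m f -> plucker f -> plucker (psis j f).
Proof.
move=> Ff [r0 H]; exists (j :: r0) => r ur sr x y.
have jr : j \in r by apply: sr; rewrite mem_head.
have /(H r ur) T : {subset r0 <= r} by move=> i ir; apply: sr; rewrite inE ir orbT.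
have {}T := tens0_map (psis j) T x y.
transitivity (\sum_(i <- r) ((i == j)%:R * ev x f * - ev y (psis j (psis i f)) +
  ev x (psis j (psi i f)) * ev y (psis j (psis i f)))).
  apply: eq_bigr => i _; rewrite carE (psisC Ff i j) linearB linearN linearZ /=.
  by rewrite mulrBl [X in _ - X]mulrN opprK.
rewrite big_split /= T addr0 (bigD1_seq j) //= (psis_sqr j Ff) linear0 oppr0 mulr0.
by rewrite add0r big1 // => i /negPf->; rewrite !mul0r.
Qed.

Lemma fock0E m f : fock m f -> m = 0%N -> exists c, f = c *: vac.
Proof.
elim=> {m f} [_|//|m _|m f g _ IHf _ IHg m0|m c f _ IH m0].
- by exists 1; rewrite scale1r.
- by exists 0; rewrite scale0r.
- have [[a ->] [b ->]] := (IHf m0, IHg m0).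
  by exists (a + b); rewrite scalerDl.
- by have [a ->] := IH m0; exists (c * a); rewrite scalerA.
Qed.

(* By the relation, [u = \sum_i ev x0 (psis i f) *: psi i] satisfies [u f = 0]. Hence
   [f] is proportional to [u (psis i0 f)], where [psis i0 f] has smaller degree and
   inherits the relation. *)
Lemma plucker_pure m f : fock m f -> f != 0 -> plucker f -> pure m f.
Proof.
elim: m f => [|m IHm] f Ff f0 Pf.
  by have [c ->] := fock0E Ff erefl; exact: pure_vac.
(* Otherwise the number operator would give (m + 1) f = 0. *)
have [i0 fi0] : exists i, psis i f != 0.
  apply: contrapT => /forallNP N; have [r0 H] := fock_number Ff.
  have /eqP := H (undup r0) (undup_uniq _) (fun i => etrans (mem_undup _ _)).
  rewrite big1 => [|i _].
    by rewrite eq_sym scaler_eq0 pnatr_eq0 (negPf f0).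
  by have /negP := N i; rewrite negbK => /eqP->; rewrite linear0.
have [x0 fx0] : exists x, ev x (psis i0 f) != 0.
  apply: contrapT => /forallNP N; case/eqP: fi0; apply: evP => x.
  by have /negP := N x; rewrite negbK => /eqP.
have [r0 H] := Pf; pose r := undup (i0 :: r0).
have i0r : i0 \in r by rewrite mem_undup mem_head.
have ur : uniq r by exact: undup_uniq.
have sr : {subset r0 <= r} by move=> i ir; rewrite mem_undup inE ir orbT.
pose c i := ev x0 (psis i f).
have uf : \sum_(i <- r) c i *: psi i f = 0 := tens0l x0 (H r ur sr).
pose f' := (c i0)^-1 *: psis i0 f.
have fE : f = \sum_(i <- r) c i *: psi i f'.
  transitivity (\sum_(i <- r) ((c i0)^-1 *: (c i *: ((i == i0)%:R *: f))
      - (c i0)^-1 *: psis i0 (c i *: psi i f))); last first.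
    apply: eq_bigr => i _; rewrite [in RHS]linearZZ carE !scalerBr [psis i0 (_ *: _)]linearZZ.
    by rewrite !(scaleCA (c i)).
  rewrite sumrB -!scaler_sumr -linear_sum uf linear0 scaler0 subr0.
  rewrite (bigD1_seq i0) //= eqxx scale1r big1 ?addr0 => [|i ii0].
    by rewrite scalerA mulVf // scale1r.
  by rewrite (negPf ii0) scale0r scaler0.
rewrite fE; apply/pure_psi/IHm.
- by apply: fockZ; have [_] := fock_psis Ff i0.
- by rewrite scaler_eq0 invr_eq0 negb_or fx0.
- exact/pluckerZ/(plucker_psis _ Ff).
Qed.

Definition comb (r : seq I) (c : I -> K) g := \sum_(k <- r) c k *: psi k g.
Lemma comb_is_linear r c : linear (comb r c).
Proof.
move=> a f g; rewrite /comb scaler_sumr -big_split; apply: eq_bigr => k _ /=.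
by rewrite linearP scalerDr scaleCA.
Qed.
HB.instance Definition _ r c := GRing.isLinear.Build K V V *:%R (comb r c)
  (comb_is_linear r c).

(** Multiplication by a vector, [U], anticommutes with creation operators and squares to zero, while
    moving a contraction past [U] leaves the scalar [c' i]. Hence the relation for [U f] is the one
    for f with [U] applied to both factors, plus a term containing [U (U f)]. *)
Lemma pure_plucker m f : pure m f -> plucker f.
Proof.
elim=> {m f} [a|m r1 c f pf [r0 H]].
  exists [::] => r _ _ x y; rewrite big1 // => i _.
  by rewrite !linearZZ psis_vac scaler0 linear0 mulr0.
pose U : {linear V -> V} := comb r1 c.
have UE g : U g = \sum_(k <- r1) c k *: psi k g by [].
rewrite -UE; exists (r1 ++ r0) => r ur sr x y.
have psiU i g : psi i (U g) = - U (psi i g).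
  rewrite !UE -sumrN [LHS]linear_sum; apply: eq_bigr => k _.
  by rewrite [LHS]linearZZ (psiC i) scalerN.
have UU g : U (U g) = 0.
  have UN : U (U g) = - U (U g).
    transitivity (- \sum_(k <- r1) U (c k *: psi k g)).
      rewrite [LHS]UE -sumrN; apply: eq_bigr => k _.
      by rewrite linearZZ psiU scalerN.
    by rewrite -linear_sum.
  by move/eqP: UN; rewrite -subr_eq0 opprK -mulr2n -scaler_nat scaler_eq0 pnatr_eq0 => /eqP.
have /(H r ur) T : {subset r0 <= r} by move=> i ir; apply: sr; rewrite mem_cat ir orbT.
have {}T := tens0_map U T x y.
pose c' i := \sum_(k <- r1) (k == i)%:R * c k.
have psisU i : psis i (U f) = c' i *: f - U (psis i f).
  rewrite !UE linear_sum scaler_suml -sumrB; apply: eq_bigr => k _.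
  by rewrite linearZZ carE' scalerBr scalerA mulrC.
have Uc : \sum_(i <- r) c' i *: psi i f = U f.
  rewrite UE; under eq_bigr do rewrite scaler_suml.
  rewrite exchange_big big_seq [RHS]big_seq; apply: eq_bigr => k kr1 /=.
  have kr : k \in r by apply: sr; rewrite mem_cat kr1.
  rewrite (bigD1_seq k) //= eqxx mul1r big1 ?addr0 // => i ik.
  by rewrite eq_sym (negPf ik) mul0r scale0r.
transitivity (ev x (- U (\sum_(i <- r) c' i *: psi i f)) * ev y f +
   \sum_(i <- r) ev x (U (psi i f)) * ev y (U (psis i f))).
  have -> : ev x (- U (\sum_(i <- r) c' i *: psi i f)) =
      \sum_(i <- r) - (c' i * ev x (U (psi i f))).
    rewrite linearN [U (\sum_(i <- r) _)]linear_sum [ev x _]linear_sum -sumrN.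
    by apply: eq_bigr => i _; rewrite [U (_ *: _)]linearZZ [ev x (_ *: _)]linearZ.
  rewrite mulr_suml -big_split; apply: eq_bigr => i _ /=.
  rewrite psiU psisU [ev x (- _)]linearN [ev y (_ - _)]linearB [ev y (_ *: _)]linearZ /=.
  by rewrite mulrBr !mulNr opprK mulrCA mulrA.
by rewrite T addr0 Uc UU oppr0 linear0 mul0r.
Qed.

End Clifford.

(** * The bosonic realization *)

Section FockSpace.
Context {K : numFieldType} {A : comAlgType K} {s : nat}.
Context {u : 'I_s -> nat -> A} {d : 'I_s -> nat -> {linear A -> A}}.
Hypothesis dcomm : forall a b i j x, d a i (d b j x) = d b j (d a i x).
Hypothesis dder : forall a i f g, leibniz (d a i) f g.
Hypothesis du : forall a b i k, d a i.+1 (u b k.+1) = ((a == b) && (i == k))%:R.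
Hypothesis genA : forall T : A -> Prop, (forall c : K, T c%:A) ->
  (forall f g, T f -> T g -> T (f + g)) -> (forall a k f, T f -> T (u a k.+1 * f)) ->
  forall f, T f.
Context {Y : Type} {co : Y -> {scalar A}}.
Hypothesis coP : forall f, (forall y, co y f = 0) -> f = 0.

Notation S a := (schurz (u a)).
Notation Sd a := (schurz (fun i => - u a i)).
Notation vop := (vop dcomm dder du genA).
Notation vops := (vops dcomm dder du genA).
Notation P := (P d).
Notation Q := (Q d).
Notation V := (lattice s -> A).
Implicit Types (a b : 'I_s) (v w : lattice s) (f g : V).

(** Raising a coordinate b < a flips this sign, so that the commuting vertex operators of distinct
    components become anticommuting modes. *)
Definition sg a v : K := (-1) ^ (\sum_(b < s | (b < a)%N) v b).

Lemma sgD a v w : sg a (v + w) = sg a v * sg a w.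
Proof.
rewrite /sg -expfzDr ?oppr_eq0 ?oner_eq0 // -big_split /=.
by congr (_ ^ _); apply: eq_bigr => b _; rewrite ffunE.
Qed.

Lemma sg_sqr a v : sg a v * sg a v = 1.
Proof.
by rewrite /sg -expfzMl mulrNN mulr1 exp1rz.
Qed.

Lemma sgN a v : sg a (- v) = sg a v.
Proof.
have sg0 : sg a 0 = 1 by rewrite /sg big1 // => b _; rewrite ffunE.
rewrite -[LHS]mulr1 -(sg_sqr a v) mulrA -sgD addNr sg0 mul1r //.
Qed.

Lemma sg_unitv a b : sg a (unitv b) = if (b < a)%N then -1 else 1.
Proof.
rewrite /sg; case: ifP => ba.
  rewrite (bigD1 b) //= ffunE eqxx big1 ?addr0 ?expr1z // => c /andP[_ cb].
  by rewrite ffunE (negPf cb).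
rewrite big1 ?expr0z // => c ca; rewrite ffunE; case: eqP => // cb.
by rewrite -cb ca in ba.
Qed.

(** The offset by [v a] comes from z raised to the charge. It absorbs the unit shifts in
    [vop_anticomm] and [vop_vops_anticomm], leaving the standard relations. *)
Definition psi a (n : int) f : V := fun v => sg a v *: vop a (n - v a) (f (v - unitv a)).
Definition psis a (n : int) f : V :=
  fun v => sg a v *: vops a (v a + 1 - n) (f (v + unitv a)).

Lemma psi_is_linear a n : linear (psi a n).
Proof.
move=> c f g; apply: funext => v; rewrite /psi [(c *: f + g) _]/(c *: f _ + g _).
by rewrite linearP scalerDr scaleCA.
Qed.
HB.instance Definition _ a n := GRing.isLinear.Build K V V *:%R (psi a n) (psi_is_linear a n).
Lemma psis_is_linear a n : linear (psis a n).
Proof.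
move=> c f g; apply: funext => v; rewrite /psis [(c *: f + g) _]/(c *: f _ + g _).
by rewrite linearP scalerDr scaleCA.
Qed.
HB.instance Definition _ a n := GRing.isLinear.Build K V V *:%R (psis a n) (psis_is_linear a n).

Lemma vopZ a n c x : vop a n (c *: x) = c *: vop a n x.
Proof. exact: linearZZ. Qed.
Lemma vopsZ a n c x : vops a n (c *: x) = c *: vops a n x.
Proof. exact: linearZZ. Qed.
Lemma psiE a n f v : psi a n f v = sg a v *: vop a (n - v a) (f (v - unitv a)).
Proof. by []. Qed.
Lemma psisE a n f v : psis a n f v = sg a v *: vops a (v a + 1 - n) (f (v + unitv a)).
Proof. by []. Qed.
Lemma fctDE f g v : (f + g) v = f v + g v. Proof. by []. Qed.
Lemma fctNE f v : (- f) v = - f v. Proof. by []. Qed.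
Lemma fctZE c f v : (c *: f) v = c *: f v. Proof. by []. Qed.

Lemma psiD a n f g : psi a n (f + g) = psi a n f + psi a n g.
Proof. exact: linearD. Qed.
Lemma psiZ a n c f : psi a n (c *: f) = c *: psi a n f.
Proof. exact: linearZZ. Qed.
Lemma psi0 a n : psi a n 0 = 0.
Proof. exact: linear0. Qed.

Lemma psi_psi a b m n f : psi a m (psi b n f) = - psi b n (psi a m f).
Proof.
apply: funext => v; rewrite fctNE !psiE !vopZ !scalerA -scalerN.
rewrite [v - _ - _]addrAC; have [->|ab] := eqVneq a b.
  congr (_ *: _); rewrite !ffunE eqxx /= vop_anticomm.
  by congr (- vop _ _ (vop _ _ _)); ring.
rewrite vop_comm // !ffunE eq_sym (negPf ab) !subr0 scalerN -scaleNr.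
rewrite !sgD !sgN !sg_unitv; congr (_ *: _).
case: (ltngtP a b) ab => [||/val_inj->]; last by rewrite eqxx.
  by rewrite mulrN1 mulr1 mulrN mulrC.
by rewrite mulrN1 mulr1 mulrN opprK mulrC.
Qed.

Lemma psi_psis a b m n f :
  psi a m (psis b n f) + psis b n (psi a m f) = ((a == b) && (m == n))%:R *: f.
Proof.
apply: funext => v; rewrite fctDE fctZE psiE psisE psisE psiE.
rewrite vopZ vopsZ !scalerA [v + _ - _]addrAC; have [->|ab] := eqVneq a b.
  rewrite !sgD !sgN !mulrA !sg_sqr !mul1r sg_unitv ltnn.
  rewrite !scale1r !ffunE eqxx /= !subrK.
  have := vop_vops_anticomm dcomm dder du genA b (m - v b) (v b - n) (f v).
  rewrite (_ : v b - n + 1 = v b + 1 - n); last by ring.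
  rewrite (_ : m - v b - 1 = m - (v b + 1)); last by ring.
  move=> ->; rewrite (_ : m - v b + (v b - n) = m - n); last by ring.
  by rewrite subr_eq0; case: eqP; rewrite ?scale1r ?scale0r.
have ba : b != a by rewrite eq_sym.
rewrite vop_vops_comm // !ffunE (negPf ab) (negPf ba) subr0 addr0.
rewrite -scalerDl !sgD !sgN !sg_unitv.
rewrite (_ : _ + _ = 0) ?scale0r //.
case: (ltngtP a b) ab => [||/val_inj->]; last by rewrite eqxx.
  by move=> *; ring.
by move=> *; ring.
Qed.

Definition vac : V := fun v => if v == 0 then 1 else 0.

Lemma P1 a l : P a l 1 = if l == 0%N then 1 else 0.
Proof.
apply: taylor_const => [i j x|i]; first exact: dPcomm.
by rewrite dPE (d_one dder) scaler0 oppr0.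
Qed.
Lemma Q1 a l : Q a l 1 = if l == 0%N then 1 else 0.
Proof.
apply: taylor_const => [i j x|i]; first exact: dQcomm.
by rewrite dQE (d_one dder) scaler0.
Qed.

Lemma vop1 a m : vop a m 1 = S a m.
Proof.
rewrite (@vopE _ _ _ _ _ dcomm dder du genA _ _ _ 1) => [|[|l] //]; rewrite ?P1 //.
by rewrite big_ord1 P1 mulr1 add0r.
Qed.
Lemma vops1 a m : vops a m 1 = Sd a m.
Proof.
rewrite (@vopsE _ _ _ _ _ dcomm dder du genA _ _ _ 1) => [|[|l] //]; rewrite ?Q1 //.
by rewrite big_ord1 Q1 mulr1 add0r.
Qed.

Lemma psis_vac a (n : int) : 1 <= n -> psis a n vac = 0.
Proof.
move=> n1; apply: funext => v; rewrite /psis /vac; case: eqP => [v0|_]; last first.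
  by rewrite linear0 scaler0.
rewrite vops1 schurz_neg ?scaler0 //.
by move/ffunP/(_ a): v0; rewrite !ffunE eqxx mulr1n => ->; rewrite sub0r oppr_lt0 (lt_le_trans _ n1).
Qed.

Lemma psi_vac a (n : int) : n <= 0 -> psi a n vac = 0.
Proof.
move=> n0; apply: funext => v; rewrite /psi /vac; case: eqP => [v0|_]; last first.
  by rewrite linear0 scaler0.
rewrite vop1 schurz_neg ?scaler0 //.
move/ffunP/(_ a): v0; rewrite !ffunE eqxx mulr1n => /eqP; rewrite subr_eq0 => /eqP->.
by rewrite subr_lt0 (le_lt_trans n0).
Qed.

(* Only the modes of positive index are used: they generate from [vac] the part of
   the Fock space which lies above [vac]. *)
Definition cre (i : 'I_s * nat) : {linear V -> V} := psi i.1 i.2.+1.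
Definition ann (i : 'I_s * nat) : {linear V -> V} := psis i.1 i.2.+1.
Definition evl (x : lattice s * Y) f : K := co x.2 (f x.1).
Lemma evl_is_linear x : scalar (evl x).
Proof. by move=> c f g; rewrite /evl linearP. Qed.
HB.instance Definition _ x := GRing.isLinear.Build K V K *%R (evl x) (evl_is_linear x).

Lemma evlP f : (forall x, evl x f = 0) -> f = 0.
Proof. by move=> H; apply: funext => v; apply: coP => y; exact: (H (v, y)). Qed.

Lemma cre_ann i j f : cre i (ann j f) + ann j (cre i f) = (i == j)%:R *: f.
Proof. by case: i j => [a m] [b n]; rewrite /cre /ann /= psi_psis. Qed.

Lemma creC i j f : cre i (cre j f) = - cre j (cre i f).
Proof. exact: psi_psi. Qed.

Lemma ann_vac i : ann i vac = 0.
Proof. exact: psis_vac. Qed.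

Notation fockV := (fock cre vac).

(** On [vac] such a mode gives a Schur polynomial of negative index, and it anticommutes with the
    generators. This is what restricts the residue to positive modes. *)
Lemma fock_low m f a (n : int) : fockV m f -> n <= 0 -> psi a n f = 0.
Proof.
move=> Hf n0; elim: Hf => {m f} [|m i f _ IH|m|m f g _ IHf _ IHg|m c f _ IH].
- exact: psi_vac.
- by rewrite /cre /= psi_psi IH psi0 oppr0.
- exact: psi0.
- by rewrite psiD IHf IHg addr0.
- by rewrite psiZ IH scaler0.
Qed.

Lemma fock_psi_int m f a (n : int) : fockV m f -> fockV m.+1 (psi a n f).
Proof.
move=> Hf; have [n0|n0] := leP n 0; first by rewrite (fock_low _ Hf n0); exact: fock0.
have -> : n = `|n|.-1.+1%N%:Z by lia.
exact: (fock_psi (psi := cre) (a, `|n|.-1)).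
Qed.

Lemma fct_sumE' (J : Type) (r : seq J) (F : J -> V) v :
  (\sum_(j <- r) F j) v = \sum_(j <- r) F j v.
Proof. exact: (big_morph (fun f : V => f v)). Qed.

Lemma Q_psi a i n f : (fun v => Q a i (psi a n f v)) =
  \sum_(r < i.+1) psi a (n - r%:Z) (fun v => Q a (i - r)%N (f v)).
Proof.
apply: funext => v; rewrite fct_sumE' psiE QZ // Q_vop scaler_sumr.
by apply: eq_bigr => r _; rewrite psiE addrAC.
Qed.

Lemma Q_psi_other a b i n f : a != b ->
  (fun v => Q a i (psi b n f v)) = psi b n (fun v => Q a i (f v)).
Proof. by move=> ab; apply: funext => v; rewrite psiE QZ // Q_vop_other. Qed.

(** [Q] turns a mode into modes of smaller or equal index; those leaving the positive range are
    harmless by [fock_low]. *)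
Lemma fock_Q m f a i : fockV m f -> fockV m (fun v => Q a i (f v)).
Proof.
move=> Hf; elim: Hf i => {m f} [|m [b n] f _ IH|m|m f g _ IHf _ IHg|m c f _ IH] i.
- have [->|i0] := eqVneq i 0%N.
    rewrite (_ : (fun v => _) = vac); first exact: fock_vac.
    by apply: funext => v; rewrite Q0.
  rewrite (_ : (fun v => _) = 0); first exact: fock0.
  apply: funext => v; rewrite /vac; case: eqP => _; last exact: Qz.
  by rewrite Q1 (negPf i0).
- have [ab|ab] := eqVneq a b.
    rewrite /cre /= -ab Q_psi; apply: fock_sum => r; exact/fock_psi_int/IH.
  by rewrite /cre /= Q_psi_other //; exact/fock_psi_int/IH.
- rewrite (_ : (fun v => _) = 0); first exact: fock0.
  by apply: funext => v; exact: Qz.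
- rewrite (_ : (fun v => _) = (fun v => Q a i (f v)) + (fun v => Q a i (g v))).
    exact: fockD.
  by apply: funext => v; rewrite fctDE QD.
- rewrite (_ : (fun v => _) = c *: (fun v => Q a i (f v))); first exact: fockZ.
  by apply: funext => v; rewrite fctZE QZ.
Qed.

(* Multiplication by [q^e] in terms of coefficients. *)
Definition shift (e : lattice s) f : V := fun v => f (v - e).

Lemma shift_psi a b n f :
  shift (unitv a) (psi b n f) =
  (if (a < b)%N then -1 else 1) *: psi b (n + (b == a)%:R) (shift (unitv a) f).
Proof.
apply: funext => v; rewrite fctZE psiE /shift psiE sgD sgN sg_unitv scalerA mulrC.
rewrite !ffunE; congr (_ *: vop _ _ (f _)); first by rewrite opprB addrA addrAC.
by rewrite addrAC.
Qed.

Lemma shift_vac a : shift (unitv a) vac = psi a 1 vac.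
Proof.
apply: funext => v; rewrite psiE /shift /vac; case: eqP => [/eqP|_]; last first.
  by rewrite linear0 scaler0.
rewrite subr_eq0 => /eqP->; rewrite sg_unitv ltnn scale1r vop1 ffunE eqxx subrr /=.
by rewrite schur0.
Qed.

(** The shift only renumbers the modes, up to sign, and sends [vac] to [psi a 1 vac], whence one
    degree more. *)
Lemma fock_shift1 m f a : fockV m f -> fockV m.+1 (shift (unitv a) f).
Proof.
elim=> {m f} [|m [b n] f _ IH|m|m f g _ IHf _ IHg|m c f _ IH].
- rewrite shift_vac; exact/fock_psi_int/fock_vac.
- by rewrite /cre /= shift_psi; apply/fockZ/fock_psi_int.
- exact: fock0.
- exact: fockD.
- exact: fockZ.
Qed.

Definition nvec (k : {ffun 'I_s -> nat}) : lattice s := [ffun a => (k a)%:Z].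

Lemma fock_shift m f (k : {ffun 'I_s -> nat}) :
  fockV m f -> fockV (m + \sum_a k a)%N (shift (nvec k) f).
Proof.
have [N leN] := ubnP (\sum_a k a)%N; elim: N k leN => // N IHN k leN Hf.
have [/eqP|] := eqVneq (\sum_a k a)%N 0%N.
  rewrite sum_nat_eq0 => /forallP k0; rewrite big1 => [|a _]; last exact/eqP/k0.
  rewrite addn0 (_ : nvec k = 0) => [|]; last first.
    by apply/ffunP => a; rewrite !ffunE; have /eqP-> := k0 a.
  by rewrite (_ : shift 0 f = f) //; apply: funext => v; rewrite /shift subr0.
rewrite sum_nat_eq0 => /forallPn[a /= ka].
pose k' : {ffun 'I_s -> nat} := [ffun b => (k b - (b == a))%N].
have kE : nvec k = nvec k' + unitv a.
  apply/ffunP => b; rewrite !ffunE; case: eqP => [->|_]; last by rewrite subn0 addr0.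
  by move: ka; case: (k a) => // r _; rewrite subn1 intS addrC.
have sE : (\sum_b k b = (\sum_b k' b).+1)%N.
  rewrite (bigD1 a) //= [in RHS](bigD1 a) //= ffunE eqxx subn1 -addSn prednK ?lt0n //.
  by congr (_ + _)%N; apply: eq_bigr => b ba; rewrite ffunE (negPf ba) subn0.
rewrite sE addnS (_ : shift _ f = shift (unitv a) (shift (nvec k') f)).
  by apply/fock_shift1/IHN => //; rewrite -ltnS -sE.
by apply: funext => v; rewrite /shift kE opprD addrA addrAC.
Qed.

Definition dl v (x : A) : V := fun w => if w == v then x else 0.

Lemma dlD v x y : dl v (x + y) = dl v x + dl v y.
Proof. by apply: funext => w; rewrite fctDE /dl; case: eqP; rewrite ?addr0. Qed.
Lemma dlZ v c x : dl v (c *: x) = c *: dl v x.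
Proof. by apply: funext => w; rewrite fctZE /dl; case: eqP; rewrite ?scaler0. Qed.
Lemma shift_dl e v x : shift e (dl v x) = dl (v + e) x.
Proof. by apply: funext => w; rewrite /shift /dl subr_eq. Qed.

Lemma fock_dlS m v x a j : fockV m (dl v x) -> fockV m.+1 (dl (v + unitv a) (S a j * x)).
Proof.
move=> Hf; have [L SE] := S_vop dcomm dder du genA a j x.
(* The mode index is offset to cancel the charge that [psi] subtracts, and the prefactor cancels the
   sign of [psi]. *)
have -> : dl (v + unitv a) (S a j * x) = sg a (v + unitv a) *:
    \sum_(i < L) psi a (j + i%:Z + (v + unitv a) a) (fun w => Q a i (dl v x w)).
  apply: funext => w; rewrite fctZE fct_sumE' scaler_sumr /dl.
  case: eqP => [->|wv].
    rewrite SE; apply: eq_bigr => i _.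
    by rewrite psiE !addrK eqxx scalerA sg_sqr scale1r.
  rewrite big1 // => i _; rewrite psiE; case: eqP => [e|_]; first by case: wv; rewrite -e subrK.
  by rewrite (Qz dcomm) linear0 !scaler0.
by apply/fockZ/fock_sum => i; exact/fock_psi_int/fock_Q.
Qed.

(** The degree is tied to the lattice point, so that two vectors shifted to the same point have the
    same degree and can be added. *)
Definition spanned (x : A) := forall v, exists (k : {ffun 'I_s -> nat}) m,
  m%:Z = \sum_a (v + nvec k) a /\ fockV m (dl (v + nvec k) x).

Lemma nvecD (k1 k2 : {ffun 'I_s -> nat}) :
  nvec [ffun a => (k1 a + k2 a)%N] = nvec k1 + nvec k2.
Proof. by apply/ffunP => a; rewrite !ffunE PoszD. Qed.

Lemma sum_nvec v (k : {ffun 'I_s -> nat}) :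
  \sum_a (v + nvec k) a = \sum_a v a + (\sum_a k a)%N%:Z.
Proof.
rewrite -natz natr_sum -big_split; apply: eq_bigr => a _.
by rewrite !ffunE natz.
Qed.

Lemma fock_enlarge m (k1 k2 : {ffun 'I_s -> nat}) f : fockV m (shift (nvec k1) f) ->
  fockV (m + \sum_a k2 a)%N (shift (nvec k1 + nvec k2) f).
Proof.
move/(fock_shift k2); rewrite (_ : shift _ (shift _ f) = shift (nvec k1 + nvec k2) f) //.
by apply: funext => v; rewrite /shift opprD addrA addrAC.
Qed.

Lemma spannedD x y : spanned x -> spanned y -> spanned (x + y).
Proof.
move=> Hx Hy v; have [k1 [m1 [m1E Hx1]]] := Hx v; have [k2 [m2 [m2E Hy2]]] := Hy v.
exists [ffun a => (k1 a + k2 a)%N], (m1 + \sum_a k2 a)%N.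
have Ex := @fock_enlarge m1 k1 k2 (dl v x); rewrite !shift_dl in Ex.
have Ey := @fock_enlarge m2 k2 k1 (dl v y); rewrite !shift_dl in Ey.
rewrite nvecD; split.
  by rewrite addrA sum_nvec -m1E PoszD.
rewrite dlD; apply: fockD; first exact: Ex.
rewrite [nvec k1 + _]addrC (_ : m1 + _ = m2 + \sum_a k1 a)%N; first exact: Ey.
apply/eqP; rewrite -eqz_nat !PoszD m1E m2E !sum_nvec.
by rewrite -!addrA [_%:Z + _%:Z]addrC.
Qed.

Lemma spannedZ c x : spanned x -> spanned (c *: x).
Proof.
move=> Hx v; have [k [m [mE Hm]]] := Hx v; exists k, m; split=> //.
by rewrite dlZ; exact: fockZ.
Qed.

Lemma spannedS a j x : spanned x -> spanned (S a j * x).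
Proof.
move=> Hx v; have [k [m [mE Hm]]] := Hx v.
exists [ffun b => (k b + (b == a))%N], m.+1.
have kE : nvec [ffun b => (k b + (b == a))%N] = nvec k + unitv a.
  by apply/ffunP => b; rewrite !ffunE PoszD; case: eqP.
rewrite kE addrA; split; last exact: fock_dlS.
rewrite -addrA -kE sum_nvec (_ : (\sum_b _ = \sum_b k b + 1)%N) => [|]; last first.
  under eq_bigr do rewrite ffunE; rewrite big_split /=; congr (_ + _)%N.
  by rewrite (bigD1 a) //= eqxx big1 // => b /negPf->.
by rewrite PoszD addrA -sum_nvec -mE addrC -intS.
Qed.

(** The Euler recursion writes (k + 1) s_{k+1} as (k + 1) u_{k+1} plus products of lower variables
    with Schur polynomials; it is solved for u_{k+1}. *)
Lemma spanned_u a k x : spanned x -> spanned (u a k.+1 * x).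
Proof.
elim/ltn_ind: k x => k IHk x Hx.
have k0 : k.+1%:R != 0 :> K by rewrite pnatr_eq0.
have -> : u a k.+1 * x = S a k.+1%:Z * x + (- k.+1%:R^-1) *:
    \sum_(i < k) i.+1%:R *: (u a i.+1 * (S a (k - i)%N%:Z * x)).
  apply: (scalerI k0); rewrite scalerDr scalerA mulrN divff // scaleN1r.
  have -> : k.+1%:R *: (S a k.+1%:Z * x) = \sum_(i < k) i.+1%:R *: (u a i.+1 *
      (S a (k - i)%N%:Z * x)) + k.+1%:R *: (u a k.+1 * x).
    rewrite [S a k.+1%:Z]/= [LHS]scalerAl schur_flow big_ord_recr /= subnn schur0 mulr1.
    rewrite mulrDl mulr_suml -scalerAl; congr (_ + _).
    by apply: eq_bigr => i _; rewrite -scalerAl mulrA subSS.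
  by rewrite addrAC subrr add0r.
apply: spannedD; first exact: spannedS.
apply: spannedZ; elim/big_ind: _ => [|y z|i _].
- rewrite -(scale0r x); exact: spannedZ.
- exact: spannedD.
- by apply/spannedZ/IHk/spannedS.
Qed.

Lemma spanned_all x : spanned x.
Proof.
elim/genA: x => [c|x y|a k x]; [|exact: spannedD|exact: spanned_u].
(* Shifting by absolute values makes all coordinates non-negative, and 1 placed at such a point is a
   shift of [vac]. *)
apply: spannedZ => v; exists [ffun a => absz (v a)].
pose k : {ffun 'I_s -> nat} := [ffun a => absz (v a + (absz (v a))%:Z)].
have kE : v + nvec [ffun a => absz (v a)] = nvec k.
  by apply/ffunP => a; rewrite !ffunE; move: (v a : int) => z; lia.
exists (\sum_a k a)%N; rewrite kE; split.
  by have := sum_nvec 0 k; rewrite add0r => ->; rewrite [X in _ = X + _]big1 ?add0r // => a _; rewrite ffunE.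
have := fock_shift k (fock_vac cre vac); rewrite add0n.
rewrite (_ : vac = dl 0 1); last by apply: funext.
by rewrite shift_dl add0r.
Qed.

(* Everything is reached after a lattice shift because [S a j * x] placed at [v] is
   obtained by a creation operator, up to a shift, and the [S a j] generate [A]. *)
Lemma fock_surj (a0 : 'I_s) (r : seq (lattice s)) (k : int) f : uniq r ->
    (forall v, v \notin r -> f v = 0) -> (forall v, f v != 0 -> \sum_a v a = k) ->
  exists (e : {ffun 'I_s -> nat}) m,
    m%:Z = k + (\sum_a e a)%N%:Z /\ fockV m (shift (nvec e) f).
Proof.
move=> ur fr fk.
have dl0 v : dl v 0 = 0 by apply: funext => w; rewrite /dl; case: eqP.
have {fr} -> : f = \sum_(v <- r) dl v (f v).
  apply: funext => w; rewrite fct_sumE'; have [wr|wr] := boolP (w \in r).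
    by rewrite (bigD1_seq w) //= /dl eqxx big1 ?addr0 // => v /negPf; rewrite eq_sym => ->.
  rewrite fr // big_seq big1 // => v vr; rewrite /dl; case: eqP => // wv.
  by rewrite wv vr in wr.
have shift0 e : shift e 0 = 0 by [].
have shiftD e g h : shift e (g + h) = shift e g + shift e h by [].
elim: r {ur} => [|v r [e1 [m1 [m1E H1]]]].
  (* The empty sum lies in every degree; the shift serves only to make k plus its size non-negative,
     for which one component is enough. *)
  pose e : {ffun 'I_s -> nat} := [ffun a => if a == a0 then absz k else 0%N].
  exists e, (absz (k + (absz k)%:Z)); split; last by rewrite big_nil; exact: fock0.
  rewrite (bigD1 a0) //= ffunE eqxx big1 ?addn0; first by lia.
  by move=> a /negPf aa0; rewrite ffunE aa0.
rewrite big_cons; have [->|fv] := eqVneq (f v) 0.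
  by exists e1, m1; rewrite dl0 add0r.
have [e2 [m2 [m2E H2]]] := spanned_all (f v) v.
exists [ffun a => (e1 a + e2 a)%N], (m1 + \sum_a e2 a)%N; split.
  rewrite PoszD m1E -addrA -PoszD; congr (_ + Posz _).
  by rewrite -big_split; apply: eq_bigr => a _; rewrite ffunE.
rewrite nvecD shiftD addrC; apply: fockD; first exact: fock_enlarge.
rewrite addrC (_ : m1 + _ = m2 + \sum_a e1 a)%N; last first.
  apply/eqP; rewrite -eqz_nat !PoszD m1E m2E sum_nvec (fk _ fv).
  by rewrite -!addrA [_%:Z + _%:Z]addrC.
by apply: fock_enlarge; rewrite shift_dl.
Qed.

End FockSpace.

(** * Determinants *)

Section RowDet.
Context {B : comNzRingType} {m : nat}.
Implicit Types (L : seq ('I_m -> B)) (x y : 'I_m -> B).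

(** Rows are kept in a list so that blocks can be concatenated; a missing row counts as zero. *)
Definition rdet L : B := \det (\matrix_(r < m, j < m) nth (fun=> 0) L r j).

Lemma rdetB L1 L2 x y (c : B) : (size L1 + (size L2).+1)%N = m ->
  rdet (L1 ++ (fun j => x j - c * y j) :: L2) =
  rdet (L1 ++ x :: L2) - c * rdet (L1 ++ y :: L2).
Proof.
move=> sm; have i0P : (size L1 < m)%N by lia.
pose i0 := Ordinal i0P.
have := @determinant_multilinear B m
  (\matrix_(r < m, j < m) nth (fun=> 0) (L1 ++ (fun j => x j - c * y j) :: L2) r j)
  (\matrix_(r < m, j < m) nth (fun=> 0) (L1 ++ x :: L2) r j)
  (\matrix_(r < m, j < m) nth (fun=> 0) (L1 ++ y :: L2) r j) i0 1 (- c).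
rewrite mul1r mulNr; apply.
- by apply/rowP => j; rewrite !mxE !nth_cat ltnn subnn /= mul1r mulNr.
- apply/matrixP => i j; rewrite !mxE !nth_cat; case: ltnP => // le.
  move: (neq_lift i0 i); rewrite -val_eqE /= => ne.
  have -> // : (bump (size L1) i - size L1 = (bump (size L1) i - size L1).-1.+1)%N.
  by move: le ne => /=; move: (bump _ _) => t; lia.
apply/matrixP => i j; rewrite !mxE !nth_cat; case: ltnP => // le.
move: (neq_lift i0 i); rewrite -val_eqE /= => ne.
have -> // : (bump (size L1) i - size L1 = (bump (size L1) i - size L1).-1.+1)%N.
  by move: le ne => /=; move: (bump _ _) => t; lia.
Qed.

Lemma rdet_alt L1 L2 x : (size L1 + (size L2).+2)%N = m ->
  rdet (L1 ++ x :: x :: L2) = 0.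
Proof.
move=> sm; have i1P : (size L1 < m)%N by lia.
have i2P : ((size L1).+1 < m)%N by lia.
apply: (@determinant_alternate _ _ _ (Ordinal i1P) (Ordinal i2P)).
  by rewrite -val_eqE /= ltn_eqF.
by move=> j; rewrite !mxE !nth_cat /= ltnn subnn ltnNge leqnSn /= subSnn.
Qed.

Definition rdiff (c : B) x y : 'I_m -> B := fun j => y j - c * x j.

(** As [x] itself is a row, row operations from the top down replace each difference by its leading
    row. *)
Lemma rdet_diff_head (c : B) L1 x L L2 : (size L1 + (size L + size L2).+1)%N = m ->
  rdet (L1 ++ x :: pairmap (rdiff c) x L ++ L2) = rdet (L1 ++ x :: L ++ L2).
Proof.
elim: L L1 x => [//|y L IHL] L1 x sm /=.
rewrite -[LHS]/(rdet (L1 ++ [:: x] ++ rdiff c x y :: pairmap (rdiff c) y L ++ L2)).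
rewrite catA rdetB; last by rewrite size_cat /= size_cat size_pairmap; move: sm => /=; lia.
rewrite -!catA [X in _ - c * X]rdet_alt ?mulr0 ?subr0; last first.
  by rewrite size_cat size_pairmap; move: sm => /=; lia.
by rewrite catA IHL -?catA // size_cat /=; move: sm => /=; lia.
Qed.

Definition omit {T : Type} i (L : seq T) := take i L ++ drop i.+1 L.

(** Expand the top difference y - c x. Choosing y undoes all later differences by [rdet_diff_head];
    choosing - c x passes to the next difference. Each outcome leaves out exactly one row of
    [x :: L]. *)
Lemma rdet_diff (c : B) L1 x L L2 : (size L1 + (size L + size L2))%N = m ->
  rdet (L1 ++ pairmap (rdiff c) x L ++ L2) =
  \sum_(i < (size L).+1) (- c) ^+ i * rdet (L1 ++ omit i (x :: L) ++ L2).
Proof.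
elim: L L1 x => [|y L IHL] L1 x sm /=.
  by rewrite big_ord1 expr0 mul1r.
rewrite rdetB; last by rewrite size_cat size_pairmap; move: sm => /=; lia.
rewrite rdet_diff_head; last by move: sm => /=; lia.
rewrite big_ord_recl expr0 mul1r /= /omit /= ?drop0; congr (_ + _).
rewrite -cat1s catA IHL; last by rewrite size_cat /=; move: sm => /=; lia.
rewrite -mulNr mulr_sumr; apply: eq_bigr => i _.
by rewrite bump0 exprS mulrA -!catA.
Qed.

End RowDet.

Section OpDet.
Context {B : comNzRingType}.

Definition opdet m (rs : seq (B -> B)) (h : 'I_m -> B) : B :=
  \det (\matrix_(r < m, j < m) nth (fun=> 0) rs r (h j)).

Definition fcons {T : Type} m (x : T) (h : 'I_m -> T) (j : 'I_m.+1) : T :=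
  if unlift ord0 j is Some i then h i else x.

Lemma fcons0 T m (x : T) (h : 'I_m -> T) : fcons x h ord0 = x.
Proof. by rewrite /fcons unlift_none. Qed.
Lemma fconsS T m (x : T) (h : 'I_m -> T) j : fcons x h (lift ord0 j) = h j.
Proof. by rewrite /fcons liftK. Qed.

Lemma nth_omit (T : Type) (x0 : T) i (L : seq T) j : (i <= size L)%N ->
  nth x0 (omit i L) j = nth x0 L (bump i j).
Proof.
move=> iL; rewrite /omit nth_cat size_takel // /bump; case: ltnP => ji.
  by rewrite nth_take // leqNgt ji.
by rewrite nth_drop; congr (nth _ _ _); lia.
Qed.

Lemma opdet_fcons m rs (x : B) (h : 'I_m -> B) : size rs = m.+1 ->
  opdet rs (fcons x h) =
  \sum_(r < m.+1) nth (fun=> 0) rs r x * ((-1) ^+ r * opdet (omit r rs) h).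
Proof.
move=> srs; rewrite /opdet (expand_det_col _ ord0); apply: eq_bigr => r _.
rewrite mxE fcons0 /cofactor addn0; congr (_ * (_ * \det _)).
apply/matrixP => i j; rewrite !mxE fconsS nth_omit // srs; exact/ltnW.
Qed.

Lemma opdet_rdet m rs (h : 'I_m -> B) :
  opdet rs h = rdet [seq (fun j => f (h j)) | f <- rs].
Proof.
congr (\det _); apply/matrixP => i j; rewrite !mxE.
have [lt|le] := ltnP i (size rs); first by rewrite (nth_map (fun=> 0)).
by rewrite !nth_default ?size_map.
Qed.

End OpDet.

Lemma rdet_map (B C : comNzRingType) (phi : {rmorphism B -> C}) m (L : seq ('I_m -> B)) :
  phi (rdet L) = rdet [seq (fun j => phi (x j)) | x <- L].
Proof.
rewrite /rdet -det_map_mx; congr (\det _); apply/matrixP => i j; rewrite !mxE.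
have [lt|le] := ltnP i (size L); first by rewrite (nth_map (fun=> 0)).
by rewrite !nth_default ?size_map // rmorph0.
Qed.

Lemma sum_ord_mid (V : nmodType) (F : nat -> V) (a b N : nat) : (a + b <= N)%N ->
    (forall r, (r < a)%N -> F r = 0) -> (forall r, (a + b <= r < N)%N -> F r = 0) ->
  \sum_(r < N) F r = \sum_(l < b) F (a + l)%N.
Proof.
move=> abN F1 F2; rewrite -(subnKC abN) !big_split_ord /= [X in X + _ + _]big1 => [|i _].
  rewrite add0r [X in _ + X]big1 ?addr0 // => i _.
  by apply: F2; have := ltn_ord i; lia.
exact: F1.
Qed.

Section BlockRows.
Context {s : nat}.
Implicit Types (mu : 'I_s -> nat) (E : seq 'I_s).

Definition blocks mu E : seq ('I_s * nat) :=
  [seq (a, k) | a <- E, k <- rev (iota 1 (mu a))].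

Lemma blocks_cat mu E1 E2 : blocks mu (E1 ++ E2) = blocks mu E1 ++ blocks mu E2.
Proof. by rewrite /blocks map_cat flatten_cat. Qed.

Lemma mem_blocks mu E x : x \in blocks mu E -> x.1 \in E /\ (0 < x.2)%N.
Proof.
by case/allpairsPdep => a [k [aE]]; rewrite mem_rev mem_iota => /andP[k0 _] ->.
Qed.

Lemma size_blocks mu E : size (blocks mu E) = (\sum_(a <- E) mu a)%N.
Proof.
elim: E => [|a E IHE]; first by rewrite big_nil.
by rewrite -cat1s blocks_cat size_cat IHE big_cons /blocks /= cats0 size_map size_rev size_iota.
Qed.

Lemma eq_blocks mu mu' E : {in E, mu =1 mu'} -> blocks mu E = blocks mu' E.
Proof.
elim: E => // a E IHE H; rewrite -cat1s !blocks_cat IHE => [|b bE]; last first.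
  by apply: H; rewrite inE bE orbT.
by rewrite /blocks /= H ?mem_head.
Qed.

(** The last clause will match the number of rows above the block of a with the exponent in [sg]. *)
Lemma enum_split (a : 'I_s) : exists E1 E2, [/\ enum 'I_s = E1 ++ a :: E2, a \notin E1,
  a \notin E2 & forall F : 'I_s -> nat,
    (\sum_(b <- E1) F b = \sum_(b < s | (b < a)%N) F b)%N].
Proof.
have aE : a \in enum 'I_s by rewrite mem_enum.
have E0 : enum 'I_s = take a (enum 'I_s) ++ a :: drop a.+1 (enum 'I_s).
  have sa : (a < size (enum 'I_s))%N by rewrite size_enum_ord.
  by rewrite -{1}(cat_take_drop a (enum 'I_s)) (drop_nth a) // nth_ord_enum.
have t1 b : b \in take a (enum 'I_s) -> (b < a)%N.
  move/(nthP a) => [j]; rewrite size_takel; last by rewrite size_enum_ord ltnW.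
  by move=> ia <-; rewrite nth_take // nth_enum_ord // (ltn_trans ia).
have t2 b : b \in drop a.+1 (enum 'I_s) -> (a < b)%N.
  move/(nthP a) => [j]; rewrite size_drop size_enum_ord => ia <-.
  by rewrite nth_drop nth_enum_ord; lia.
exists (take a (enum 'I_s)), (drop a.+1 (enum 'I_s)); split=> //.
- by apply/negP => /t1; rewrite ltnn.
- by apply/negP => /t2; rewrite ltnn.
move=> F; transitivity (\sum_(b <- enum 'I_s | (b < a)%N) F b)%N; last by rewrite big_enum_cond.
rewrite [in RHS]E0 big_cat big_cons /= ltnn.
have -> : (\sum_(b <- drop a.+1 (enum 'I_s) | (b < a)%N) F b = 0)%N.
  by rewrite big_seq_cond big1 // => b /andP[b2 ba]; have := t2 b b2; lia.
rewrite addn0 big_seq [RHS]big_seq_cond; apply: eq_bigl => b.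
by have [/t1->|//] := boolP (b \in take _ _).
Qed.

End BlockRows.

(** * Determinants as vectors of the Fock space *)

Section DetFock.
Context {K : numFieldType} {A : comAlgType K} {s : nat}.
Context {u : 'I_s -> nat -> A} {d : 'I_s -> nat -> {linear A -> A}}.
Hypothesis dcomm : forall a b i j x, d a i (d b j x) = d b j (d a i x).
Hypothesis dder : forall a i f g, leibniz (d a i) f g.
Hypothesis du : forall a b i k, d a i.+1 (u b k.+1) = ((a == b) && (i == k))%:R.
Hypothesis genA : forall T : A -> Prop, (forall c : K, T c%:A) ->
  (forall f g, T f -> T g -> T (f + g)) -> (forall a k f, T f -> T (u a k.+1 * f)) ->
  forall f, T f.

Notation S a := (schurz (u a)).
Notation vop := (vop dcomm dder du genA).
Notation psi := (psi dcomm dder du genA).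
Notation cre := (cre dcomm dder du genA).
Notation P := (P d).
Notation V := (lattice s -> A).
Implicit Types (a b : 'I_s) (v w : lattice s) (x y : A).

Definition rowop (i : 'I_s * nat) : A -> A := iter i.2 (d i.1 1).
Arguments rowop : simpl never.
Definition orows (mu : 'I_s -> nat) : seq (A -> A) := map rowop (blocks mu (enum 'I_s)).

Lemma rowop_is_linear i : linear (rowop i).
Proof.
case: i => a k c x y; rewrite /rowop /=; elim: k => //= k ->.
by rewrite linearD linearZZ.
Qed.
HB.instance Definition _ i := GRing.isLinear.Build K A A *:%R (rowop i) (rowop_is_linear i).

Lemma rowopN i x : rowop i (- x) = - rowop i x. Proof. exact: linearN. Qed.
Lemma rowopZ i c x : rowop i (c *: x) = c *: rowop i x. Proof. exact: linearZZ. Qed.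
Lemma rowopD i x y : rowop i (x + y) = rowop i x + rowop i y. Proof. exact: linearD. Qed.
Lemma rowop0 i : rowop i 0 = 0. Proof. exact: linear0. Qed.
Lemma rowopS a k x : rowop (a, k) (d a 1 x) = rowop (a, k.+1) x.
Proof. by rewrite /rowop /= -iterS iterSr. Qed.

Lemma rowop_const i (c : K) : (0 < i.2)%N -> rowop i c%:A = 0.
Proof.
case: i => a [//|k] _; rewrite /rowop iterSr (d_const dder).
exact: (rowop0 (a, k)).
Qed.

Lemma rowop_S a k n : rowop (a, k) (S a n) = S a (n - k%:Z).
Proof.
rewrite /rowop /=; elim: k => [|k IHk] /=; first by rewrite subr0.
by rewrite IHk (d_S dder du); congr (S a _); lia.
Qed.

Lemma rowop_S_other i a n : i.1 != a -> (0 < i.2)%N -> rowop i (S a n) = 0.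
Proof.
case: i => b [//|k] /= ba _; rewrite /rowop iterSr (d_S_other dder du) //.
exact: (rowop0 (b, k)).
Qed.

(* The functions on which [exp (- \sum d_i z^-i / i)] acts as [1 - d_1 z^-1], and
   whose mixed [d_1]-derivatives vanish. *)
Definition lin x := (forall a l, P a l.+2 x = 0) /\
  (forall a b, a != b -> d a 1 (d b 1 x) = 0).

(** The factor 1 - z w gives the first condition. A Schur polynomial involves the variables of one
    component only, which gives the second. *)
Lemma lin_S a n : lin (S a n).
Proof.
have P1E b l : P b l (S a n) = P b l (S a n * 1) by rewrite mulr1.
split=> [b l|b c bc].
  rewrite P1E; have [->|ba] := eqVneq b a; last first.
    by rewrite (P_S_other dcomm dder du) // P1 // mulr0.
  by rewrite (P_S dcomm dder du) !P1 // !mulr0 subrr.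
have [ca|ca] := eqVneq c a; last by rewrite (d_S_other dder du) // linear0.
by rewrite ca (d_S dder du) (d_S_other dder du) // -ca.
Qed.

Lemma lin_const (c : K) : lin c%:A.
Proof.
split=> [a l|a b ab]; last by rewrite (d_const dder) linear0.
by rewrite PZ // P1 // scaler0.
Qed.

Lemma linD x y : lin x -> lin y -> lin (x + y).
Proof.
move=> [x1 x2] [y1 y2]; split=> [a l|a b ab]; first by rewrite PD // x1 y1 addr0.
by rewrite !linearD x2 // y2 // addr0.
Qed.

Lemma linZ (c : K) x : lin x -> lin (c *: x).
Proof.
move=> [x1 x2]; split=> [a l|a b ab]; first by rewrite PZ // x1 scaler0.
by rewrite !linearZZ x2 // scaler0.
Qed.

Lemma P_one a x : P a 1 x = - d a 1 x.
Proof.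
have := taylor_flow (fun i j => dPcomm dcomm a i a j) x 1.
by rewrite big_ord1 !scale1r taylor0 dPE invr1 scale1r.
Qed.

Lemma P_rowop a l i x : P a l (rowop i x) = rowop i (P a l x).
Proof.
symmetry; apply: (taylor_comm (D := dP d a)) => [j k y|j y]; first exact: dPcomm.
have E z : rowop i (d a j.+1 z) = d a j.+1 (rowop i z).
  by case: i => b k; rewrite /rowop /=; elim: k => //= k ->; rewrite dcomm.
rewrite -[LHS]/(rowop i (dP d a j.+1 y)) -[RHS]/(dP d a j.+1 (rowop i y)).
by rewrite !dPE rowopN rowopZ E.
Qed.

(* The ring morphism [exp (- \sum d_i w^i / i)], [w] being the indeterminate. *)
Definition Tpoly a x : {poly A} := \poly_(l < bound dcomm dder du genA x) P a l x.

Lemma coef_Tpoly a x l : (Tpoly a x)`_l = P a l x.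
Proof. by rewrite coef_poly; case: ltnP => // /(P_bound (dcomm := dcomm)) ->. Qed.

Lemma Tpoly_is_additive a x y : Tpoly a (x - y) = Tpoly a x - Tpoly a y.
Proof.
by apply/polyP => l; rewrite coefB !coef_Tpoly -scaleN1r PD // PZ // scaleN1r.
Qed.
HB.instance Definition _ a := GRing.isZmodMorphism.Build A {poly A} (Tpoly a) (Tpoly_is_additive a).
Lemma Tpoly_is_monoid_morphism a : monoid_morphism (Tpoly a).
Proof.
split=> [|x y]; apply/polyP => l.
  by rewrite coef_Tpoly P1 // coef1; case: eqP.
rewrite coefM coef_Tpoly /P taylorM => [|i j z|i f g]; [|exact: dPcomm|exact: dPder].
by apply: eq_bigr => i _; rewrite !coef_Tpoly.
Qed.
HB.instance Definition _ a := GRing.isMonoidMorphism.Build A {poly A} (Tpoly a)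
  (Tpoly_is_monoid_morphism a).

Lemma Tpoly_diag a k x : lin x -> Tpoly a (rowop (a, k) x) =
  (rowop (a, k) x)%:P - 'X * (rowop (a, k.+1) x)%:P.
Proof.
move=> [x1 _]; apply/polyP => l; rewrite coef_Tpoly coefB coefC coefXM coefC P_rowop.
case: l => [|[|l]] /=; first by rewrite P0 subr0.
  by rewrite P_one sub0r rowopN rowopS.
by rewrite x1 rowop0 subr0.
Qed.

Lemma Tpoly_off a i x : lin x -> a != i.1 -> (0 < i.2)%N -> Tpoly a (rowop i x) = (rowop i x)%:P.
Proof.
move=> [x1 x2] ai i0; apply/polyP => l; rewrite coef_Tpoly coefC P_rowop.
case: l => [|[|l]] /=; first by rewrite P0.
  rewrite P_one; case: i ai i0 => b [//|k] /= ab _.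
  by rewrite rowopN -rowopS dcomm x2 // rowop0 oppr0.
by rewrite x1 rowop0.
Qed.

(** The block of a is split off for all [mu'] at once, so that the row lists with and without its
    additional row share [L1] and [L2]. *)
Lemma blocks_split (mu : 'I_s -> nat) a : exists L1 L2,
  [/\ forall mu' : 'I_s -> nat, (forall b, b != a -> mu' b = mu b) -> blocks mu' (enum 'I_s) =
        L1 ++ [seq (a, k) | k <- rev (iota 1 (mu' a))] ++ L2,
      forall i, i \in L1 ++ L2 -> i.1 != a /\ (0 < i.2)%N
    & size L1 = (\sum_(b < s | (b < a)%N) mu b)%N].
Proof.
have [E1 [E2 [E0 aE1 aE2 E1E]]] := enum_split a.
exists (blocks mu E1), (blocks mu E2); split; last by rewrite size_blocks.
  move=> mu' mu'E; rewrite E0 -cat1s !blocks_cat.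
  rewrite (@eq_blocks _ mu' mu E1) => [|b bE]; last first.
    by apply: mu'E; apply: contraNneq aE1 => <-.
  rewrite (@eq_blocks _ mu' mu E2) => [|b bE]; last first.
    by apply: mu'E; apply: contraNneq aE2 => <-.
  by rewrite {2}/blocks /= cats0.
move=> i; rewrite mem_cat => /orP[] /mem_blocks[iE ?]; split=> //.
  by apply: contraNneq aE1 => <-.
by apply: contraNneq aE2 => <-.
Qed.

Lemma rev_iotaS p : rev (iota 1 p.+1) = p.+1 :: rev (iota 1 p).
Proof. by rewrite -[in LHS](addn1 p) iotaD rev_cat /= add1n. Qed.

Lemma map_omit (T T' : Type) (f : T -> T') i L : map f (omit i L) = omit i (map f L).
Proof. by rewrite /omit map_cat map_take map_drop. Qed.

Lemma omit_cat (T : Type) (L1 M L2 : seq T) l : (l < size M)%N ->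
  omit (size L1 + l) (L1 ++ M ++ L2) = L1 ++ omit l M ++ L2.
Proof.
move=> lM; rewrite /omit takeD take_size_cat // drop_size_cat // -addnS addnC -drop_drop.
rewrite drop_size_cat // take_cat lM drop_cat -!catA; congr (_ ++ (_ ++ _)).
case: ltnP => // le; have -> : l.+1 = size M by apply/eqP; rewrite eqn_leq le lM.
by rewrite subnn drop0 drop_size.
Qed.

Lemma nth_col a q l : (l < q)%N ->
  nth (a, 0%N) [seq (a, k) | k <- rev (iota 1 q)] l = (a, (q - l)%N).
Proof.
move=> lq; rewrite (nth_map 0%N) ?size_rev ?size_iota // nth_rev ?size_iota // nth_iota.
  by congr (_, _); lia.
by lia.
Qed.

(* Applying [1 - w d_1] to the rows of orders p, ..., 1 gives differences of
   consecutive rows of orders p + 1, ..., 1, so the coefficient of [w^l] omits one of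
   the latter: these are the minors in the expansion along the new column. *)
Lemma opdet_vop (mu mu' : 'I_s -> nat) m (h : 'I_m -> A) a p n :
    (forall j, lin (h j)) -> (\sum_b mu b = m.+1)%N -> mu a = p.+1 -> mu' a = p ->
    (forall b, b != a -> mu' b = mu b) ->
  (-1) ^+ (\sum_(b < s | (b < a)%N) mu b) * vop a (n - (mu a)%:Z) (opdet (orows mu') h) =
  opdet (orows mu) (fcons (S a n) h).
Proof.
move=> hlin summ mua mu'a mu'E.
have [L1 [L2 [LE L12 sL1]]] := blocks_split mu a.
have rE : blocks mu (enum 'I_s) = L1 ++ [seq (a, k) | k <- rev (iota 1 p.+1)] ++ L2.
  by rewrite LE // mua.
have r'E : blocks mu' (enum 'I_s) = L1 ++ [seq (a, k) | k <- rev (iota 1 p)] ++ L2.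
  by rewrite LE // mu'a.
have sm : (size L1 + (p + size L2))%N = m.
  have := congr1 size rE; rewrite size_blocks big_enum /= summ !size_cat size_map size_rev.
  by rewrite /= size_iota; lia.
pose om l := L1 ++ omit l [seq (a, k) | k <- rev (iota 1 p.+1)] ++ L2.
pose W l := opdet (map rowop (om l)) h.
have PD l : P a l (opdet (orows mu') h) = if (l < p.+1)%N then (-1) ^+ l * W l else 0.
  pose G k : 'I_m -> {poly A} := fun j => (rowop (a, k) (h j))%:P.
  pose N i : 'I_m -> {poly A} := fun j => (rowop i (h j))%:P.
  (* On the block of a the rows become differences of consecutive orders, the topmost one
     subtracting the row of order q + 1. *)
  have chain q : [seq (fun j => Tpoly a (rowop (a, k) (h j))) | k <- rev (iota 1 q)] =
      pairmap (rdiff 'X) (G q.+1) [seq G k | k <- rev (iota 1 q)].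
    elim: q => [//|q IHq]; rewrite rev_iotaS /= IHq; congr (_ :: _).
    by apply: funext => j; rewrite Tpoly_diag.
  have off L : {subset L <= L1 ++ L2} ->
      [seq (fun j => Tpoly a (rowop i (h j))) | i <- L] = map N L.
    move=> sL; apply/eq_in_map => i /sL/L12[ia i0]; apply: funext => j.
    by rewrite Tpoly_off // eq_sym.
  rewrite -coef_Tpoly opdet_rdet rdet_map /orows r'E -!map_comp !map_cat -!map_comp.
  rewrite (_ : [seq _ | i <- L1] = map N L1); last first.
    by apply: off => i; rewrite mem_cat => ->.
  rewrite (_ : [seq _ | i <- L2] = map N L2); last first.
    by apply: off => i; rewrite mem_cat orbC => ->.
  rewrite (_ : map _ (rev _) = pairmap (rdiff 'X) (G p.+1) [seq G k | k <- rev (iota 1 p)]);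
    last exact: chain.
  rewrite rdet_diff ?size_map ?size_rev ?size_iota //.
  have omE i : map N L1 ++ omit i (G p.+1 :: [seq G k | k <- rev (iota 1 p)]) ++ map N L2 =
      map N (om i).
    by rewrite /om /omit rev_iotaS !map_cat !map_take !map_drop /= -!map_comp.
  have detN L : rdet (map N L) = (opdet (map rowop L) h)%:P.
    by rewrite opdet_rdet (rdet_map (@polyC A)) -!map_comp.
  have cf i (c : A) : ((- 'X) ^+ i * c%:P)`_l = (l == i)%:R * ((-1) ^+ i * c).
    have sgnP : (-1) ^+ i = ((-1) ^+ i)%:P :> {poly A} by rewrite rmorph_sign.
    by rewrite [(- 'X) ^+ i]exprNn sgnP -mulrA coefCM coefMC coefXn mulrCA.
  rewrite coef_sum; transitivity (\sum_(i < p.+1) (l == i)%:R *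
      ((-1) ^+ i * W i)).
    by apply: eq_bigr => i _; rewrite omE detN cf.
  case: ltnP => [lp|pl].
    rewrite (bigD1 (Ordinal lp)) //= eqxx mul1r big1 ?addr0 // => i il.
    have -> : (l == i) = false by apply: contraNF il => /eqP li; apply/eqP/val_inj.
    by rewrite mul0r.
  rewrite big1 // => i _; have -> : (l == i) = false by have := ltn_ord i; lia.
  by rewrite mul0r.
rewrite mua (@vopE _ _ _ _ _ dcomm dder du genA _ _ _ p.+1) => [|l pl]; last first.
  by rewrite PD ltnNge pl.
rewrite opdet_fcons; last by rewrite /orows size_map size_blocks big_enum /= summ.
have szB : size (blocks mu (enum 'I_s)) = m.+1 by rewrite size_blocks big_enum /= summ.
have nthE r : (r < m.+1)%N -> nth (fun=> 0) (orows mu) r =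
    rowop (nth (a, 0%N) (blocks mu (enum 'I_s)) r).
  by move=> rm; rewrite (nth_map (a, 0%N)) // szB.
have szM : size [seq (a, k) | k <- rev (iota 1 p.+1)] = p.+1.
  by rewrite size_map size_rev size_iota.
(* Only the rows of the block of a see the new column; all others differentiate in another
   component. The [size L1] rows above the block account for the sign. *)
rewrite (@sum_ord_mid _ (fun r => nth (fun=> 0) (orows mu) r (S a n) *
  ((-1) ^+ r * opdet (omit r (orows mu)) h)) (size L1) p.+1).
- rewrite mulr_sumr; apply: eq_bigr => l _; have lp := ltn_ord l.
  have omE : omit (size L1 + l) (orows mu) = map rowop (om l).
    rewrite /orows rE -map_omit omit_cat ?szM //.
  rewrite omE PD lp nthE; last by lia.
  rewrite rE nth_cat [(size L1 + l < size L1)%N]ltnNge leq_addr addKn nth_cat szM lp nth_col //.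
  rewrite rowop_S -/(W l) -sL1 exprD mulrCA; congr (S a _ * _); first lia.
  by rewrite mulrA.
- by lia.
- move=> r rL; rewrite nthE; last lia.
  have /L12[i1 i2] : nth (a, 0%N) (blocks mu (enum 'I_s)) r \in L1 ++ L2.
    by rewrite rE nth_cat rL mem_cat mem_nth.
  by rewrite rowop_S_other // mul0r.
- move=> r /andP[rL rm]; rewrite nthE //.
  have /L12[i1 i2] : nth (a, 0%N) (blocks mu (enum 'I_s)) r \in L1 ++ L2.
    have e0 : (r < size L1)%N = false by lia.
    have e1 : (r - size L1 < p.+1)%N = false by lia.
    have e2 : (r - size L1 - p.+1 < size L2)%N by lia.
    by rewrite rE nth_cat e0 nth_cat szM e1 mem_cat mem_nth ?orbT.
  by rewrite rowop_S_other // mul0r.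
Qed.

Lemma sign_scale k x : (-1 : K) ^+ k *: x = (-1) ^+ k * x.
Proof.
elim: k => [|k IHk]; first by rewrite !expr0 scale1r mul1r.
by rewrite !exprS -scalerA IHk scaleN1r mulN1r mulNr.
Qed.

Lemma nth_orowsP (mu : 'I_s -> nat) r :
  (exists2 i, i \in blocks mu (enum 'I_s) & nth (fun=> 0) (orows mu) r = rowop i) \/
  nth (fun=> 0) (orows mu) r = fun=> 0.
Proof.
rewrite /orows; have [lt|le] := ltnP r (size (blocks mu (enum 'I_s))); last first.
  by right; rewrite nth_default ?size_map.
case E: (blocks mu (enum 'I_s)) lt => [//|i0 l] lt; left.
by exists (nth i0 (i0 :: l) r); rewrite ?mem_nth // (nth_map i0).
Qed.

Definition detV m (h : 'I_m -> A) : V := fun v =>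
  if [forall a, 0 <= v a] && (\sum_a v a == m%:Z)
  then opdet (orows (fun a => absz (v a))) h else 0.

Lemma sum_absz m v : [forall a, 0 <= v a] -> \sum_a v a = m%:Z ->
  (\sum_a absz (v a) = m)%N.
Proof.
move=> /forallP v0 vm; apply/eqP; rewrite -eqz_nat -vm -[(\sum_a _)%N%:Z]natz natr_sum.
by apply/eqP/eq_bigr => a _; rewrite natz gez0_abs.
Qed.

Lemma size_orows mu : size (orows mu) = (\sum_a mu a)%N.
Proof. by rewrite /orows size_map size_blocks big_enum. Qed.

Lemma detV_fcons_is_linear m (h : 'I_m -> A) (c : K) x y :
  detV (fcons (c *: x + y) h) = c *: detV (fcons x h) + detV (fcons y h).
Proof.
apply: funext => v; rewrite fctDE fctZE /detV.
case: ifP => [/andP[v0 /eqP vm]|_]; last by rewrite scaler0 addr0.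
rewrite !opdet_fcons ?size_orows ?(sum_absz v0 vm) // scaler_sumr -big_split.
apply: eq_bigr => r _ /=.
case: (nth_orowsP (fun a => absz (v a)) r) => [[i _ ->]|->]; last first.
  by rewrite mul0r scaler0 addr0.
by rewrite rowopD rowopZ mulrDl scalerAl.
Qed.

(** Creation operators act on determinants through this linear dependence on the first column. *)
Definition detl m (h : 'I_m -> A) x : V := detV (fcons x h).
HB.instance Definition _ m (h : 'I_m -> A) := GRing.isLinear.Build K A V *:%R (detl h)
  (detV_fcons_is_linear h).

Lemma detlD m (h : 'I_m -> A) x y : detl h (x + y) = detl h x + detl h y.
Proof. exact: linearD. Qed.

Lemma eq_detV_const m (h h' : 'I_m -> A) :
  (forall j, exists c : K, h j = h' j + c%:A) -> detV h = detV h'.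
Proof.
move=> hh'; apply: funext => v; rewrite /detV; case: ifP => // _.
congr (\det _); apply/matrixP => r j; rewrite !mxE.
case: (nth_orowsP (fun a => absz (v a)) r) => [[i ib ->]|->] //.
have [c ->] := hh' j; rewrite rowopD rowop_const ?addr0 //.
by case: (mem_blocks ib).
Qed.

Lemma detl_const m (h : 'I_m -> A) (c : K) : detl h c%:A = 0.
Proof.
rewrite -(linear0 (detl h)); apply: eq_detV_const => j.
rewrite /fcons; case: unliftP => [i|] _; last by exists c; rewrite add0r.
by exists 0; rewrite scale0r addr0.
Qed.

Lemma detV0 (h : 'I_0 -> A) : detV h = vac.
Proof.
apply: funext => v; rewrite /detV /vac; have [->|v0] := eqVneq v 0.
  rewrite ifT ?/opdet ?det_mx00 //; apply/andP; split.
    by apply/forallP => a; rewrite ffunE.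
  by rewrite big1 // => a _; rewrite ffunE.
case: ifP => // /andP[vp /eqP vm]; case/eqP: v0; apply/ffunP => a; rewrite ffunE.
have /eqP := sum_absz vp vm; rewrite sum_nat_eq0 => /forallP/(_ a)/= /eqP.
by case: (v a) => // -[].
Qed.

(** The substance is [opdet_vop]; the rest concerns points where both sides vanish. If [v a] = 0 the
    block of a is empty and all rows kill the new column. *)
Lemma psi_detV m (h : 'I_m -> A) a n : (forall j, lin (h j)) ->
  psi a n (detV h) = detl h (S a n).
Proof.
move=> hlin; apply: funext => v; rewrite psiE /detl /detV.
have [vp|vn] /= := boolP [forall b, 0 <= v b]; last first.
  rewrite ifF ?linear0 ?scaler0 //; apply: contraNF vn => /andP[/forallP vp _].
  by apply/forallP => b; have := vp b; rewrite !ffunE; case: eqP => _ /=; lia.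
have sE : \sum_b (v - unitv a) b = \sum_b v b - 1.
  under eq_bigr do rewrite !ffunE; rewrite sumrB; congr (_ - _).
  by rewrite (bigD1 a) //= eqxx big1 ?addr0 // => b /negPf->.
have [vm|vm] := eqVneq (\sum_b v b) m.+1%:Z; last first.
  by rewrite sE ifF ?linear0 ?scaler0 //; apply: contraNF vm => /andP[_]; lia.
have summ := sum_absz vp vm.
have v0 b : 0 <= v b by move/forallP: vp.
have mE b : b != a -> absz ((v - unitv a)%R b) = absz (v b).
  by move=> ba; rewrite !ffunE (negPf ba) subr0.
case va: (absz (v a)) => [|p].
  rewrite ifF ?linear0 ?scaler0; last first.
    by apply/negP => /andP[/forallP/(_ a)]; rewrite !ffunE eqxx mulr1n; move: va; move: (v a : int) => z; lia.
  rewrite opdet_fcons ?size_orows // big1 // => r _.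
  have [L1 [L2 [LE L12 _]]] := blocks_split (fun b => absz (v b)) a.
  case: (nth_orowsP (fun b => absz (v b)) r) => [[i ib ->]|->]; last by rewrite mul0r.
  rewrite LE // va /= in ib; have [i1 i2] := L12 _ ib.
  by rewrite rowop_S_other // mul0r.
rewrite ifT; last first.
  rewrite sE vm; apply/andP; split; last by lia.
  apply/forallP => b; have := v0 b; rewrite !ffunE.
  case: eqP => [->|_]; rewrite ?mulr1n ?mulr0n ?subr0 //.
  by move: va; move: (v a : int) => z; lia.
have vaE : v a = (absz (v a))%:Z by rewrite gez0_abs.
have -> : n - v a = n - (absz (v a))%:Z by rewrite -vaE.
rewrite -(opdet_vop n hlin summ va _ mE); last first.
  by rewrite !ffunE eqxx mulr1n; move: va (v0 a); move: (v a : int) => z; lia.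
have -> : sg a v = (-1) ^+ (\sum_(b < s | (b < a)%N) absz (v b)) :> K.
  rewrite /sg [RHS]exprnP; congr (_ ^ _); rewrite -[RHS]natz natr_sum.
  by apply: eq_bigr => b _; rewrite natz gez0_abs.
exact: sign_scale.
Qed.

(** Positive indices only, as s_0 = 1 is a constant, which the rows do not see. *)
Definition spanS x := exists (r : seq ('I_s * nat)) (c : 'I_s * nat -> K),
  x = \sum_(i <- r) c i *: S i.1 i.2.+1%:Z.

Lemma lin_spanS x : spanS x -> lin x.
Proof.
move=> [r [c ->]]; elim/big_ind: _ => [|y z|i _].
- by rewrite -(scale0r 1); exact: lin_const.
- exact: linD.
- exact/linZ/lin_S.
Qed.

Lemma fcons_eta m (h : 'I_m.+1 -> A) : h = fcons (h ord0) (fun j => h (lift ord0 j)).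
Proof. by apply: funext => j; rewrite /fcons; case: unliftP => [i|] ->. Qed.

Lemma comb_detV m (h : 'I_m -> A) (r : seq ('I_s * nat)) c : (forall j, lin (h j)) ->
  \sum_(i <- r) c i *: cre i (detV h) = detl h (\sum_(i <- r) c i *: S i.1 i.2.+1%:Z).
Proof.
move=> hlin; rewrite [RHS]linear_sum; apply: eq_bigr => i _.
rewrite [RHS]linearZZ; congr (_ *: _); exact: psi_detV.
Qed.

Lemma pure_detV m f : pure cre vac m f ->
  exists (c : K) (h : 'I_m -> A), f = c *: detV h /\ forall j, spanS (h j).
Proof.
elim=> {m f} [c|m r c f _ [e [h [-> hS]]]].
  by exists c, (fun=> 0); split; [rewrite detV0 | case].
exists e, (fcons (\sum_(i <- r) c i *: S i.1 i.2.+1%:Z) h); split; last first.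
  move=> j; rewrite /fcons; case: unliftP => [i|] _ //.
  by exists r, c.
transitivity (e *: detl h (\sum_(i <- r) c i *: S i.1 i.2.+1%:Z)); last by [].
rewrite -comb_detV => [|j]; last exact: lin_spanS.
by rewrite scaler_sumr; apply: eq_bigr => i _; rewrite linearZZ scaleCA.
Qed.

(** Peel off the first column: its constant part contributes nothing, and the rest is a combination
    of creation operators applied to the smaller determinant. *)
Lemma detV_pure m (h : 'I_m -> A) :
  (forall j, exists (c : K) x, h j = x + c%:A /\ spanS x) -> pure cre vac m (detV h).
Proof.
elim: m h => [|m IHm] h hS.
  by have := pure_vac cre vac 1; rewrite scale1r detV0.
have -> : detV h = detl (fun j => h (lift ord0 j)) (h ord0) by rewrite /detl -fcons_eta.
have [c [x [-> [r [e ->]]]]] := hS ord0.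
rewrite detlD detl_const addr0 -comb_detV.
  by apply/pure_psi/IHm => j; exact: hS.
move=> j; have [k [y [-> yS]]] := hS (lift ord0 j).
by apply: linD; [exact: lin_spanS | exact: lin_const].
Qed.
End DetFock.

Lemma taylor_morph (K : numFieldType) (A B : comAlgType K) (phi : {rmorphism A -> B})
    (D : nat -> {linear A -> A}) (D' : nat -> {linear B -> B}) :
    (forall i j x, D i (D j x) = D j (D i x)) ->
    (forall i j x, D' i (D' j x) = D' j (D' i x)) ->
    (forall i x, D' i.+1 (phi x) = phi (D i.+1 x)) ->
  forall l x, taylor D' l (phi x) = phi (taylor D l x).
Proof.
move=> Dcomm D'comm phiD l x; move: l.
apply: (taylorP D'comm (E := fun l => phi (taylor D l x))) => [|l].
  by rewrite taylor0.
rewrite scaler_nat -rmorphMn /= -scaler_nat taylor_flow // rmorph_sum.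
by apply: eq_bigr => i _; rewrite !scaler_nat rmorphMn /= phiD.
Qed.

(** * The bilinear equation as a Pluecker relation *)

(* [B] stands for C[t, y], [inT] and [inY] for the embeddings of C[t]. *)
Section Bridge.
Context {K : numFieldType} {A : comAlgType K} {s : nat}.
Context {u : 'I_s -> nat -> A} {d : 'I_s -> nat -> {linear A -> A}}.
Hypothesis dcomm : forall a b i j x, d a i (d b j x) = d b j (d a i x).
Hypothesis dder : forall a i f g, leibniz (d a i) f g.
Hypothesis du : forall a b i k, d a i.+1 (u b k.+1) = ((a == b) && (i == k))%:R.
Hypothesis genA : forall T : A -> Prop, (forall c : K, T c%:A) ->
  (forall f g, T f -> T g -> T (f + g)) -> (forall a k f, T f -> T (u a k.+1 * f)) ->
  forall f, T f.
Context {Y : Type} {co : Y -> {scalar A}}.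

Context {B : comAlgType K} {inT inY : {rmorphism A -> B}}.
Hypothesis inTZ : forall c x, inT (c *: x) = c *: inT x.
Hypothesis inYZ : forall c x, inY (c *: x) = c *: inY x.
Context {D : 'I_s -> nat -> {linear B -> B}}.
Hypothesis Dcomm : forall a i j x, D a i (D a j x) = D a j (D a i x).
Hypothesis Dder : forall a i f g, leibniz (D a i) f g.
Hypothesis DT : forall a i x, D a i.+1 (inT x) = - (i.+1%:R^-1 *: inT (d a i.+1 x)).
Hypothesis DY : forall a i x, D a i.+1 (inY x) = i.+1%:R^-1 *: inY (d a i.+1 x).
Hypothesis tensP : forall (J : eqType) (r : seq J) (x y : J -> A),
  \sum_(j <- r) inT (x j) * inY (y j) = 0 <->
  forall mu nu, \sum_(j <- r) co mu (x j) * co nu (y j) = 0.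

Notation S a := (schurz (u a)).
Notation Sd a := (schurz (fun i => - u a i)).
Notation psi := (psi dcomm dder du genA).
Notation psis := (psis dcomm dder du genA).
Notation cre := (cre dcomm dder du genA).
Notation ann := (ann dcomm dder du genA).
Notation P := (P d).
Notation Q := (Q d).
Notation V := (lattice s -> A).
Implicit Types (a b : 'I_s) (v w m p : lattice s) (f g : V).

Definition ty a i : B := inT (u a i) - inY (u a i).

(** The abstract form of [res_term], with the sign factored so that one half goes to [psi] and the
    other to [psis]. *)
Definition res (f : V) m p a l : B := (sg a m * sg a p) *:
  (schurz (ty a) (l%:Z + 1 - m a + p a)
   * taylor (D a) l (inT (f (m - unitv a)) * inY (f (p + unitv a)))).

Definition bilinear_eq (f : V) m p := exists L0, forall L, (L0 <= L)%N ->
  \sum_(l < L) \sum_(a < s) res f m p a l = 0.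

(** The exponent of z depends only on the difference of the two points, and the sign of the shift
    enters twice. *)
Lemma res_shift e f m p a l : res (shift e f) (m + e) (p + e) a l = res f m p a l.
Proof.
rewrite /res /shift !sgD !ffunE; congr (_ *: (schurz _ _ * taylor _ _ (inT (f _) * inY (f _)))).
- by rewrite mulrACA sg_sqr mulr1.
- by ring.
- by rewrite addrAC addrK.
- by rewrite addrAC addrK.
Qed.

Lemma bilinear_eq_shift e f m p :
  bilinear_eq (shift e f) (m + e) (p + e) <-> bilinear_eq f m p.
Proof.
have E L : \sum_(l < L) \sum_(a < s) res (shift e f) (m + e) (p + e) a l
    = \sum_(l < L) \sum_(a < s) res f m p a l.
  by apply: eq_bigr => l _; apply: eq_bigr => a _; exact: res_shift.
by split=> -[L0 H]; exists L0 => L LL; [rewrite -E|rewrite E]; exact: H.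
Qed.

Lemma taylor_inTY a l x y : taylor (D a) l (inT x * inY y) =
  \sum_(i < l.+1) inT (P a i x) * inY (Q a (l - i)%N y).
Proof.
rewrite taylorM => [|i j z|i z w]; [|exact: Dcomm|exact: Dder].
apply: eq_bigr => i _; congr (_ * _).
  apply: taylor_morph => [j k z|j k z|j z]; [exact: dPcomm|exact: Dcomm|].
  by rewrite DT dPE rmorphN /= inTZ.
apply: taylor_morph => [j k z|j k z|j z]; [exact: dQcomm|exact: Dcomm|].
by rewrite DY dQE inYZ.
Qed.

(** The residue of a product of two Laurent series pairs their coefficients, which are the modes.
    For fixed orders of [P] and [Q], the sum over modes is a convolution of Schur polynomials at t
    and at -y, hence one at t - y. *)
Lemma sum_res f m p a : exists L0 T0, forall L T, (L0 <= L)%N -> (T0 <= T)%N ->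
  \sum_(l < L) res f m p a l =
  \sum_(k < T + T.+1) inT (psi a (k%:Z - T%:Z) f m) * inY (psis a (k%:Z - T%:Z) f p).
Proof.
pose F := f (m - unitv a); pose G := f (p + unitv a).
pose bF := bound dcomm dder du genA F; pose bG := bound dcomm dder du genA G.
pose b := maxn bF bG.
have PF i : (b <= i)%N -> P a i F = 0 by rewrite geq_max => /andP[/P_bound].
have QG i : (b <= i)%N -> Q a i G = 0 by rewrite geq_max => /andP[_ /Q_bound].
(* The left side ends before order b + b; the window from -T to T must contain all modes for which
   both Schur indices are non-negative. *)
exists (b + b)%N, (b + absz (m a) + absz (p a)).+1 => L T bL bT.
transitivity ((sg a m * sg a p) *: \sum_(i < b) \sum_(j < b)
    schurz (ty a) (i%:Z + j%:Z + 1 - m a + p a) * (inT (P a i F) * inY (Q a j G))).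
  rewrite -scaler_sumr; congr (_ *: _).
  rewrite (@sum_box_antidiag _ (fun i j => schurz (ty a) (i%:Z + j%:Z + 1 - m a + p a) *
    (inT (P a i F) * inY (Q a j G))) b L) //; first last.
  - by move=> i j ji; rewrite QG // rmorph0 !mulr0.
  - by move=> i j ij; rewrite PF // rmorph0 mul0r mulr0.
  apply: eq_bigr => l _; rewrite taylor_inTY mulr_sumr; apply: eq_bigr => i _.
  by congr (schurz _ _ * _); have := ltn_ord i; lia.
transitivity (\sum_(k < T + T.+1) (sg a m * sg a p) *:
   \sum_(i < b) \sum_(j < b) (inT (S a (i%:Z + (k%:Z - T%:Z - m a)) * P a i F) *
      inY (Sd a (j%:Z + (p a + 1 - (k%:Z - T%:Z))) * Q a j G))); last first.
  apply: eq_bigr => k _; rewrite psiE psisE inTZ inYZ -scalerAl -scalerAr scalerA.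
  rewrite (vopE _ _ _ _ _ PF) (vopsE _ _ _ _ _ QG).
  rewrite (rmorph_sum inT) (rmorph_sum inY) mulr_suml; congr (_ *: _).
  by apply: eq_bigr => i _; rewrite [RHS]mulr_sumr.
rewrite -scaler_sumr [in RHS]exchange_big; congr (_ *: _); apply: eq_bigr => i _ /=.
rewrite [RHS]exchange_big; apply: eq_bigr => j _ /=.
have tyE c : ty a c = inT (u a c) + inY (- u a c) by rewrite rmorphN.
transitivity (\sum_(k < T + T.+1) (inT (S a (i%:Z - m a - T%:Z + k%:Z)) *
   inY (Sd a (i%:Z + j%:Z + 1 - m a + p a - (i%:Z - m a - T%:Z + k%:Z)))) *
   (inT (P a i F) * inY (Q a j G))); last first.
  apply: eq_bigr => k _; rewrite (rmorphM inT (S a _)) (rmorphM inY (Sd a _)) [RHS]mulrACA.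
  by congr (inT (schurz _ _) * inY (schurz _ _) * _); ring.
rewrite -mulr_suml; congr (_ * _).
under eq_bigr do rewrite !schurz_morph.
rewrite schurz_sum; last first.
- by have := ltn_ord j; lia.
- by have := ltn_ord i; lia.
case: (_ - _ + _) => // q /=; apply: eq_schur => c; exact: tyE.
Qed.

Definition modes T : seq ('I_s * nat) := [seq (a, k) | a <- enum 'I_s, k <- iota 0 T].

Lemma mem_modes T i : (i \in modes T) = (i.2 < T)%N.
Proof.
case: i => a k; apply/allpairsPdep/idP => [[b [j [_]]]|kT].
  by rewrite mem_iota /= => jT [_ ->].
by exists a, k; rewrite mem_enum mem_iota.
Qed.

Lemma modes_uniq T : uniq (modes T).
Proof.
by apply: allpairs_uniq; rewrite ?enum_uniq ?iota_uniq // => -[a k] [b j] _ _ /= [-> ->].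
Qed.

Lemma big_modes (U : nmodType) T (F : 'I_s * nat -> U) :
  \sum_(i <- modes T) F i = \sum_(a < s) \sum_(k < T) F (a, k : nat).
Proof.
rewrite /modes big_allpairs_dep big_enum; apply: eq_bigr => a _ /=.
by rewrite -[T in iota 0 T]subn0 -/(index_iota 0 T) big_mkord.
Qed.

Lemma sum_res_modes k f m p : fock cre vac k f -> exists L0 T0, forall L T,
    (L0 <= L)%N -> (T0 <= T)%N ->
  \sum_(l < L) \sum_(a < s) res f m p a l =
  \sum_(i <- modes T) inT (cre i f m) * inY (ann i f p).
Proof.
move=> Ff.
have [L0 [T0 H]] : exists L0 T0, forall a L T, (L0 <= L)%N -> (T0 <= T)%N ->
    \sum_(l < L) res f m p a l = \sum_(k < T + T.+1)
      inT (psi a (k%:Z - T%:Z) f m) * inY (psis a (k%:Z - T%:Z) f p).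
  have /choice[LT HLT] : forall a, exists LT : nat * nat, forall L T, (LT.1 <= L)%N ->
     (LT.2 <= T)%N -> \sum_(l < L) res f m p a l = \sum_(k < T + T.+1)
      inT (psi a (k%:Z - T%:Z) f m) * inY (psis a (k%:Z - T%:Z) f p).
    by move=> a; have [L0 [T0 H]] := sum_res f m p a; exists (L0, T0).
  exists (\max_a (LT a).1)%N, (\max_a (LT a).2)%N => a L T HL HT.
  by apply: HLT; [apply: leq_trans HL|apply: leq_trans HT]; apply: leq_bigmax.
exists L0, T0 => L T HL HT; rewrite exchange_big big_modes; apply: eq_bigr => a _ /=.
(* Of the 2T + 1 modes the first T + 1 have index at most 0 and kill f; those from 1 to T make up
   [modes T]. *)
rewrite (H a L T) // -addSnnS big_split_ord /= big1 ?add0r => [|j _]; last first.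
  rewrite (fock_low _ Ff) ?rmorph0 ?mul0r //; have := ltn_ord j; lia.
by apply: eq_bigr => j _; rewrite /cre /ann /=; congr (inT (psi _ _ _ _) * inY (psis _ _ _ _)); lia.
Qed.

Lemma fock_supp k f v : fock cre vac k f -> \sum_a v a != k%:Z -> f v = 0.
Proof.
move=> Ff; elim: Ff v => {k f} [|k [a n] f _ IH|k|k f g _ IHf _ IHg|k c f _ IH] v vk.
- rewrite /vac; case: (v =P 0) vk => // ->.
  by rewrite big1 ?eqxx // => a _; rewrite ffunE.
- rewrite /cre /= psiE IH ?linear0 ?scaler0 //; apply: contra vk => /eqP E; apply/eqP.
  have : \sum_b (v - unitv a) b = \sum_b v b - 1.
    under eq_bigr do rewrite !ffunE; rewrite sumrB; congr (_ - _).
    by rewrite (bigD1 a) //= eqxx big1 ?addr0 // => b /negPf->.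
  by rewrite E => /esym/eqP; rewrite subr_eq => /eqP->; rewrite intS addrC.
- by [].
- by rewrite fctDE IHf // IHg // addr0.
- by rewrite fctZE IH // scaler0.
Qed.

(** Away from the charges k + 1 and k - 1 all terms vanish by degree. At these charges the residue
    is a sum over [modes T], to which modes outside r contribute nothing because their contractions
    kill f. *)
Lemma bilinear_plucker k f : fock cre vac k f ->
    (forall m p, \sum_a m a = k%:Z + 1 -> \sum_a p a = k%:Z - 1 -> bilinear_eq f m p) ->
  plucker cre ann (evl (co := co)) f.
Proof.
move=> Ff Hb.
have [r1 Hr1] := fock_support (cre_ann dcomm dder du genA) (ann_vac dcomm dder du genA) Ff.
exists r1 => r ur sr [m y] [p z]; rewrite /evl /=.
suff /tensP -> : \sum_(i <- r) inT (cre i f m) * inY (ann i f p) = 0 by [].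
have [mk|mk] := eqVneq (\sum_a m a) (k%:Z + 1); last first.
  rewrite big1 // => i _; rewrite (@fock_supp k.+1) ?rmorph0 ?mul0r //.
    exact: fock_psi.
  by rewrite intS addrC.
have [pk|pk] := eqVneq (\sum_a p a) (k%:Z - 1); last first.
  rewrite big1 // => i _; have [H0 H1] := fock_psis (cre_ann dcomm dder du genA)
    (ann_vac dcomm dder du genA) Ff i.
  case: k {Ff Hb mk} pk H0 H1 => [|k] pk H0 H1.
    by rewrite H0 // rmorph0 mulr0.
  rewrite (fock_supp H1) ?rmorph0 ?mulr0 //; apply: contra pk => /eqP->.
  by rewrite /= intS addrC addKr.
have [L0 HL0] := Hb m p mk pk; have [L1 [T1 H]] := sum_res_modes m p Ff.
have [T2 HT2] : exists T2 : nat, forall i, i \in r -> (i.2 < T2)%N.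
  exists (\max_(i <- r) i.2.+1)%N => i ir.
  by rewrite (big_rem i) //= leq_maxl.
pose T := maxn T1 T2; pose L := maxn L0 L1.
have sub : {subset r <= modes T}.
  by move=> i /HT2 iT; rewrite mem_modes (leq_trans iT) // leq_maxr.
transitivity (\sum_(i <- modes T) inT (cre i f m) * inY (ann i f p)); last first.
  by rewrite -(H L T) ?leq_maxr ?leq_maxl // HL0 // leq_maxl.
rewrite [RHS](bigID (mem r)) /= [X in _ = _ + X]big1 ?addr0 => [|i ir]; last first.
  by rewrite Hr1 ?rmorph0 ?mulr0 //; apply: contra ir; exact: sr.
rewrite -[RHS]big_filter; apply: perm_big; apply: uniq_perm => //.
  exact/filter_uniq/modes_uniq.
move=> i; rewrite mem_filter; apply/idP/andP => [ir|[] //]; split=> //; exact: sub.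
Qed.

Lemma plucker_bilinear k f : fock cre vac k f -> plucker cre ann (evl (co := co)) f ->
  forall m p, bilinear_eq f m p.
Proof.
move=> Ff [r0 Hr0] m p; have [L1 [T1 H]] := sum_res_modes m p Ff.
exists L1 => L HL.
pose T := maxn T1 (\max_(i <- r0) i.2.+1)%N.
rewrite (H L T) ?leq_maxl //; apply/tensP => y z.
apply: (Hr0 (modes T) (modes_uniq T) _ (m, y) (p, z)) => i ir.
rewrite mem_modes (leq_trans _ (leq_maxr _ _)) //.
by rewrite (big_rem i) //= leq_maxl.
Qed.

End Bridge.

(** * Polynomials in two sets of variables *)

Section TwoSets.
Context {K : comNzRingType} {I : choiceType}.

Lemma mcoeff_varM {L : comNzRingType} i (f : mpol L I) m :
  (var i * f)@_m = if (0 < m i)%N then f@_(divcm m (ucm i)) else 0.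
Proof.
elim/(@malg_addind L I): f => [|f g IHf IHg|c k].
- by rewrite mulr0 !mcoeff0 if_same.
- rewrite mulrDr.
  rewrite (mcoeffD _ (var i * f)) (mcoeffD _ f).
  apply: etrans (congr2 +%R IHf IHg) _.
  case: ifP => // _.
  exact: addr0.
rewrite var_mon monM mul1r mon.unlock !mcoeffU.
case: (posnP (m i)) => mi.
  case: eqP => // mE; move: mi; rewrite -mE mulcmE ucmE eqxx; lia.
congr (_ *+ nat_of_bool _); apply/eqP/eqP => [<-|->].
  by apply/eqP/cmP => j; rewrite divcmE mulcmE ucmE addKn.
apply/eqP/cmP => j; rewrite mulcmE divcmE ucmE.
by case: eqP => [<-|_]; rewrite ?subn0 // subnKC.
Qed.

Lemma mcoeffCM {L : comNzRingType} c (f : mpol L I) m : (c%:MP * f)@_m = c * f@_m.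
Proof. by rewrite mul_malgC mpolZE. Qed.

Notation KI := (mpol K I).
Notation KII := (mpol KI I).

(** Polynomials in t and y seen as polynomials in y over those in t, so that the coefficients of
    x(t) y(y) are scalar multiples of x. *)
Definition split_gen (i : I + I) : KII :=
  match i with inl i => (var i)%:MP | inr i => var i end.

Definition split_mpol : {rmorphism mpol K (I + I)%type -> KII} :=
  meval (@malgC {cmonom I} KI \o @malgC {cmonom I} K) split_gen.

Definition merge_mpol : {rmorphism KII -> mpol K (I + I)%type} :=
  meval (@ren K I (I + I)%type inl) (fun i => var (inr i)).

Lemma split_C c : split_mpol c%:MP = c%:MP%:MP.
Proof. exact: mevalC. Qed.
Lemma split_X i : split_mpol (var i) = split_gen i.
Proof. exact: mevalX. Qed.
Lemma merge_C x : merge_mpol x%:MP = ren inl x.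
Proof. exact: mevalC. Qed.
Lemma merge_X i : merge_mpol (var i) = var (inr i).
Proof. exact: mevalX. Qed.

Lemma split_mpolK f : merge_mpol (split_mpol f) = f.
Proof.
elim/(@mpol_ind K (I + I)%type): f => [c|f g IHf IHg|i f IHf].
- by rewrite split_C merge_C renC.
- rewrite (rmorphD split_mpol) (rmorphD merge_mpol).
  exact: congr2 IHf IHg.
- rewrite (rmorphM split_mpol) (rmorphM merge_mpol).
  apply: congr2 IHf; case: i => i; rewrite split_X /=.
    by rewrite merge_C renX.
  exact: merge_X.
Qed.

Lemma split_inl x : split_mpol (ren inl x) = x%:MP.
Proof.
elim/(@mpol_ind K I): x => [c|f g IHf IHg|i f IHf].
- by rewrite renC split_C.
- rewrite (rmorphD (ren inl)) (rmorphD split_mpol).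
  apply: etrans (congr2 _ IHf IHg) _; exact: esym (raddfD (@malgC {cmonom I} _) _ _).
- rewrite (rmorphM (ren inl)) (rmorphM split_mpol) /= renX split_X.
  apply: etrans (congr2 _ erefl IHf) _; exact: esym (rmorphM (@malgC {cmonom I} _) _ _).
Qed.

Lemma mcoeff_split_inr y m : (split_mpol (ren inr y))@_m = (y@_m)%:MP.
Proof.
elim/(@mpol_ind K I): y m => [c|f g IHf IHg|i f IHf] m.
- rewrite renC split_C !mcoeffC; case: eqP => _; rewrite ?mulr1n // !mulr0n.
  exact/esym/malgC0E.
- rewrite (rmorphD (ren inr)) (rmorphD split_mpol) mcoeffD (mcoeffD _ f).
  apply: etrans (congr2 _ (IHf m) (IHg m)) _; exact: esym (raddfD (@malgC {cmonom I} _) _ _).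
- rewrite (rmorphM (ren inr)) (rmorphM split_mpol) /= renX split_X /= !mcoeff_varM.
  by case: ifP => // _; exact/esym/malgC0E.
Qed.

Lemma sum_inl_inr_eq0 (J : eqType) (r : seq J) (x y : J -> KI) :
  \sum_(j <- r) ren inl (x j) * ren inr (y j) = 0 :> mpol K (I + I)%type <->
  forall mu nu, \sum_(j <- r) (x j)@_mu * (y j)@_nu = 0.
Proof.
have E mu nu : ((split_mpol (\sum_(j <- r) ren inl (x j) * ren inr (y j)))@_nu)@_mu
    = \sum_(j <- r) (x j)@_mu * (y j)@_nu.
  rewrite rmorph_sum !raddf_sum; apply: eq_bigr => j _.
  rewrite (rmorphM split_mpol) split_inl /= mcoeffCM mcoeff_split_inr.
  by rewrite (mulrC (x j)) mcoeffCM mulrC.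
split=> [H mu nu|H]; first by rewrite -E H rmorph0 !mcoeff0.
rewrite -[LHS]split_mpolK [split_mpol _](_ : _ = 0) ?rmorph0 //.
by apply/malgP => nu; apply/malgP => mu; rewrite E H !mcoeff0.
Qed.

End TwoSets.

(** * Shifted Schur polynomials *)

Section SchurSurj.
Context {K : numFieldType} {A : comAlgType K}.
Implicit Types (u g : nat -> A).

(** Up to order N + 1, exp(x z^{N+1}) is 1 + x z^{N+1}. *)
Lemma schur_single N (x : A) l : (l <= N.+1)%N ->
  schur (fun i => if i == N.+1 then x else 0) l =
    (if l == 0%N then 1 else if l == N.+1 then x else 0).
Proof.
case: l => [|l] lN; first exact: schur0.
apply: (@scalerI _ A l.+1%:R); first by rewrite pnatr_eq0.
rewrite schur_flow big_ord_recr /= subnn schur0 mulr1 eqSS big1 ?add0r => [|i _].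
  by case: eqP.
rewrite eqSS; case: eqP => [iN|_]; last by rewrite mul0r scaler0.
by have := ltn_ord i; lia.
Qed.

(** Adding x to u_{N+1} leaves s_0, ..., s_N unchanged and adds x to s_{N+1}, so the values can be
    prescribed one after another. *)
Lemma schur_surj g N : g 0%N = 1 ->
  exists u, forall k, (k <= N)%N -> schur u k = g k.
Proof.
move=> g0; elim: N => [|N [u IH]].
  by exists (fun=> 0) => k; rewrite leqn0 => /eqP->; rewrite schur0.
pose x := g N.+1 - schur u N.+1.
exists (fun i => (if i == N.+1 then x else 0) + u i) => k kN.
rewrite -schur_sum big_ord_recl schur0 mul1r subn0.
have [->|kN'] := eqVneq k N.+1; last first.
  rewrite big1 ?addr0 => [|i _]; first by apply: IH; move: kN kN'; lia.
  rewrite schur_single /=; last by have := ltn_ord i; rewrite /bump; lia.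
  rewrite ifF ?mul0r //; apply/negP; have := ltn_ord i; move: kN kN'.
  by rewrite /bump /=; lia.
rewrite big_ord_recr big1 ?add0r => [|i _]; last first.
  rewrite schur_single /=; last by have := ltn_ord i; rewrite /bump; lia.
  rewrite ifF ?mul0r //; apply/negP; have := ltn_ord i.
  by rewrite /bump /=; lia.
by rewrite schur_single //= /bump add1n eqxx subnn schur0 mulr1 /x add0r addrC subrK.
Qed.

End SchurSurj.

Section Columns.
Context {K : numFieldType} {A : comAlgType K}.

Lemma schur_shift (u : nat -> A) (c : nat -> K^o) M :
  schur (fun k => u k + (c k : K)%:A) M =
  \sum_(i < M.+1) (schur c (M - i)%N : K) *: schur u i.
Proof.
rewrite -schur_sum; apply: eq_bigr => i _.
have := schur_morph (in_alg A : {rmorphism K^o -> A}) c (M - i)%N.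
by move=> <- /=; rewrite -scalerAr mulr1.
Qed.

Lemma shifted_schur (u : nat -> A) (w : nat -> K) N :
  exists (M : nat) (b : K) (c : nat -> K) (e : K), (0 < M)%N /\
    b *: schur (fun k => u k + (c k)%:A) M
    = \sum_(k < N) w k *: schur u k.+1 + e%:A.
Proof.
elim: N => [|N IHN].
  (* The zero combination still needs a positive index M: take M = 1 and b = 0. *)
  by exists 1%N, 0, (fun=> 0), 0; split; rewrite // big_ord0 !scale0r addr0.
have [wN|wN] := eqVneq (w N) 0.
  have [M [b [c [e [M0 E]]]]] := IHN.
  by exists M, b, c, e; split; rewrite // big_ord_recr /= wN scale0r addr0.
(* The coefficient of s_{k+1}(u) in s_{N+1}(u + c) is s_{N-k}(c), which has to equal w_k / w_N. *)
pose g k : K^o := if k == 0%N then 1 else w (N - k)%N / w N.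
have [c cg] := @schur_surj K K^o g N erefl.
exists N.+1, (w N), c, (w N * (schur c N.+1 : K)); split=> //.
rewrite schur_shift big_ord_recl subn0 schur0 scalerDr scalerA addrC scaler_sumr.
congr (_ + _); apply: eq_bigr => k _; rewrite scalerA lift0.
rewrite subSS cg ?leq_subr // /g; have := ltn_ord k; rewrite ltnS => kN.
case: eqP => [E|E]; first by rewrite mulr1; congr (w _ *: _); lia.
by rewrite subKn // mulrC divfK.
Qed.

Context {s : nat} {u : 'I_s -> nat -> A}.
Notation spanS := (@spanS K A s u).

Lemma spanS_coord x : spanS x -> exists N (w : 'I_s -> nat -> K),
  x = \sum_a \sum_(k < N) w a k *: schur (u a) k.+1.
Proof.
move=> [r [c ->]]; exists (\max_(i <- r) i.2.+1)%N.
exists (fun a k => \sum_(i <- r | i == (a, k)) c i).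
rewrite pair_big /=; under [RHS]eq_bigr do rewrite scaler_suml.
rewrite (exchange_big_dep predT) //= big_seq [RHS]big_seq; apply: eq_bigr => -[a k] ir.
have kN : (k < \max_(i <- r) i.2.+1)%N by rewrite (big_rem (a, k)) //= leq_maxl.
by rewrite (big_pred1 (a, Ordinal kN)).
Qed.

Lemma shifted_schur_column x : spanS x ->
  exists (M : 'I_s -> nat) (b : 'I_s -> K) (c : 'I_s -> nat -> K),
    (forall a, 0 < M a)%N /\
    exists e : K, \sum_a b a *: schur (fun k => u a k + (c a k)%:A) (M a) = x + e%:A.
Proof.
move/spanS_coord => [N [w ->]].
have /choice[D HD] a : exists D : nat * K * (nat -> K) * K, (0 < D.1.1.1)%N /\
    D.1.1.2 *: schur (fun k => u a k + (D.1.2 k)%:A) D.1.1.1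
    = \sum_(k < N) w a k *: schur (u a) k.+1 + D.2%:A.
  by have [M [b [c [e H]]]] := shifted_schur (u a) (w a) N; exists (M, b, c, e).
exists (fun a => (D a).1.1.1), (fun a => (D a).1.1.2), (fun a => (D a).1.2).
split=> [a|]; first by case: (HD a).
exists (\sum_a (D a).2); rewrite scaler_suml -big_split; apply: eq_bigr => a _.
by case: (HD a).
Qed.

Lemma spanS_shifted (M : 'I_s -> nat) (b : 'I_s -> K) (c : 'I_s -> nat -> K) :
    (forall a, 0 < M a)%N ->
  exists (e : K) x, \sum_a b a *: schur (fun k => u a k + (c a k)%:A) (M a) = x + e%:A
    /\ spanS x.
Proof.
move=> M0; pose w a k := b a * (schur (c a : nat -> K^o) (M a - k.+1)%N : K).
exists (\sum_a b a * (schur (c a : nat -> K^o) (M a) : K)).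
exists (\sum_a \sum_(k < M a) w a k *: schur (u a) k.+1); split.
  rewrite scaler_suml -big_split; apply: eq_bigr => a _ /=.
  rewrite (schur_shift (u a) (c a)) big_ord_recl subn0 schur0 scalerDr scalerA addrC.
  by rewrite scaler_sumr; congr (_ + _); apply: eq_bigr => k _; rewrite scalerA.
exists [seq (a, k) | a <- enum 'I_s, k <- iota 0 (M a)], (fun i => w i.1 i.2).
rewrite big_allpairs_dep big_enum; apply: eq_bigr => a _ /=.
by rewrite -[X in iota 0 X]subn0 -/(index_iota 0 (M a)) big_mkord.
Qed.

End Columns.

(** * The multicomponent KP hierarchy *)

Section ScaledDiff.
Context {K : comNzRingType} {V W : lmodType K} (c : K) (f g : {linear V -> W}).
Definition scaled_diff x := c *: (f x - g x).
Lemma scaled_diff_is_linear : linear scaled_diff.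
Proof.
move=> k x y; rewrite /scaled_diff (linearP f) (linearP g) /= opprD addrACA -scalerBr scalerDr.
by rewrite scaleCA.
Qed.
HB.instance Definition _ := GRing.isLinear.Build K V W *:%R scaled_diff
  scaled_diff_is_linear.
End ScaledDiff.

Lemma scaled_diff_comm {K : comNzRingType} {V : lmodType K} (c c' : K)
    (f g f' g' : {linear V -> V}) :
    (forall x, f (f' x) = f' (f x)) -> (forall x, f (g' x) = g' (f x)) ->
    (forall x, g (f' x) = f' (g x)) -> (forall x, g (g' x) = g' (g x)) ->
  forall x, scaled_diff c f g (scaled_diff c' f' g' x)
          = scaled_diff c' f' g' (scaled_diff c f g x).
Proof.
move=> ff' fg' gf' gg' x; rewrite /scaled_diff (linearZZ f) (linearZZ g).
rewrite (linearZZ f') (linearZZ g') -!scalerBr scaleCA; congr (_ *: (_ *: _)).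
rewrite (linearB f) (linearB g) (linearB f') (linearB g') ff' fg' gf' gg' !opprB.
by rewrite addrACA [RHS]addrACA [- _ + _]addrC.
Qed.

Lemma scaled_diffM {K : comNzRingType} {A : comAlgType K} (c : K) (f g : {linear A -> A})
    x y : leibniz f x y -> leibniz g x y -> leibniz (scaled_diff c f g) x y.
Proof.
rewrite /leibniz /= /scaled_diff => -> ->; rewrite -scalerAl -scalerAr -scalerDr.
by congr (_ *: _); rewrite mulrBl mulrBr opprD addrACA.
Qed.

Section Concrete.
Variables (R : realType) (s : nat).
Notation K := (R[i] : numFieldType).
Notation tidx := ('I_s * nat)%type.
Notation Ct := (mpol R[i] tidx).
Notation Cty := (mpol R[i] (tidx + tidx)%type).

(** Numbered from 1 like [tvar]; index 0 duplicates index 1. *)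
Definition tder (a : 'I_s) (i : nat) : {linear Ct -> Ct} := pder (a, i.-1).

Lemma tder_comm a b i j x : tder a i (tder b j x) = tder b j (tder a i x).
Proof. exact: pder_comm. Qed.

Lemma tderM a i (f g : Ct) : leibniz (tder a i) f g.
Proof. exact: pderM. Qed.

Lemma tder_tvar a b i k : tder a i.+1 (tvar R b k.+1) = ((a == b) && (i == k))%:R.
Proof. exact: pder_var. Qed.

Lemma Ct_ind (T : Ct -> Prop) : (forall c : K, T c%:A) ->
  (forall f g, T f -> T g -> T (f + g)) ->
  (forall a k f, T f -> T (tvar R a k.+1 * f)) -> forall f, T f.
Proof.
move=> TC TD TX f; elim/(@mpol_ind R[i] tidx): f => [c|f g|[a k] f].
- by rewrite -[c%:MP]mulr1 mul_malgC; exact: TC.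
- exact: TD.
- exact: TX.
Qed.

Definition tco (m : {cmonom tidx}) : {scalar Ct} := mcoeff m.

Lemma tcoP f : (forall m, tco m f = 0) -> f = 0.
Proof. by move=> f0; apply/malgP => m; rewrite mcoeff0; exact: f0. Qed.

Definition inT : {rmorphism Ct -> Cty} := ren inl.
Definition inY : {rmorphism Ct -> Cty} := ren inr.

Definition tydiff (a : 'I_s) (i : nat) : {linear Cty -> Cty} :=
  scaled_diff (i%:R^-1 : R[i]) (pder (inr (a, i.-1))) (pder (inl (a, i.-1))).

Lemma tydiff_comm a i j x : tydiff a i (tydiff a j x) = tydiff a j (tydiff a i x).
Proof.
by apply: scaled_diff_comm => y; exact: pder_comm.
Qed.

Lemma tydiffM a i f g : leibniz (tydiff a i) f g.
Proof.
by apply: scaled_diffM; exact: pderM.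
Qed.

Lemma tydiff_inT a i x : tydiff a i.+1 (inT x) = - (i.+1%:R^-1 *: inT (tder a i.+1 x)).
Proof.
transitivity ((i.+1%:R^-1 : K) *:
    (pder (inr (a, i)) (ren inl x) - pder (inl (a, i)) (ren inl x) : Cty)).
  by [].
have -> : pder (inr (a, i)) (ren inl x) = 0 :> Cty by exact: pder_ren0.
have -> : pder (inl (a, i)) (ren inl x) = ren inl (pder (a, i) x) :> Cty.
  by apply: pder_ren => j k [].
by rewrite sub0r scalerN.
Qed.

Lemma tydiff_inY a i x : tydiff a i.+1 (inY x) = i.+1%:R^-1 *: inY (tder a i.+1 x).
Proof.
transitivity ((i.+1%:R^-1 : K) *:
    (pder (inr (a, i)) (ren inr x) - pder (inl (a, i)) (ren inr x) : Cty)).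
  by [].
have -> : pder (inl (a, i)) (ren inr x) = 0 :> Cty by exact: pder_ren0.
have -> : pder (inr (a, i)) (ren inr x) = ren inr (pder (a, i) x) :> Cty.
  by apply: pder_ren => j k [].
by rewrite subr0.
Qed.

Lemma inTZ (c : K) x : inT (c *: x) = c *: inT x.
Proof. exact: (linearZZ (ren inl)). Qed.

Lemma inYZ (c : K) x : inY (c *: x) = c *: inY x.
Proof. exact: (linearZZ (ren inr)). Qed.

Lemma tensP (J : eqType) (r : seq J) (x y : J -> Ct) :
  \sum_(j <- r) inT (x j) * inY (y j) = 0 <->
  forall mu nu, \sum_(j <- r) tco mu (x j) * tco nu (y j) = 0.
Proof. exact: sum_inl_inr_eq0. Qed.

Notation bilinear_eq := (@bilinear_eq K Ct s (@tvar R s) Cty inT inY tydiff).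
Notation res := (@res K Ct s (@tvar R s) Cty inT inY tydiff).

Lemma exp_tyE a j : exp_ty R a j = schurz (ty (u := @tvar R s) (inT := inT) (inY := inY) a) j.
Proof.
case: j => n; last by [].
rewrite /exp_ty /schurz.
apply: (@eq_schur K Cty) => i.
rewrite /ty /tyt /tyy /inT /inY /tvar.
by congr (_ - _); exact/esym/renX.
Qed.

Lemma dtyopE (a : 'I_s) f : dtyop a f = psop (tydiff a) f.
Proof.
have pderE i x : pderiv i x = pder i x :> Cty by rewrite pder.unlock.
apply: funext => l; apply: eq_bigr => i _; rewrite !pderE.
exact: erefl.
Qed.

Lemma res_termE (tau : Cqt R s) m p a l : res_term tau m p a l = res (fun v => tau@_v) m p a l.
Proof.
have Es : (-1 : R[i]) ^ (\sum_(b < s | (b < a)%N) (m b + p b)) = sg a m * sg a p.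
  by rewrite big_split /= expfzDr ?oppr_eq0 ?oner_eq0.
have Et : psexp (dtyop a) (psconst (in_t (tau@_(m - unitv a)) * in_y (tau@_(p + unitv a)))) l
    = taylor (tydiff a) l (inT (tau@_(m - unitv a)) * inY (tau@_(p + unitv a))).
  rewrite /taylor (_ : dtyop a = psop (tydiff a)); last by apply: funext => f; exact: dtyopE.
  have renE' (r : tidx -> tidx + tidx) (x : Ct) : rename r x = ren r x by rewrite ren.unlock.
  by rewrite /in_t /in_y !renE'.
exact: (congr2 (fun (k : R[i]) (x : Cty) => k *: x) Es
  (congr2 (fun x y : Cty => x * y) (exp_tyE a _) Et)).
Qed.

Lemma kp_bilinearE (tau : Cqt R s) m p : kp_bilinear tau m p <-> bilinear_eq (fun v => tau@_v) m p.
Proof.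
have E L : \sum_(l < L) \sum_(a < s) res_term tau m p a l
    = \sum_(l < L) \sum_(a < s) res (fun v => tau@_v) m p a l.
  by apply: eq_bigr => l _; apply: eq_bigr => a _; exact: res_termE.
by split=> -[L0 H]; exists L0 => L LL; [rewrite -E|rewrite E]; exact: H.
Qed.

End Concrete.

Section Coefficients.
Variables (R : realType) (s : nat).
Notation K := (R[i] : numFieldType).
Notation tidx := ('I_s * nat)%type.
Notation Ct := (mpol R[i] tidx).
Notation detV := (@detV K Ct s (@tder R s)).

Lemma mcoeff_lattice_shift (d v : lattice s) (tau : Cqt R s) :
  (lattice_shift d tau)@_v = tau@_(v - d).
Proof.
rewrite /lattice_shift raddf_sum /=.
under eq_bigr => w _ do rewrite mcoeffU.
have shiftE w : (w + d == v) = (w == v - d) by rewrite -subr_eq opprK.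
case: (msuppP tau (v - d)) => [wm|wm].
  rewrite (big_fsetD1 _ wm) /= shiftE eqxx mulr1n big1_fset ?addr0 // => w.
  by rewrite in_fsetD1 shiftE => /andP[/negPf-> _].
rewrite big1_fset // => w ws _; rewrite shiftE.
by case: eqP => // wE; rewrite -wE ws in wm.
Qed.

Context {m : nat} (M : 'I_m -> 'I_s -> nat) (b : 'I_m -> 'I_s -> R[i]).
Context (c : 'I_m -> 'I_s -> nat -> R[i]).

Lemma tau_rowsE mu : tau_rows M b c mu =
  [seq (fun j => f (hfun M b c j)) | f <- orows (d := @tder R s) mu].
Proof.
rewrite /orows /blocks -map_comp map_allpairs /tau_rows.
apply: eq_allpairs => a k; apply: funext => j.
rewrite /rowop /=; elim: k => //= k ->; by rewrite pder.unlock.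
Qed.

Lemma tau_detE mu : tau_det M b c mu = opdet (orows (d := @tder R s) mu) (hfun M b c).
Proof. by rewrite opdet_rdet -tau_rowsE. Qed.

Lemma mcoeff_tau_m v : (tau_m M b c)@_v = detV (hfun M b c) v.
Proof.
rewrite /tau_m raddf_sum /=; under eq_bigr => mu _ do rewrite mcoeffU tau_detE.
rewrite /detV; have [/andP[vp /eqP vm]|vn] := ifPn.
  have vabs := sum_absz vp vm.
  have vle a : (absz (v a) < m.+1)%N by rewrite ltnS -[X in (_ <= X)%N]vabs (bigD1 a) //= leq_addr.
  (* The only block sizes contributing at v are its coordinates, which are at most m because they
     are non-negative with sum m. *)
  pose nu : {ffun 'I_s -> 'I_m.+1} := [ffun a => Ordinal (vle a)].
  rewrite (bigD1 nu) /=; last by rewrite -[X in _ == X]vabs; apply/eqP/eq_bigr => a _; rewrite ffunE.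
  rewrite [X in _ + X]big1 ?addr0 => [|mu /andP[_ munu]]; last first.
    case: eqP => // E; case/eqP: munu; apply/ffunP => a; apply/val_inj.
    by rewrite /= ffunE /= -E ffunE.
  have -> : [ffun a => (nu a : nat)%:Z] = v.
    by apply/ffunP => a; rewrite !ffunE /= gez0_abs //; move/forallP: vp.
  rewrite eqxx mulr1n; congr (opdet (orows _) _).
  by apply: funext => a; rewrite ffunE.
rewrite big1 // => mu /eqP mum; case: eqP => // E; case/negP: vn; rewrite -E.
apply/andP; split; first by apply/forallP => a; rewrite ffunE.
apply/eqP; transitivity (\sum_a (mu a : nat)%:Z); first by apply: eq_bigr => a _; rewrite ffunE.
by rewrite -[in RHS]mum -[RHS]natz natr_sum; apply: eq_bigr => a _; rewrite natz.
Qed.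

End Coefficients.

Section Final.
Variables (R : realType) (s : nat).
Notation K := (R[i] : numFieldType).
Notation tidx := ('I_s * nat)%type.
Notation Ct := (mpol R[i] tidx).
Notation Cty := (mpol R[i] (tidx + tidx)%type).
Notation detV := (@detV K Ct s (@tder R s)).
Notation dcomm := (@tder_comm R s).
Notation dder := (@tderM R s).
Notation du := (@tder_tvar R s).
Notation genA := (@Ct_ind R s).
Notation cre := (cre dcomm dder du genA).
Notation bilinear_eq :=
  (@bilinear_eq K Ct s (@tvar R s) Cty (@inT R s) (@inY R s) (@tydiff R s)).
Notation spanS := (@spanS K Ct s (@tvar R s)).

Lemma hfunE m (M : 'I_m -> 'I_s -> nat) (b : 'I_m -> 'I_s -> R[i])
    (c : 'I_m -> 'I_s -> nat -> R[i]) j :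
  hfun M b c j = \sum_a b j a *: schur (fun k => tvar R a k + (c j a k)%:A) (M j a).
Proof.
have cE (x : R[i]) : x%:MP = x%:A :> Ct by rewrite -[LHS]mulr1 mul_malgC.
apply: eq_bigr => a _; apply: (congr1 (fun x : Ct => b j a *: x)).
by apply: (@eq_schur K Ct) => k; rewrite cE.
Qed.

Lemma hfun_spanS m (M : 'I_m -> 'I_s -> nat) (b : 'I_m -> 'I_s -> R[i])
    (c : 'I_m -> 'I_s -> nat -> R[i]) j : (forall a, 0 < M j a)%N ->
  exists (e : K) x, hfun M b c j = x + e%:A /\ spanS x.
Proof. by move=> M0; rewrite hfunE; exact: (@spanS_shifted K Ct s (@tvar R s)). Qed.

Lemma pure_bilinear m f : pure cre vac m f -> forall p q, bilinear_eq f p q.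
Proof.
move=> pf; apply: (plucker_bilinear (co := @tco R s) (@inTZ R s) (@inYZ R s) (@tydiff_comm R s)
  (@tydiffM R s) (@tydiff_inT R s) (@tydiff_inY R s) (@tensP R s) (pure_fock pf)).
apply: pure_plucker pf.
- exact: (evlP (@tcoP R s)).
- exact: cre_ann.
- exact: creC.
- exact: ann_vac.
Qed.

Lemma tau_m_polynomial d m (M : 'I_m -> 'I_s -> nat) b c :
    (forall j a, 0 < M j a)%N -> lattice_shift d (tau_m M b c) != 0 :> Cqt R s ->
  polynomial_tau (lattice_shift d (tau_m M b c)).
Proof.
move=> M0 tau0; split=> //; exists (m%:Z + \sum_a d a).
pose f := detV (hfun M b c).
have coefE : (fun v => (lattice_shift d (tau_m M b c))@_v) = shift d f.
  by apply: funext => v; rewrite mcoeff_lattice_shift mcoeff_tau_m.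
have pf : pure cre vac m f by apply: detV_pure => j; exact: hfun_spanS.
split=> [v vk|p q _ _].
  rewrite -[LHS]/((fun v => (lattice_shift d (tau_m M b c))@_v) v) coefE.
  apply: (fock_supp (pure_fock pf)); apply: contra vk => /eqP <-; apply/eqP.
  rewrite -big_split; apply: eq_bigr => a _ /=.
  by rewrite !ffunE subrK.
(* Shift invariance reduces to the unshifted determinant, for which the equation holds at all pairs
   of lattice points. *)
rewrite kp_bilinearE coefE -[p](subrK d) -[q](subrK d) bilinear_eq_shift.
exact: pure_bilinear pf _ _.
Qed.

Lemma bilinear_pure m f : fock cre vac m f -> f != 0 ->
    (forall p q : lattice s, \sum_a p a = m%:Z + 1 -> \sum_a q a = m%:Z - 1 -> bilinear_eq f p q) ->
  pure cre vac m f.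
Proof.
move=> Ff f0 Hb; apply: (plucker_pure _ _ _ _ Ff f0).
- exact: (evlP (@tcoP R s)).
- exact: cre_ann.
- exact: creC.
- exact: ann_vac.
exact: (bilinear_plucker (co := @tco R s) (@inTZ R s) (@inYZ R s) (@tydiff_comm R s)
  (@tydiffM R s) (@tydiff_inT R s) (@tydiff_inY R s) (@tensP R s) Ff Hb).
Qed.

Lemma spanSZ (e : K) x : spanS x -> spanS (e *: x).
Proof.
move=> [r [w ->]]; exists r, (fun i => e * w i); rewrite scaler_sumr.
by apply: eq_bigr => i _; rewrite scalerA.
Qed.

(** The scalar in front of the determinant is absorbed into the first column, which exists as m > 0.
    The constants left by [shifted_schur_column] do not affect the determinant. *)
Lemma pure_hfun m f : (0 < m)%N -> pure cre vac m f ->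
  exists (M : 'I_m -> 'I_s -> nat) (b : 'I_m -> 'I_s -> R[i])
    (c : 'I_m -> 'I_s -> nat -> R[i]),
    (forall j a, 0 < M j a)%N /\ f = detV (hfun M b c).
Proof.
case: m => // m _ /pure_detV[e [h [-> hS]]].
pose h' := fcons (e *: h ord0) (fun j => h (lift ord0 j)).
have -> : e *: detV h = detV h'.
  rewrite [in LHS](fcons_eta h).
  exact: esym (linearZZ (@detl K Ct s (@tder R s) m (fun j => h (lift ord0 j))) e (h ord0)).
have h'S j : spanS (h' j).
  by rewrite /h' /fcons; case: unliftP => [i|] _; [|apply: spanSZ]; apply: hS.
have /choice[D HD] j : exists D : ('I_s -> nat) * ('I_s -> R[i]) * ('I_s -> nat -> R[i]),
    (forall a, 0 < D.1.1 a)%N /\ exists e : K,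
    \sum_a D.1.2 a *: schur (fun k => tvar R a k + (D.2 a k)%:A) (D.1.1 a)
      = h' j + e%:A :> Ct.
  by have [M [b [c H]]] := @shifted_schur_column K Ct s (@tvar R s) _ (h'S j);
    exists (M, b, c).
exists (fun j => (D j).1.1), (fun j => (D j).1.2), (fun j => (D j).2).
split=> [j|]; first by case: (HD j).
symmetry; apply: (eq_detV_const dder) => j.
by rewrite hfunE; case: (HD j).
Qed.

Lemma polynomial_tau_m (s_gt0 : (0 < s)%N) (tau : Cqt R s) : polynomial_tau tau ->
  exists (d : lattice s) (m : nat) (M : 'I_m -> 'I_s -> nat)
         (b : 'I_m -> 'I_s -> R[i]) (c : 'I_m -> 'I_s -> nat -> R[i]),
    [/\ (0 < m)%N, (forall j a, (0 < M j a)%N) & tau = lattice_shift d (tau_m M b c)].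
Proof.
move=> [tau0 [k [Hk Hb]]]; pose f v := tau@_v; pose a0 := Ordinal s_gt0.
have supp v : v \notin (msupp tau : seq _) -> f v = 0 by move/mcoeff_outdom.
have charge v : f v != 0 -> \sum_a v a = k.
  by apply: contra_neq_eq => /Hk.
have [e [m [mE Fm]]] := fock_surj dcomm dder du genA a0 (fset_uniq (msupp tau)) supp charge.
(* One further shift makes the degree positive, as the number of columns must be. *)
have := fock_shift1 a0 Fm; set g := shift _ _ => Fg.
pose e' : lattice s := nvec e + unitv a0.
have gE v : g v = f (v - e') by rewrite /g /shift opprD addrA addrAC.
have g0 : g != 0.
  apply: contra_neq tau0 => g0; apply/malgP => v; rewrite mcoeff0.
  by have := gE (v + e'); rewrite addrK g0.
have e'E : \sum_a e' a = m.+1%:Z - k.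
  have -> : m.+1%:Z - k = (\sum_a e a)%N%:Z + 1 by rewrite intS mE; lia.
  have e'a a : e' a = (e a)%:Z + (a == a0)%:R by rewrite !ffunE.
  rewrite (eq_bigr _ (fun a _ => e'a a)) big_split /=; congr (_ + _).
    by rewrite -[RHS]natz natr_sum; apply: eq_bigr => a _; rewrite natz.
  by rewrite (bigD1 a0) //= big1 ?addr0 // => a /negPf->.
have sumB (p : lattice s) : \sum_a (p - e') a = \sum_a p a - \sum_a e' a.
  by rewrite -sumrB; apply: eq_bigr => a _; rewrite !ffunE.
have gsh : g = shift e' f by apply: funext.
have pg : pure cre vac m.+1 g.
  apply: (bilinear_pure Fg g0) => p q pk qk.
  rewrite gsh -[p](subrK e') -[q](subrK e') bilinear_eq_shift -kp_bilinearE.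
  by apply: Hb; rewrite sumB e'E ?pk ?qk; lia.
have [M [b [c [M0 gdet]]]] := pure_hfun (ltn0Sn m) pg.
exists (- e'), m.+1, M, b, c; split=> //; apply/malgP => v.
rewrite mcoeff_lattice_shift opprK mcoeff_tau_m.
by transitivity (g (v + e')); [rewrite gE addrK | rewrite gdet].
Qed.

End Final.

Theorem theorem4 (R : realType) (s : nat) (s_gt0 : (0 < s)%N) :
  (forall tau : Cqt R s, polynomial_tau tau ->
     exists (d : lattice s) (m : nat) (M : 'I_m -> 'I_s -> nat)
            (b : 'I_m -> 'I_s -> R[i]) (c : 'I_m -> 'I_s -> nat -> R[i]),
       [/\ (0 < m)%N, (forall j a, (0 < M j a)%N)
         & tau = lattice_shift d (tau_m M b c)]) /\
  (forall (d : lattice s) (m : nat) (M : 'I_m -> 'I_s -> nat)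
          (b : 'I_m -> 'I_s -> R[i]) (c : 'I_m -> 'I_s -> nat -> R[i]),
     (0 < m)%N -> (forall j a, (0 < M j a)%N) ->
     lattice_shift d (tau_m M b c) != 0 ->
     polynomial_tau (lattice_shift d (tau_m M b c))).
Proof.
split=> [tau|d m M b c _]; [exact: polynomial_tau_m | exact: tau_m_polynomial].
Qed.
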